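(* Let $(M_1,g_1)$, $(M_2,g_2)$ be pseudo-Riemannian manifolds of positive dimensions $n_1,n_2$, $n=n_1+n_2$, let $f,\varphi:M_1\times M_2\to(0,\infty)$ be smooth, and let $M=M_1\times M_2$ with $g=g_1\oplus f^2g_2$, $k=\ln f$, $\sigma=\ln\varphi$, $\omega=k+\sigma$, $g_L=e^{2\sigma}g$. Let $Z=Z_1+Z_2$, where $Z_1,Z_2$ are the canonical lifts to $M$ of vector fields on $M_1,M_2$; let $\lambda\in C^\infty(M)$, $\rho\in\mathbb R$, $\Lambda=\lambda+\rho R^L$ and $\Theta_\sigma=\Delta\sigma+(n-2)|\nabla\sigma|_g^2$. Then $$\operatorname{Ric}^L+\tfrac12\mathcal L_Zg_L=(\lambda+\rho R^L)g_L$$ holds on $M$ if and only if the following three conditions hold. (i) For all horizontal lifts $X,Y$ of vector fields on $M_1$, $$\operatorname{Ric}_1(X,Y)-n_2[\operatorname{Hess}_1k(X,Y)+X(k)Y(k)]-(n-2)[\operatorname{Hess}_1\sigma(X,Y)-X(\sigma)Y(\sigma)]+\tfrac{e^{2\sigma}}2(\mathcal L_{Z_1}g_1)(X,Y)=\big[e^{2\sigma}(\Lambda-Z(\sigma))+\Theta_\sigma\big]g_1(X,Y).$$ (ii) For all vertical lifts $U,V$ of vector fields on $M_2$, $$\operatorname{Ric}(U,V)-(n-2)[\operatorname{Hess}\sigma(U,V)-U(\sigma)V(\sigma)]+\tfrac{e^{2\sigma}f^2}2(\mathcal L_{Z_2}g_2)(U,V)=f^2\big[e^{2\sigma}(\Lambda-Z(\omega))+\Theta_\sigma\big]g_2(U,V),$$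 where $$\operatorname{Ric}(U,V)=\operatorname{Ric}_2(U,V)-(n_2-2)[\operatorname{Hess}_2k(U,V)-U(k)V(k)]-[\Delta_2k+(n_2-2)|\nabla_2k|_{g_2}^2]g_2(U,V)-f^2[\Delta_1k+n_2|\nabla_1k|_{g_1}^2]g_2(U,V)$$ and $$\operatorname{Hess}\sigma(U,V)=\operatorname{Hess}_2\sigma(U,V)-U(k)V(\sigma)-V(k)U(\sigma)+g_2(U,V)\langle\nabla_2k,\nabla_2\sigma\rangle_{g_2}+f^2g_2(U,V)\langle\nabla_1k,\nabla_1\sigma\rangle_{g_1}.$$ (iii) For all horizontal lifts $X$ and vertical lifts $U$, $$(n_2-1)XU(k)+(n-2)\big[XU(\sigma)-X(k)U(\sigma)-X(\sigma)U(\sigma)\big]=0.$$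
   Context: All objects are smooth; $g_1,g_2$ also denote the pull-backs to $M$. $\operatorname{Ric}^L,R^L$ are the Ricci tensor and scalar curvature of the Levi-Civita connection of $g_L$ (sign convention: round spheres have positive Ricci curvature). $\operatorname{Ric}$, $\nabla$, $\operatorname{Hess}$, $\Delta$ (trace of the Hessian) and $|\cdot|_g^2$ refer to $g$; $\operatorname{Ric}_i$ is the Ricci tensor of $g_i$. For $h\in C^\infty(M)$, $\nabla_ih,\operatorname{Hess}_ih,\Delta_ih$ are the partial gradient, Hessian and Laplacian on the factor $(M_i,g_i)$ with the variable of the other factor held fixed. Squared norms mean $|v|^2=\langle v,v\rangle$ (possibly indefinite). $XU(h)$ means $X(U(h))$; lifts satisfy $[X,U]=0$. $\mathcal L$ is the Lie derivative. *)

(* Defs.v *)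
From HB Require Import structures.
From mathcomp Require Import all_boot all_order all_algebra.
From mathcomp Require Import all_classical all_reals all_analysis.
From mathcomp Require Import ring.
Import Order.TTheory GRing.Theory Num.Theory.
Import numFieldNormedType.Exports.

Set Implicit Arguments.
Unset Strict Implicit.
Unset Printing Implicit Defensive.

Local Open Scope classical_set_scope.
Local Open Scope ring_scope.

Section smooth_maps.
Context {R : realType} {V W : normedModType R}.

(* Only used on open sets D, where 'D_v f at a point of D depends on f|_D only. *)
Fixpoint Ck (k : nat) (D : set V) (f : V -> W) : Prop :=
  if k is k'.+1 then
    (forall x, D x -> differentiable f x) /\ (forall v, Ck k' D ('D_v f))
  else forall x, D x -> {for x, continuous f}.

Definition smooth_on (D : set V) (f : V -> W) : Prop := forall k, Ck k D f.

End smooth_maps.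

(* The data of an atlas: [icoord c] is meaningful on the open set
   [coord c @` dom c] only, where it is the inverse of [coord c]. *)
Record atlas (R : realType) (n : nat) (M : topologicalType) := Atlas {
  idx : Type;
  dom : idx -> set M;
  coord : idx -> M -> 'rV[R]_n;
  icoord : idx -> 'rV[R]_n -> M }.

Arguments idx {R n M} A : rename.
Arguments dom {R n M} A c : rename.
Arguments coord {R n M} A c : rename.
Arguments icoord {R n M} A c : rename.

Section manifold.
Context {R : realType} {n : nat} {M : topologicalType} (A : atlas R n M).

Definition cimage (c : idx A) : set 'rV[R]_n := coord A c @` dom A c.

Definition transition (c c' : idx A) : 'rV[R]_n -> 'rV[R]_n :=
  coord A c' \o icoord A c.

Record smooth_manifold : Prop := SmoothManifold {
  manifold_hausdorff : hausdorff_space M;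
  manifold_second_countable : @second_countable M;
  atlas_cover : forall p, exists c, dom A c p;
  dom_open : forall c, open (dom A c);
  cimage_open : forall c, open (cimage c);
  coordK : forall c p, dom A c p -> icoord A c (coord A c p) = p;
  coord_continuous : forall c p, dom A c p -> {for p, continuous (coord A c)};
  icoord_continuous :
    forall c x, cimage c x -> {for x, continuous (icoord A c)};
  transition_smooth : forall c c',
    smooth_on (coord A c @` (dom A c `&` dom A c')) (transition c c') }.

Definition smooth_fun (h : M -> R) : Prop :=
  forall c, smooth_on (cimage c) (h \o icoord A c).

(* A vector field, resp. a covariant 2-tensor field, is the family of its
   components in the charts of the atlas: the values at the chart c and the
   point p matter for p in [dom A c] only.  Tangent vectors are row vectors. *)
Definition vfield := idx A -> M -> 'rV[R]_n.
Definition tensor2 := idx A -> M -> 'M[R]_n.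

Definition transition_jacobian (c c' : idx A) (p : M) : 'M[R]_n :=
  'J (transition c c') (coord A c p).

Record smooth_vfield (X : vfield) : Prop := SmoothVfield {
  vfield_smooth : forall c,
    smooth_on (cimage c) (fun x => X c (icoord A c x));
  vfield_transition : forall c c' p, dom A c p -> dom A c' p ->
    X c' p = X c p *m transition_jacobian c c' p }.

Record pseudo_riemannian (g : tensor2) : Prop := PseudoRiemannian {
  metric_smooth : forall c i j,
    smooth_on (cimage c) (fun x => g c (icoord A c x) i j);
  metric_transition : forall c c' p, dom A c p -> dom A c' p ->
    g c p = transition_jacobian c c' p *m g c' p
            *m (transition_jacobian c c' p)^T;
  metric_sym : forall c p, dom A c p -> (g c p)^T = g c p;
  metric_nondegenerate : forall c p, dom A c p -> g c p \in unitmx }.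

(* T(X,Y) at p, computed in the chart c *)
Definition ev2 (T : tensor2) (X Y : vfield) (c : idx A) (p : M) : R :=
  (X c p *m T c p *m (Y c p)^T) 0 0.

(* X(h) at p, computed in the chart c *)
Definition der (X : vfield) (h : M -> R) (c : idx A) (p : M) : R :=
  'D_(X c p) (h \o icoord A c) (coord A c p).

Definition der2 (X Y : vfield) (h : M -> R) (c : idx A) (p : M) : R :=
  der X (der Y h c) c p.

Definition coord_vfield (i : 'I_n) : vfield := fun _ _ => 'e_i.

Definition pd (i : 'I_n) (h : M -> R) (c : idx A) (p : M) : R :=
  der (coord_vfield i) h c p.

Definition lie (Z : vfield) (T : tensor2) : tensor2 := fun c p =>
  \matrix_(i, j) (der Z (fun q => T c q i j) c p
    + \sum_k pd i (fun q => Z c q 0 k) c p * T c p k j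
    + \sum_k pd j (fun q => Z c q 0 k) c p * T c p i k).

(* Components G c k i j p of an affine connection:
   nabla_(d_i) d_j = \sum_k (G c k i j p) d_k *)
Definition connection := idx A -> 'I_n -> 'I_n -> 'I_n -> M -> R.

Definition levi_civita (g : tensor2) : connection := fun c k i j p =>
  2^-1 * \sum_l invmx (g c p) k l *
    (pd i (fun q => g c q j l) c p + pd j (fun q => g c q i l) c p
     - pd l (fun q => g c q i j) c p).

(* R(d_i, d_j) d_k = \sum_l (curvature G c l k i j p) d_l, where
   R(X,Y) = [nabla_X, nabla_Y] - nabla_[X,Y] *)
Definition curvature (G : connection) (c : idx A) (l k i j : 'I_n) (p : M) : R :=
  pd i (G c l j k) c p - pd j (G c l i k) c p
  + \sum_m (G c l i m p * G c m j k p - G c l j m p * G c m i k p).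

(* Ric(Y,Z) is the trace of X |-> R(X,Y)Z *)
Definition ric (g : tensor2) : tensor2 := fun c p =>
  \matrix_(j, k) \sum_i curvature (levi_civita g) c i k i j p.

Definition scal (g : tensor2) (c : idx A) (p : M) : R :=
  \tr (invmx (g c p) *m ric g c p).

Definition grad (g : tensor2) (h : M -> R) : vfield := fun c p =>
  (\row_i pd i h c p) *m invmx (g c p).

Definition grad_dot (g : tensor2) (h h' : M -> R) (c : idx A) (p : M) : R :=
  ev2 g (grad g h) (grad g h') c p.

Definition grad_sq (g : tensor2) (h : M -> R) (c : idx A) (p : M) : R :=
  grad_dot g h h c p.

Definition hess (g : tensor2) (h : M -> R) : tensor2 := fun c p =>
  \matrix_(i, j) (der2 (coord_vfield i) (coord_vfield j) h c p
                  - \sum_k levi_civita g c k i j p * pd k h c p).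

Definition laplacian (g : tensor2) (h : M -> R) (c : idx A) (p : M) : R :=
  \tr (invmx (g c p) *m hess g h c p).

End manifold.

Arguments coord_vfield {R n M A} i _ _ /.

Section levi_civita_theory.
Context {R : realType} {n : nat} {M : topologicalType} {A : atlas R n M}.
Context (A_manifold : smooth_manifold A).

Lemma eq_pd (i : 'I_n) (h h' : M -> R) (c : idx A) (p : M) :
  (forall q, dom A c q -> h q = h' q) -> dom A c p -> pd i h c p = pd i h' c p.
Proof.
move=> hh' cp; rewrite /pd /der /=.
apply: near_eq_derive.
have : nbhs (coord A c p) (cimage c).
  by apply: open_nbhs_nbhs; split; [exact: cimage_open | exists p].
apply: filterS => x [q cq <-] /=.
by rewrite (coordK A_manifold cq) hh'.
Qed.

Context (g : tensor2 A) (g_metric : pseudo_riemannian g).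

Lemma levi_civita_torsion_free (c : idx A) (k i j : 'I_n) (p : M) :
  dom A c p -> levi_civita g c k i j p = levi_civita g c k j i p.
Proof.
move=> cp; rewrite /levi_civita; congr (_ * _); apply: eq_bigr => l _.
rewrite [pd l (fun q => g c q i j) c p](@eq_pd _ _ (fun q => g c q j i)) //.
  by rewrite [pd i _ c p + _]addrC.
by move=> q cq; rewrite -[g c q in LHS](metric_sym g_metric cq) mxE.
Qed.

(* Metric compatibility; with torsion-freeness it justifies [levi_civita]. *)
Lemma levi_civita_metric (c : idx A) (k i j : 'I_n) (p : M) :
  dom A c p ->
  pd k (fun q => g c q i j) c p =
    \sum_l (levi_civita g c l k i p * g c p l j
            + levi_civita g c l k j p * g c p i l).
Proof.
move=> cp.
have sym a b l : pd l (fun q => g c q a b) c p = pd l (fun q => g c q b a) c p.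
  apply: eq_pd => // q cq.
  by rewrite -[g c q in LHS](metric_sym g_metric cq) mxE.
have gs a b : g c p a b = g c p b a.
  by rewrite -[g c p in LHS](metric_sym g_metric cp) mxE.
have lower a b d : \sum_l levi_civita g c l a b p * g c p l d =
    2^-1 * (pd a (fun q => g c q b d) c p + pd b (fun q => g c q a d) c p
     - pd d (fun q => g c q a b) c p).
  set F := fun d => pd a (fun q => g c q b d) c p
     + pd b (fun q => g c q a d) c p - pd d (fun q => g c q a b) c p.
  rewrite -[RHS]/(2^-1 * F d) /levi_civita.
  under eq_bigr do rewrite -mulrA mulr_suml.
  rewrite -mulr_sumr exchange_big /=; congr (_ * _).
  have E m : \sum_i0 invmx (g c p) i0 m * F m * g c p i0 d = F m * (d == m)%:R.
    have /matrixP/(_ d m) := mulmxV (metric_nondegenerate g_metric cp).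
    rewrite !mxE => <-; rewrite mulr_sumr; apply: eq_bigr => l _.
    by rewrite [g c p l d]gs; ring.
  under eq_bigr do rewrite E.
  rewrite (bigD1 d) //= eqxx mulr1 big1 ?addr0 // => m /negPf md.
  by rewrite eq_sym md mulr0.
rewrite big_split /=.
under [X in _ + X]eq_bigr do rewrite [g c p i _]gs.
rewrite !lower [pd i (fun q => g c q k j) c p]sym [pd j (fun q => g c q k i) c p]sym.
rewrite [pd j (fun q => g c q i k) c p]sym [pd i (fun q => g c q j k) c p]sym.
rewrite [pd k (fun q => g c q j i) c p]sym.
by field.
Qed.

End levi_civita_theory.

Section product.
Context {R : realType} {n1 n2 : nat} {M1 M2 : topologicalType}.
Context (A1 : atlas R n1 M1) (A2 : atlas R n2 M2).

Definition prod_atlas : atlas R (n1 + n2) (M1 * M2)%type :=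
  @Atlas R (n1 + n2) (M1 * M2)%type (idx A1 * idx A2)%type
    (fun c => dom A1 c.1 `*` dom A2 c.2)
    (fun c p => row_mx (coord A1 c.1 p.1) (coord A2 c.2 p.2))
    (fun c x => (icoord A1 c.1 (lsubmx x), icoord A2 c.2 (rsubmx x))).

Definition hlift (X : vfield A1) : vfield prod_atlas :=
  fun (c : idx A1 * idx A2) p => row_mx (X c.1 p.1) 0.

Definition vlift (U : vfield A2) : vfield prod_atlas :=
  fun (c : idx A1 * idx A2) p => row_mx 0 (U c.2 p.2).

(* For a family T of tensors on the slices M1 x {q}, q in M2, the tensor on the
   product which vanishes on vertical vectors; pull-back if T is constant. *)
Definition hpull (T : M2 -> tensor2 A1) : tensor2 prod_atlas :=
  fun (c : idx A1 * idx A2) p => block_mx (T p.2 c.1 p.1) 0 0 0.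

Definition vpull (T : M1 -> tensor2 A2) : tensor2 prod_atlas :=
  fun (c : idx A1 * idx A2) p => block_mx 0 0 0 (T p.1 c.2 p.2).

Definition pull1 (T : tensor2 A1) := hpull (fun _ => T).
Definition pull2 (T : tensor2 A2) := vpull (fun _ => T).

Definition slice1 (h : M1 * M2 -> R) (q : M2) : M1 -> R := fun p => h (p, q).
Definition slice2 (h : M1 * M2 -> R) (p : M1) : M2 -> R := fun q => h (p, q).

Definition hess1 (g1 : tensor2 A1) (h : M1 * M2 -> R) : tensor2 prod_atlas :=
  hpull (fun q => hess g1 (slice1 h q)).

Definition hess2 (g2 : tensor2 A2) (h : M1 * M2 -> R) : tensor2 prod_atlas :=
  vpull (fun p => hess g2 (slice2 h p)).

Definition laplacian1 (g1 : tensor2 A1) (h : M1 * M2 -> R)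
    (c : idx A1 * idx A2) (p : M1 * M2) : R :=
  laplacian g1 (slice1 h p.2) c.1 p.1.

Definition laplacian2 (g2 : tensor2 A2) (h : M1 * M2 -> R)
    (c : idx A1 * idx A2) (p : M1 * M2) : R :=
  laplacian g2 (slice2 h p.1) c.2 p.2.

Definition grad_dot1 (g1 : tensor2 A1) (h h' : M1 * M2 -> R)
    (c : idx A1 * idx A2) (p : M1 * M2) : R :=
  grad_dot g1 (slice1 h p.2) (slice1 h' p.2) c.1 p.1.

Definition grad_dot2 (g2 : tensor2 A2) (h h' : M1 * M2 -> R)
    (c : idx A1 * idx A2) (p : M1 * M2) : R :=
  grad_dot g2 (slice2 h p.1) (slice2 h' p.1) c.2 p.2.

Definition twisted_metric (g1 : tensor2 A1) (g2 : tensor2 A2)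
    (f : M1 * M2 -> R) : tensor2 prod_atlas :=
  fun c p => pull1 g1 c p + f p ^+ 2 *: pull2 g2 c p.

End product.

Arguments hlift {R n1 n2 M1 M2} {A1} A2 X : rename.
Arguments vlift {R n1 n2 M1 M2} A1 {A2} U : rename.
Arguments hpull {R n1 n2 M1 M2} {A1} A2 T : rename.
Arguments vpull {R n1 n2 M1 M2} A1 {A2} T : rename.
Arguments pull1 {R n1 n2 M1 M2} {A1} A2 T : rename.
Arguments pull2 {R n1 n2 M1 M2} A1 {A2} T : rename.
Arguments hess1 {R n1 n2 M1 M2} {A1} A2 g1 h : rename.
Arguments hess2 {R n1 n2 M1 M2} A1 {A2} g2 h : rename.
Arguments laplacian1 {R n1 n2 M1 M2} {A1} A2 g1 h c p : rename.
Arguments laplacian2 {R n1 n2 M1 M2} A1 {A2} g2 h c p : rename.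
Arguments grad_dot1 {R n1 n2 M1 M2} {A1} A2 g1 h h' c p : rename.
Arguments grad_dot2 {R n1 n2 M1 M2} A1 {A2} g2 h h' c p : rename.

(* Main.v *)
Require Import Defs.
From HB Require Import structures.
From mathcomp Require Import all_boot all_order all_algebra.
From mathcomp Require Import all_classical all_reals all_analysis.
From mathcomp Require Import ring lra.
Import Order.TTheory GRing.Theory Num.Theory.
Import numFieldNormedType.Exports.

Set Implicit Arguments.
Unset Strict Implicit.
Unset Printing Implicit Defensive.

Local Open Scope classical_set_scope.
Local Open Scope ring_scope.

(* Everything is computed in the product charts.  Writing the Christoffel symbols
   of e^{2s} g as those of g plus a tensor built from ds gives
     Ric(e^{2s} g) = Ric(g) - (n - 2) (Hess s - ds ds)
                     - (Lap s + (n - 2) |ds|^2) g.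
   The Christoffel symbols of g1 + f^2 g2 split into blocks; the block with only
   vertical indices is that of the conformal metric f^2 g2 on a slice {p} x M2,
   so the vertical Ricci curvature is given by the same formula in dimension n2,
   up to a term in the horizontal derivatives of k = ln f.  The remaining blocks
   are Ric_1 - n2 (Hess_1 k + dk dk) and (1 - n2) XU(k).  Applying the conformal
   formula to e^{2 sigma} g, the horizontal, vertical and mixed components of the
   equation are (i), (ii) and (iii), up to sign.  Evaluating the conditions at a
   point requires global vector fields with prescribed values there, obtained
   by cutting off constant fields of a chart. *)

(** * Smooth maps *)

(** A chart is used only through [is_chart] and a metric only through [chart_metric]; neither
    mentions transition maps. Both pass to product charts, to the twisted metric and to the
    conformal metrics on the slices, so one conformal formula serves for [sigma] on the product and
    for [k] on a slice. Transition maps matter only for the construction of global vector fields.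
    Components are functions on the whole manifold that are controlled on a chart domain only. Hence
    every replacement under [pd] is an equality of germs, and smoothness is treated point by point.
    The scalar curvature of [g_L] is never expanded: at a given point [Lambda] is just a number, so
    the equation separates into matrix entries. Both mixed blocks have to be computed, and both lead
    to (iii). By the Leibniz rule the Lie derivative yields Z(sigma) on the horizontal block e^(2
    sigma) g1 and Z(omega) on the vertical block e^(2 omega) g2, which is why (i) and (ii) differ
    there. *)

Section near_differentiable.
Context {R : numFieldType} {V W : normedModType R}.

Lemma near_eq_differentiable (f g : V -> W) (x : V) :
  {near x, f =1 g} -> differentiable f x -> differentiable g x.
Proof.
move=> fg /diff_locallyP[dfc /eqaddoP dfx].
have gx : f x = g x := nbhs_singleton fg.
have E : g \o shift x = cst (g x) + 'd f x +o_ 0 id.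
  apply/eqaddoP => e e0; have := dfx e e0.
  apply: filterS2 => /=; last first.
    have := fg; rewrite (near_shift 0); apply.
  by move=> y; rewrite /= subr0 !fctE /= gx => ->.
(* The expansion of [f] at [x] is also one of [g], and uniqueness of the differential turns it into
   the expansion with ['d g x]. *)
by apply/diff_locallyP; rewrite (diff_unique dfc E); split.
Qed.

End near_differentiable.

Section Ck_theory.
Context {R : realType} {V W : normedModType R}.
Implicit Types (f g : V -> W) (D E : set V).

(** Each clause of [Ck] speaks of one point at a time, and the derivatives are total functions. So
    the singleton is meaningful although it is not open: it expresses a property of the germ at
    [x]. *)
Lemma Ck_pointwise k D f :
  Ck k D f <-> forall x, D x -> Ck k [set x] f.
Proof.
elim: k f => [|k IH] f /=.
  by split=> [H x Dx y -> //=|H x Dx]; [exact: H|exact: (H x Dx x erefl)].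
split=> [[H1 H2] x Dx|H].
  by split=> [y ->|v]; [exact: H1|exact: (IH _).1].
by split=> [x Dx|v]; [exact: (H x Dx).1|apply/IH => x Dx; exact: (H x Dx).2].
Qed.

Lemma Ck_near k x f g :
  {near x, f =1 g} -> Ck k [set x] f -> Ck k [set x] g.
Proof.
elim: k f g => [|k IH] f g fg /=.
  move=> H y -> ; have := H x erefl.
  rewrite /prop_for /continuous_at -(nbhs_singleton fg) => fx.
  by apply: cvg_trans fx; apply: near_eq_cvg.
move=> [H1 H2]; split=> [y ->|v].
  exact: near_eq_differentiable (H1 x erefl).
(* Equality near [x] is also equality near each [y] close to [x], so the derivatives agree near
   [x]. *)
apply: IH (H2 v); have := near_join fg; apply: filterS => y.
exact: near_eq_derive.
Qed.

Lemma Ck_eq k D f g : open D -> (forall x, D x -> f x = g x) ->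
  Ck k D f -> Ck k D g.
Proof.
move=> oD fg /Ck_pointwise H; apply/Ck_pointwise => x Dx.
apply: Ck_near (H x Dx).
by apply: filterS fg _; exact: open_nbhs_nbhs.
Qed.

Lemma CkS k D f : Ck k.+1 D f -> Ck k D f.
Proof.
elim: k f => [|k IH] f [H1 H2].
  by move=> x Dx; apply: differentiable_continuous; exact: H1.
by split=> // v; apply: IH.
Qed.

Lemma Ck_subset k D E f : D `<=` E -> Ck k E f -> Ck k D f.
Proof.
by move=> DE /Ck_pointwise H; apply/Ck_pointwise => x Dx; apply/H/DE.
Qed.

Lemma Ck_cst k D (a : W) : Ck k D (cst a).
Proof.
elim: k a => [|k IH] a /=; first by move=> x _; exact: cst_continuous.
split=> // v.
rewrite (_ : 'D_v _ = cst 0); first exact: IH.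
by apply/funext => x; rewrite derive_cst.
Qed.

Lemma CkD k D f g : open D -> Ck k D f -> Ck k D g -> Ck k D (f \+ g).
Proof.
move=> oD; elim: k f g => [|k IH] f g /=.
  by move=> Hf Hg x Dx; apply: cvgD; [exact: Hf|exact: Hg].
move=> [f1 f2] [g1 g2]; split=> [x Dx|v].
  by apply: differentiableD; [exact: f1|exact: g1].
apply: (@Ck_eq _ _ ('D_v f \+ 'D_v g)) => //; last exact: IH.
by move=> x Dx; rewrite deriveD //; apply: diff_derivable;
  [exact: f1|exact: g1].
Qed.

Lemma smooth_on_eq D f g : open D -> (forall x, D x -> f x = g x) ->
  smooth_on D f -> smooth_on D g.
Proof. by move=> oD fg H k; apply: Ck_eq (H k). Qed.

Lemma smooth_on_cst D (a : W) : smooth_on D (cst a).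
Proof. by move=> k; exact: Ck_cst. Qed.

Lemma smooth_onD D f g : open D ->
  smooth_on D f -> smooth_on D g -> smooth_on D (f \+ g).
Proof. by move=> oD Hf Hg k; exact: CkD. Qed.

Lemma smooth_on_derive D f v : smooth_on D f -> smooth_on D ('D_v f).
Proof. by move=> H k; exact: (H k.+1).2. Qed.

Lemma smooth_on_diff D f x : smooth_on D f -> D x -> differentiable f x.
Proof. by move=> H Dx; exact: (H 1).1. Qed.

(* Smoothness is pointwise in the domain, so it can be checked separately
   near each point, where the function agrees with a smooth one. *)
Lemma smooth_on_local D f :
  (forall x, D x -> exists2 E, nbhs x E & exists2 g,
      smooth_on E g & {near x, g =1 f}) ->
  smooth_on D f.
Proof.
move=> H k; apply/Ck_pointwise => x /H[E xE [g sg gf]].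
apply: Ck_near gf _; apply: Ck_subset (sg k) => y ->.
exact: nbhs_singleton.
Qed.

End Ck_theory.

Section Ck_linear.
Context {R : realType} {V W W' : normedModType R}.

Lemma smooth_on_linear (D : set V) (f : V -> W) (L : {linear W -> W'}) :
  open D -> continuous L -> smooth_on D f -> smooth_on D (L \o f).
Proof.
move=> oD cL H k; have {H} := H k; elim: k f => [|k IH] f /=.
  move=> H x Dx; apply: continuous_comp; [exact: H|exact: cL].
move=> [f1 f2]; split=> [x Dx|v].
  by apply: differentiable_comp; [exact: f1|exact: linear_differentiable].
apply: (@Ck_eq _ _ _ _ _ (L \o 'D_v f)) => //; last exact: IH.
move=> x Dx /=.
have df := f1 x Dx; have dL := linear_differentiable (f x) cL.
rewrite !deriveE //; last exact: differentiable_comp.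
by rewrite (diff_comp df dL) /= (diff_lin _ cL).
Qed.

End Ck_linear.

Section Ck_scalar.
Context {R : realType} {V : normedModType R}.
Implicit Types (f g : V -> R) (D : set V).

Lemma CkM k D f g : open D -> Ck k D f -> Ck k D g -> Ck k D (f \* g).
Proof.
move=> oD; elim: k f g => [|k IH] f g.
  by move=> Hf Hg x Dx; apply: continuousM; [exact: Hf|exact: Hg].
move=> Hf Hg; have [f1 f2] := Hf; have [g1 g2] := Hg; split=> [x Dx|v].
  by apply: differentiableM; [exact: f1|exact: g1].
apply: (@Ck_eq _ _ _ _ _ ((f \* 'D_v g) \+ (g \* 'D_v f))) => //.
  move=> x Dx; rewrite deriveM //; apply: diff_derivable;
    [exact: f1|exact: g1].
by apply: CkD => //; apply: IH; (exact: CkS || exact: f2 || exact: g2).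
Qed.

Lemma Ck_sum (I : Type) (r : seq I) k D (F : I -> V -> R) : open D ->
  (forall i, Ck k D (F i)) -> Ck k D (fun x => \sum_(i <- r) F i x).
Proof.
move=> oD H; elim: r => [|a r IH].
  apply: (@Ck_eq _ _ _ _ _ (cst 0)) => //; last exact: Ck_cst.
  by move=> x _; rewrite big_nil.
apply: (@Ck_eq _ _ _ _ _ (F a \+ (fun x => \sum_(i <- r) F i x))) => //.
  by move=> x _; rewrite big_cons.
exact: CkD.
Qed.

Lemma smooth_onM D f g : open D ->
  smooth_on D f -> smooth_on D g -> smooth_on D (f \* g).
Proof. by move=> oD Hf Hg k; exact: CkM. Qed.

Lemma smooth_on_sum (I : Type) (r : seq I) D (F : I -> V -> R) : open D ->
  (forall i, smooth_on D (F i)) -> smooth_on D (fun x => \sum_(i <- r) F i x).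
Proof. by move=> oD H k; apply: Ck_sum => // i; exact: H. Qed.

Lemma smooth_onZ D f (a : R) : open D ->
  smooth_on D f -> smooth_on D (fun x => a * f x).
Proof. by move=> oD; apply: smooth_onM => //; exact: smooth_on_cst. Qed.

Lemma smooth_onN D f : open D -> smooth_on D f -> smooth_on D (\- f).
Proof.
move=> oD Hf; apply: (@smooth_on_eq _ _ _ _ (fun x => -1 * f x)) => //.
  by move=> x _ /=; rewrite mulN1r.
exact: smooth_onZ.
Qed.

(* In the induction the differential of [h] is expanded along the basis [e]. *)
Lemma smooth_on_comp_basis (U : normedModType R) (m : nat) (e : 'I_m -> U)
    (l : 'I_m -> {linear U -> R}) D (E : set U) (u : V -> U) (h : U -> R) :
  (forall i, continuous (l i)) -> (forall x, x = \sum_i l i x *: e i) ->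
  open D -> (forall x, D x -> E (u x)) ->
  smooth_on D u -> smooth_on E h -> smooth_on D (h \o u).
Proof.
move=> cl le oD DE su sh k; elim: k h sh => [|k IH] h sh.
  move=> x Dx; apply: continuous_comp; first exact: (su 0).
  exact/(sh 0)/DE.
split=> [x Dx|v].
  apply: differentiable_comp; first exact: smooth_on_diff su Dx.
  exact: smooth_on_diff sh (DE x Dx).
apply: (@Ck_eq _ _ _ _ _
    (fun x => \sum_i (l i \o 'D_v u) x * ('D_(e i) h \o u) x)) => //.
  move=> x Dx /=.
  have du : differentiable u x := smooth_on_diff su Dx.
  have dh : differentiable h (u x) := smooth_on_diff sh (DE x Dx).
  rewrite [RHS]deriveE; last exact: differentiable_comp.
  rewrite (diff_comp du dh) /= -(deriveE v du).
  rewrite [in RHS](le ('D_v u x)) linear_sum.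
  by apply: eq_bigr => i _; rewrite linearZ (deriveE (e i) dh).
apply: Ck_sum => // i; apply: CkM => //.
  by apply: smooth_on_linear => //; exact: smooth_on_derive.
by apply: IH; exact: smooth_on_derive.
Qed.

End Ck_scalar.

(** * Coordinates and elementary functions *)

Section smooth_instances.
Context {R : realType}.

(** Named so that it can carry a linear structure and serve as a dual basis vector in
    [smooth_on_comp_basis]. *)
Definition rVcoord n (i : 'I_n) (x : 'rV[R]_n) : R := x 0 i.

Lemma rVcoord_is_linear n (i : 'I_n) : linear (rVcoord i).
Proof. by move=> a x y; rewrite /rVcoord !mxE. Qed.

HB.instance Definition _ n (i : 'I_n) := GRing.isLinear.Build R 'rV[R]_n R
  *:%R (rVcoord i) (@rVcoord_is_linear n i).

Definition rVline n (w : 'rV[R]_n) (a : R) : 'rV[R]_n := a *: w.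

Lemma rVline_is_linear n (w : 'rV[R]_n) : linear (rVline w).
Proof. by move=> a x y; rewrite /rVline scalerDl scalerA. Qed.

HB.instance Definition _ n (w : 'rV[R]_n) := GRing.isLinear.Build R R 'rV[R]_n
  *:%R (rVline w) (rVline_is_linear w).

Context {V : normedModType R}.
Implicit Type D : set V.

Lemma smooth_on_comp D (E : set R) (u : V -> R) (h : R -> R) :
  open D -> (forall x, D x -> E (u x)) ->
  smooth_on D u -> smooth_on E h -> smooth_on D (h \o u).
Proof.
move=> oD DE su sh; apply: (@smooth_on_comp_basis _ _ R 1 (fun=> 1)
  (fun=> idfun : {linear R -> R}) _ _ _ _ _ _ oD DE su sh) => [_ x //|x].
by rewrite big_ord1 /= -[_ *: _]/(x * 1) mulr1.
Qed.

Lemma smooth_on_comp_rV m D (E : set 'rV[R]_m) (u : V -> 'rV[R]_m)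
    (h : 'rV[R]_m -> R) :
  open D -> (forall x, D x -> E (u x)) ->
  smooth_on D u -> smooth_on E h -> smooth_on D (h \o u).
Proof.
move=> oD DE su sh; apply: (@smooth_on_comp_basis _ _ _ m (fun i => 'e_i)
  (fun i => rVcoord i : {linear _ -> _}) _ _ _ _ _ _ oD DE su sh) => [i|x].
  exact: matrix_normedtype.coord_continuous.
exact: row_sum_delta.
Qed.

Lemma smooth_on_coord m D (u : V -> 'rV[R]_m) i : open D ->
  smooth_on D u -> smooth_on D (fun x => u x 0 i).
Proof.
move=> oD; apply: (@smooth_on_linear _ _ _ _ _ _
  (rVcoord i : {linear _ -> _})) => //.
exact: matrix_normedtype.coord_continuous.
Qed.

Lemma smooth_on_rV m D (u : V -> 'rV[R]_m) : open D ->
  (forall i, smooth_on D (fun x => u x 0 i)) -> smooth_on D u.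
Proof.
move=> oD H.
apply: (@smooth_on_eq _ _ _ _ (fun x => \sum_i u x 0 i *: ('e_i : 'rV[R]_m))).
- exact: oD.
- by move=> x _; rewrite -row_sum_delta.
elim: (index_enum _) => [|i r IH].
  apply: (@smooth_on_eq _ _ _ _ (cst 0)) => //; last exact: smooth_on_cst.
  by move=> x _; rewrite big_nil.
apply: (@smooth_on_eq _ _ _ _ ((fun x => u x 0 i *: ('e_i : 'rV[R]_m)) \+
   (fun x => \sum_(i <- r) u x 0 i *: ('e_i : 'rV[R]_m)))) => //.
  by move=> x _; rewrite big_cons.
apply: smooth_onD => //.
apply: (@smooth_on_linear _ _ _ _ _ _
  (rVline ('e_i : 'rV[R]_m) : {linear _ -> _}) oD) => //.
by move=> a; exact: scalel_continuous.
Qed.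

Lemma smooth_on_id D : open D -> smooth_on D id.
Proof.
move=> oD [|k]; first by move=> x _; exact: cvg_id.
split=> // v; apply: (@Ck_eq _ _ _ _ _ (cst v)) => //; last exact: Ck_cst.
by move=> x _; rewrite derive_id.
Qed.

(** On the line all directional derivatives are multiples of one: ['D_v f] is [v] times ['D_1 f]. *)
Lemma CkS_real k (D : set R) (f : R -> R) : open D ->
  (forall x, D x -> derivable f x 1) -> Ck k D ('D_1 f) -> Ck k.+1 D f.
Proof.
move=> oD df Hf; have df' x (Dx : D x) := (derivable1_diffP f x).1 (df x Dx).
split=> // v.
apply: (@Ck_eq _ _ _ _ _ (cst v \* 'D_1 f)) => //.
  move=> x Dx /=; rewrite !(deriveE _ (df' x Dx)) -[RHS]/('d f x v).
  by rewrite -[in RHS](mulr1 v) -[v * 1]/(v *: (1 : R)) linearZ.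
by apply: CkM => //; exact: Ck_cst.
Qed.

Lemma smooth_expR : smooth_on [set: R] expR.
Proof.
elim=> [x _|k IH]; first exact: continuous_expR.
apply: CkS_real => //; first exact: openT.
by rewrite derive_expR.
Qed.

Let open_neq0 : open [set x : R | x != 0].
Proof.
rewrite (_ : [set x : R | x != 0] = ~` [set 0]); first exact/closed_openC.
by apply/seteqP; split=> x /=; [move/eqP|move=> ?; apply/eqP].
Qed.

(** The derivative is a polynomial in the inverse itself, so the induction on the order closes. *)
Lemma smooth_inv : smooth_on [set x : R | x != 0] GRing.inv.
Proof.
elim=> [x x0|k IH]; first exact: inv_continuous.
apply: CkS_real => // [x x0|]; first exact: derivableV.
apply: (@Ck_eq _ _ _ _ _ (cst (-1 : R) \*
    ((GRing.inv : R -> R) \* (GRing.inv : R -> R)))) => //.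
  move=> x x0 /=; rewrite deriveV //= derive_id -[RHS]/(- _ * 1).
  by rewrite mulN1r mulr1 -invfM -expr2.
by apply: CkM => //; [exact: Ck_cst|exact: CkM].
Qed.

Lemma smooth_ln : smooth_on [set x : R | 0 < x] (@ln R).
Proof.
have oP : open [set x : R | 0 < x] by exact: open_gt.
case=> [x x0|k]; first exact: continuous_ln.
apply: CkS_real => // [x x0|].
  by case: (is_derive1_ln x0).
apply: (@Ck_eq _ _ _ _ _ (GRing.inv : R -> R)) => //.
  by move=> x x0; case: (is_derive1_ln x0).
by apply: Ck_subset (smooth_inv k) => x /=; exact: lt0r_neq0.
Qed.

End smooth_instances.

Lemma smooth_on_rVcoord (R : realType) n (D : set 'rV[R]_n) (i : 'I_n) :
  open D -> smooth_on D (rVcoord i).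
Proof. by move=> oD; exact (smooth_on_coord i oD (smooth_on_id oD)). Qed.


(** * Symmetry of second derivatives *)

Section schwarz.
Context {R : realType} {V : normedModType R}.
Implicit Types (f : V -> R) (D : set V).

Lemma line_MVT f (y w : V) (h : R) : 0 < h ->
  (forall t, 0 <= t <= h -> derivable f (y + t *: w) w) ->
  exists2 s, 0 <= s <= h & f (y + h *: w) - f y = h * 'D_w f (y + s *: w).
Proof.
move=> h0 df.
pose F t := f (y + t *: w).
(* The difference quotients of [F] in direction 1 are literally those of [f] in direction [w], so
   derivability and the value of the derivative transfer without a chain rule. *)
have quotE t : (fun e : R => e^-1 *: ((F \o shift t) (e *: (1 : R)) - F t)) =
    (fun e => e^-1 *: ((f \o shift (y + t *: w)) (e *: w) - f (y + t *: w))).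
  apply/funext => e; rewrite /F /= -[e *: 1]/(e * 1) mulr1.
  by rewrite scalerDl addrCA.
have dF t : 0 <= t <= h -> is_derive t 1 F ('D_w f (y + t *: w)).
  move=> /df dft; apply: DeriveDef.
    by have := dft; rewrite /derivable -quotE.
  by rewrite /derive -quotE.
have cF : {within `[0, h], continuous F}.
  apply: continuous_in_subspaceT => t; rewrite inE /= in_itv /= => th.
  by apply: differentiable_continuous; apply/derivable1_diffP; case: (dF t th).
have dF' t : t \in `]0, h[ -> is_derive t 1 F ('D_w f (y + t *: w)).
  by rewrite in_itv /= => /andP[t0 th]; apply: dF; rewrite !ltW.
have [s sh E] := MVT_segment (ltW h0) dF' cF.
exists s; first by move: sh; rewrite in_itv.
by move: E; rewrite /F scale0r addr0 subr0 mulrC.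
Qed.

(** The mean value theorem along [u] for the difference f(y + hv) - f(y), then along [v] for
    ['D_u f]. The left-hand side is symmetric in [u] and [v], the right-hand side is not: this gives
    the symmetry of mixed derivatives. *)
Lemma second_difference D f (x u v : V) (h : R) : open D -> smooth_on D f ->
  0 < h ->
  (forall s t, 0 <= s <= h -> 0 <= t <= h -> D (x + s *: u + t *: v)) ->
  exists s t, [/\ 0 <= s <= h, 0 <= t <= h &
    f (x + h *: u + h *: v) - f (x + h *: u) - (f (x + h *: v) - f x) =
    h ^+ 2 * 'D_v ('D_u f) (x + s *: u + t *: v)].
Proof.
move=> oD sf h0 inD.
have hh : 0 <= h <= h by rewrite lexx ltW.
have h00 : 0 <= (0 : R) <= h by rewrite lexx ltW.
have df s t w : 0 <= s <= h -> 0 <= t <= h ->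
    derivable f (x + s *: u + t *: v) w.
  move=> sh th; apply: diff_derivable.
  by apply: smooth_on_diff sf _; exact: inD.
have df0 s w : 0 <= s <= h -> derivable f (x + s *: u) w.
  by move=> sh; have := df s 0 w sh h00; rewrite scale0r addr0.
pose Fv y := f (y + h *: v); pose F y := Fv y - f y.
have quotE y : (fun e : R => e^-1 *: ((Fv \o shift y) (e *: u) - Fv y)) =
    (fun e => e^-1 *: ((f \o shift (y + h *: v)) (e *: u) - f (y + h *: v))).
  by apply/funext => e; rewrite /Fv /= addrA.
have dFv s : 0 <= s <= h -> derivable Fv (x + s *: u) u.
  by move=> sh; have := df s h u sh hh; rewrite /derivable -quotE.
have dF s : 0 <= s <= h -> derivable F (x + s *: u) u.
  by move=> sh; apply: derivableB; [exact: dFv|exact: df0].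
have [s sh Es] := line_MVT h0 dF.
have DF : 'D_u F (x + s *: u) =
    'D_u f (x + s *: u + h *: v) - 'D_u f (x + s *: u).
  rewrite [LHS]deriveB; [|exact: dFv|exact: df0].
  by rewrite {1}/derive quotE.
have dD t : 0 <= t <= h -> derivable ('D_u f) (x + s *: u + t *: v) v.
  move=> th; apply: diff_derivable.
  by apply: smooth_on_diff (smooth_on_derive u sf) _; exact: inD.
have [t th Et] := line_MVT h0 dD.
exists s, t; split=> //.
by move: Es; rewrite DF Et /F /Fv => ->; rewrite expr2 mulrA.
Qed.

(** If the two values [a] and [b] differed, continuity would keep each mixed derivative within half
    of [|a - b|] of its value on a ball. The second difference, read in both orders, shows that the
    two derivatives share a value on that ball, a contradiction. *)
Lemma derive_comm D f (x u v : V) : open D -> smooth_on D f -> D x ->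
  'D_v ('D_u f) x = 'D_u ('D_v f) x.
Proof.
move=> oD sf Dx.
set a : R := 'D_v ('D_u f) x; set b : R := 'D_u ('D_v f) x.
apply/eqP; rewrite -subr_eq0 -normr_le0 leNgt; apply/negP => ab.
have cont (w1 w2 : V) : {for x, continuous ('D_w1 ('D_w2 f))}.
  by have := smooth_on_derive w1 (smooth_on_derive w2 sf); move/(_ 0); apply.
have e0 : 0 < `|a - b| / 2 by rewrite divr_gt0.
have /nbhs_ballP[r /= r0 Hr0] : \forall y \near x,
    [/\ D y, `|a - 'D_v ('D_u f) y| < `|a - b| / 2
         & `|b - 'D_u ('D_v f) y| < `|a - b| / 2].
  have /cvgr_dist_lt/(_ _ e0) H1 := cont v u.
  have /cvgr_dist_lt/(_ _ e0) H2 := cont u v.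
  have H3 : \forall y \near x, D y by exact: open_nbhs_nbhs.
  by apply: filterS3 H3 H1 H2 => y Dy y1 y2; exact: And3 Dy y1 y2.
have Hr y : `|x - y| < r -> [/\ D y, `|a - 'D_v ('D_u f) y| < `|a - b| / 2
         & `|b - 'D_u ('D_v f) y| < `|a - b| / 2].
  by move=> xy; apply: Hr0; rewrite -ball_normE.
(* All points x + su + tv with s, t at most [h] then lie within r/2 of [x]; the summand 1 keeps the
   denominator positive when [u] and [v] vanish. *)
pose h := r / (2 * (`|u| + `|v| + 1)).
have n0 : 0 < `|u| + `|v| + 1 by rewrite ltr_wpDl // addr_ge0.
have h0 : 0 < h by rewrite divr_gt0 // mulr_gt0.
have near s t : 0 <= s <= h -> 0 <= t <= h ->
    `|x - (x + s *: u + t *: v)| < r.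
  move=> /andP[s0 sh] /andP[t0 th].
  rewrite -addrA opprD addrA subrr sub0r normrN.
  apply: (@le_lt_trans _ _ (h * (`|u| + `|v| + 1))).
    apply: (@le_trans _ _ (h * (`|u| + `|v|))); last first.
      by apply: ler_wpM2l; [exact: ltW|rewrite lerDl].
    rewrite (le_trans (ler_normD _ _)) // !normrZ !ger0_norm // mulrDr.
    by rewrite lerD // ler_wpM2r.
  have -> : h * (`|u| + `|v| + 1) = r / 2.
    by rewrite /h; field; rewrite gt_eqF.
  by rewrite ltr_pdivrMr // ltr_pMr // ltr1n.
have [s [t [sh th E1]]] := @second_difference D f x u v h oD sf h0
  (fun s t sh th => let: And3 H _ _ := Hr _ (near s t sh th) in H).
have near' s' t' (sh' : 0 <= s' <= h) (th' : 0 <= t' <= h) :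
    `|x - (x + s' *: v + t' *: u)| < r.
  by rewrite addrAC near.
have [s' [t' [sh' th' E2]]] := @second_difference D f x v u h oD sf h0
  (fun s t sh th => let: And3 H _ _ := Hr _ (near' s t sh th) in H).
have E : 'D_v ('D_u f) (x + s *: u + t *: v) =
    'D_u ('D_v f) (x + s' *: v + t' *: u).
  apply: (@mulfI _ (h ^+ 2)); first by rewrite expf_neq0 // gt_eqF.
  apply: etrans (esym E1) _; apply: etrans E2; rewrite (addrAC x (h *: v)).
  by rewrite !opprB addrACA [- _ - _]addrC addrACA.
have [_ + _] := Hr _ (near _ _ sh th).
have [_ _] := Hr _ (near' _ _ sh' th').
rewrite -E; move: ('D_v _ _) ab => c; clearbody a b; clear => ab bc ac.
have : `|a - b| < `|a - b| / 2 + `|a - b| / 2.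
  have {1}-> : a - b = (a - c) - (b - c) by rewrite opprB addrA subrK.
  by rewrite (le_lt_trans (ler_normB _ _)) // ltrD.
by rewrite -splitr ltxx.
Qed.

End schwarz.

(** * Calculus in a chart *)

(** The part of [smooth_manifold] on which calculus in a single chart rests; unlike transition data
    it passes to product charts at once. *)
Record is_chart (R : realType) (n : nat) (M : topologicalType)
    (A : atlas R n M) (c : idx A) : Prop := IsChart {
  chart_open : open (cimage c);
  chartK : forall p, dom A c p -> icoord A c (Defs.coord A c p) = p }.

Lemma derive_comp_real (R : realType) (V : normedModType R) (u : V -> R)
    (h : R -> R) (x v : V) : differentiable u x -> derivable h (u x) 1 ->
  'D_v (h \o u) x = 'D_1 h (u x) * 'D_v u x.
Proof.
move=> du /derivable1_diffP dh.
rewrite [LHS]deriveE; last exact: (differentiable_comp du dh).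
rewrite (diff_comp du dh) /= (deriveE v du) [in RHS](deriveE _ dh).
set w := 'd u x v; rewrite mulrC -[w * _]/(w *: _) -linearZ.
by rewrite -[w *: 1]/(w * 1) mulr1.
Qed.

Section chart_calculus.
Context {R : realType} {n : nat} {M : topologicalType} {A : atlas R n M}.
Context {c : idx A} (Ac : is_chart c).
Implicit Types (h : M -> R) (p q : M).

Definition csmooth h := smooth_on (cimage c) (h \o icoord A c).

Let oI : open (cimage c) := chart_open Ac.

Lemma icoord_dom x : cimage c x -> dom A c (icoord A c x).
Proof. by move=> [q cq <-]; rewrite (chartK Ac). Qed.

Lemma cimage_coord p : dom A c p -> cimage c (Defs.coord A c p).
Proof. by exists p. Qed.

Lemma near_chart h h' p : dom A c p -> (forall q, dom A c q -> h q = h' q) ->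
  {near Defs.coord A c p, h \o icoord A c =1 h' \o icoord A c}.
Proof.
move=> cp hh'; have : nbhs (Defs.coord A c p) (cimage c).
  by apply: open_nbhs_nbhs; split => //; exact: cimage_coord.
by apply: filterS => x /icoord_dom cx; exact: hh'.
Qed.

Lemma csmooth_eq h h' : (forall q, dom A c q -> h q = h' q) ->
  csmooth h -> csmooth h'.
Proof.
by move=> hh'; apply: smooth_on_eq => // x /icoord_dom cx; exact: hh'.
Qed.

Lemma csmooth_cst a : csmooth (fun=> a).
Proof. exact: smooth_on_cst. Qed.

Lemma csmoothD h h' : csmooth h -> csmooth h' -> csmooth (fun q => h q + h' q).
Proof. exact: smooth_onD. Qed.

Lemma csmoothM h h' : csmooth h -> csmooth h' -> csmooth (fun q => h q * h' q).
Proof. exact: smooth_onM. Qed.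

Lemma csmoothN h : csmooth h -> csmooth (fun q => - h q).
Proof. exact: smooth_onN. Qed.

Lemma csmoothB h h' : csmooth h -> csmooth h' -> csmooth (fun q => h q - h' q).
Proof. by move=> sh sh'; apply: csmoothD => //; exact: csmoothN. Qed.

Lemma csmooth_sum (I : Type) (r : seq I) (F : I -> M -> R) :
  (forall i, csmooth (F i)) -> csmooth (fun q => \sum_(i <- r) F i q).
Proof. exact: smooth_on_sum. Qed.

Lemma csmooth_prod (I : Type) (r : seq I) (F : I -> M -> R) :
  (forall i, csmooth (F i)) -> csmooth (fun q => \prod_(i <- r) F i q).
Proof.
move=> sF; elim: r => [|a r IH].
  by apply: (@csmooth_eq (fun=> 1)) (csmooth_cst _) => q _; rewrite big_nil.
apply: (@csmooth_eq (fun q => F a q * \prod_(i <- r) F i q)).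
  by move=> q _; rewrite big_cons.
exact: csmoothM.
Qed.

Lemma csmooth_expR h : csmooth h -> csmooth (fun q => expR (h q)).
Proof.
move=> sh; apply: (@smooth_on_comp _ _ _ [set: R] (h \o icoord A c) expR) => //.
exact: smooth_expR.
Qed.

Lemma csmooth_ln h : (forall q, 0 < h q) -> csmooth h ->
  csmooth (fun q => ln (h q)).
Proof.
move=> h0 sh; apply: (@smooth_on_comp _ _ _ [set x | 0 < x]
  (h \o icoord A c) (@ln R)) => //.
  by move=> x _ /=.
exact: smooth_ln.
Qed.

Lemma csmoothV h : (forall q, dom A c q -> h q != 0) -> csmooth h ->
  csmooth (fun q => (h q)^-1).
Proof.
move=> h0 sh; apply: (@smooth_on_comp _ _ _ [set x | x != 0]
  (h \o icoord A c) GRing.inv) => //.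
  by move=> x /icoord_dom; exact: h0.
exact: smooth_inv.
Qed.

Lemma csmooth_pd i h : csmooth h -> csmooth (pd i h c).
Proof.
move=> sh; apply: (@smooth_on_eq _ _ _ _ ('D_('e_i) (h \o icoord A c))) => //.
  by move=> x [q cq <-]; rewrite /= (chartK Ac).
exact: smooth_on_derive.
Qed.

Lemma csmooth_det m (F : M -> 'M[R]_m) :
  (forall i j, csmooth (fun q => F q i j)) -> csmooth (fun q => \det (F q)).
Proof.
move=> sF; apply: csmooth_sum => s; apply: csmoothM.
  exact: csmooth_cst.
by apply: csmooth_prod.
Qed.

Lemma csmooth_diff h p : csmooth h -> dom A c p ->
  differentiable (h \o icoord A c) (Defs.coord A c p).
Proof. by move=> sh cp; apply: smooth_on_diff sh _; exact: cimage_coord. Qed.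

Lemma csmooth_derivable h p v : csmooth h -> dom A c p ->
  derivable (h \o icoord A c) (Defs.coord A c p) v.
Proof. by move=> sh cp; apply/diff_derivable/csmooth_diff. Qed.

Lemma chart_eq_pd i h h' p : (forall q, dom A c q -> h q = h' q) ->
  dom A c p -> pd i h c p = pd i h' c p.
Proof. by move=> hh' cp; apply: near_eq_derive; exact: near_chart. Qed.

Lemma pd_cst i a p : pd i (fun=> a) c p = 0.
Proof. exact: derive_cst. Qed.

Lemma pdD i h h' p : csmooth h -> csmooth h' -> dom A c p ->
  pd i (fun q => h q + h' q) c p = pd i h c p + pd i h' c p.
Proof. by move=> sh sh' cp; apply: deriveD; exact: csmooth_derivable. Qed.

Lemma pdN i h p : csmooth h -> dom A c p ->
  pd i (fun q => - h q) c p = - pd i h c p.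
Proof. by move=> sh cp; apply: deriveN; exact: csmooth_derivable. Qed.

Lemma pdB i h h' p : csmooth h -> csmooth h' -> dom A c p ->
  pd i (fun q => h q - h' q) c p = pd i h c p - pd i h' c p.
Proof. by move=> sh sh' cp; rewrite pdD ?pdN //; exact: csmoothN. Qed.

Lemma pdM i h h' p : csmooth h -> csmooth h' -> dom A c p ->
  pd i (fun q => h q * h' q) c p = pd i h c p * h' p + h p * pd i h' c p.
Proof.
move=> sh sh' cp; rewrite /pd /der [LHS]deriveM; do ?exact: csmooth_derivable.
rewrite /= (chartK Ac) // addrC; congr (_ + _); exact: mulrC.
Qed.

Lemma pdZ i a h p : csmooth h -> dom A c p ->
  pd i (fun q => a * h q) c p = a * pd i h c p.
Proof.
by move=> sh cp; rewrite pdM // ?pd_cst ?mul0r ?add0r //; exact: csmooth_cst.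
Qed.

Lemma pd_sum i (I : Type) (r : seq I) (F : I -> M -> R) p :
  (forall j, csmooth (F j)) -> dom A c p ->
  pd i (fun q => \sum_(j <- r) F j q) c p = \sum_(j <- r) pd i (F j) c p.
Proof.
move=> sF cp; elim: r => [|a r IH].
  rewrite big_nil (@chart_eq_pd _ _ (fun=> 0)) ?pd_cst // => q _.
  by rewrite big_nil.
rewrite big_cons -IH -pdD //; last exact: csmooth_sum.
by apply: chart_eq_pd => // q _; rewrite big_cons.
Qed.

Lemma pd_expR i h p : csmooth h -> dom A c p ->
  pd i (fun q => expR (h q)) c p = expR (h p) * pd i h c p.
Proof.
move=> sh cp; have [de ee] := is_derive_expR (h p).
rewrite /pd /der -[X in X * _]ee.
have /= := @derive_comp_real _ _ (h \o icoord A c) expR (Defs.coord A c p) 'e_i.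
rewrite (chartK Ac) // => -> //; exact: csmooth_diff.
Qed.

(** Read in the chart, [pd j h c] is a directional derivative of [h \o icoord A c] only on the chart
    image, since only there does [icoord] invert [coord]. Germs are enough to apply
    [derive_comm]. *)
Lemma pd_comm i j h p : csmooth h -> dom A c p ->
  pd i (pd j h c) c p = pd j (pd i h c) c p.
Proof.
move=> sh cp.
have E k : {near Defs.coord A c p, pd k h c \o icoord A c
    =1 'D_('e_k) (h \o icoord A c)}.
  have : nbhs (Defs.coord A c p) (cimage c).
    by apply: open_nbhs_nbhs; split => //; exact: cimage_coord.
  by apply: filterS => x [q cq <-] /=; rewrite (chartK Ac).
rewrite /pd /der /= -!/(pd _ _ _) (near_eq_derive _ (E j)).
rewrite (near_eq_derive _ (E i)).
by apply: derive_comm sh _ => //; exact: cimage_coord.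
Qed.

Lemma der_pd (X : vfield A) h p : csmooth h -> dom A c p ->
  der X h c p = \sum_i X c p 0 i * pd i h c p.
Proof.
move=> sh cp; have dh := csmooth_diff sh cp.
rewrite /der deriveE // [in LHS](row_sum_delta (X c p)) linear_sum.
by apply: eq_bigr => i _; rewrite linearZ /pd /der deriveE.
Qed.

End chart_calculus.

(** * Conformal changes of metric *)

Section sum_delta.
Context {R : pzRingType} {n : nat}.

Lemma sum_deltal (F : 'I_n -> R) j : \sum_i (i == j)%:R * F i = F j.
Proof.
rewrite (bigD1 j) //= eqxx mul1r big1 ?addr0 // => i /negPf ->.
by rewrite mul0r.
Qed.

Lemma sum_deltar (F : 'I_n -> R) j : \sum_i F i * (i == j)%:R = F j.
Proof.
rewrite (bigD1 j) //= eqxx mulr1 big1 ?addr0 // => i /negPf ->.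
by rewrite mulr0.
Qed.

End sum_delta.

(** The local content of [pseudo_riemannian], without the transformation law. It can be checked
    directly for the twisted metric and for the conformal metrics on slices. *)
Record chart_metric (R : realType) (n : nat) (M : topologicalType)
    (A : atlas R n M) (c : idx A) (g : tensor2 A) : Prop := ChartMetric {
  chart_metric_smooth : forall i j, csmooth (c := c) (fun q => g c q i j);
  chart_metric_sym : forall p i j, dom A c p -> g c p i j = g c p j i;
  chart_metric_unit : forall p, dom A c p -> g c p \in unitmx }.

(** * Christoffel symbols, gradient and Laplacian in one chart *)

Section chart_metric_theory.
Context {R : realType} {n : nat} {M : topologicalType} {A : atlas R n M}.
Context {c : idx A} (Ac : is_chart c) {g : tensor2 A} (gc : chart_metric c g).
Implicit Types (p q : M) (i j k l : 'I_n).

Local Notation h q := (invmx (g c q)).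
Local Notation Gam := (levi_civita g c).

Let gs i j : csmooth (c := c) (fun q => g c q i j).
Proof. exact: chart_metric_smooth. Qed.

Lemma chart_metric_trmx p : dom A c p -> (g c p)^T = g c p.
Proof.
by move=> cp; apply/matrixP => i j; rewrite mxE (chart_metric_sym gc).
Qed.

Lemma invmx_metric_sym p i j : dom A c p -> h p i j = h p j i.
Proof.
by move=> cp; rewrite -[in LHS](chart_metric_trmx cp) -trmx_inv mxE.
Qed.

Lemma sum_invmx_metric p i j : dom A c p ->
  \sum_l h p i l * g c p l j = (i == j)%:R.
Proof.
move=> cp; have /matrixP/(_ i j) := mulVmx (chart_metric_unit gc cp).
by rewrite !mxE.
Qed.

Lemma csmooth_invmx i j : csmooth (c := c) (fun q => h q i j).
Proof.
(* Cramer's rule: entries of the inverse are cofactors divided by the determinant. *)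
apply: (csmooth_eq Ac (h := fun q => (\det (g c q))^-1 *
    ((-1) ^+ (j + i) * \det (row' j (col' i (g c q)))))).
  by move=> q cq; rewrite /invmx (chart_metric_unit gc cq) !mxE.
apply: csmoothM => //.
  apply: csmoothV => // [q cq|]; last exact: csmooth_det.
  by have := chart_metric_unit gc cq; rewrite unitmxE unitfE.
apply: csmoothM; [exact: Ac|exact: csmooth_cst|].
apply: csmooth_det => // a b.
by apply: csmooth_eq (gs (lift j a) (lift i b)) => // q _; rewrite !mxE.
Qed.

Lemma csmooth_levi_civita k i j : csmooth (c := c) (Gam k i j).
Proof.
apply: csmoothM; [exact: Ac|exact: csmooth_cst|].
apply: csmooth_sum => // l; apply: csmoothM => //; first exact: csmooth_invmx.
by apply: csmoothB => //; [apply: csmoothD => //|]; exact: csmooth_pd.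
Qed.

Lemma pd_metric_sym p k i j : dom A c p ->
  pd k (fun q => g c q i j) c p = pd k (fun q => g c q j i) c p.
Proof.
by move=> cp; apply: chart_eq_pd => // q cq; exact: chart_metric_sym.
Qed.

Lemma levi_civita_sym p k i j : dom A c p -> Gam k i j p = Gam k j i p.
Proof.
move=> cp; rewrite /levi_civita; congr (_ * _); apply: eq_bigr => l _.
by rewrite (pd_metric_sym l i j cp) [pd i _ c p + _]addrC.
Qed.

(** Lowering the index cancels the inverse metric and leaves the Christoffel symbols of the first
    kind. *)
Lemma lower_levi_civita p i j d : dom A c p ->
  \sum_l Gam l i j p * g c p l d = 2^-1 * (pd i (fun q => g c q j d) c p
    + pd j (fun q => g c q i d) c p - pd d (fun q => g c q i j) c p).
Proof.
move=> cp; rewrite /levi_civita.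
under eq_bigr do rewrite -mulrA mulr_suml.
rewrite -mulr_sumr exchange_big /=; congr (_ * _).
under eq_bigr => m _.
  under eq_bigr => l _ do rewrite mulrAC (invmx_metric_sym l m cp).
  rewrite -mulr_suml sum_invmx_metric //; over.
by rewrite sum_deltal.
Qed.

(** Metric compatibility: of the six derivatives in the two symbols of the first kind, four cancel
    in pairs and two agree. *)
Lemma pd_metric p k i j : dom A c p ->
  pd k (fun q => g c q i j) c p =
    \sum_l Gam l k i p * g c p l j + \sum_l Gam l k j p * g c p l i.
Proof.
move=> cp; rewrite !lower_levi_civita //.
rewrite (pd_metric_sym k j i cp) (pd_metric_sym i k j cp).
rewrite (pd_metric_sym j k i cp) (pd_metric_sym j i k cp).
rewrite (pd_metric_sym i j k cp).
by field.
Qed.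

(* Differentiate [invmx g *m g = 1] and use metric compatibility. *)
Lemma pd_invmx p k i j : dom A c p ->
  pd k (fun q => h q i j) c p =
    - \sum_a Gam i k a p * h p a j - \sum_a Gam j k a p * h p a i.
Proof.
move=> cp.
pose T := \matrix_(a, l) Gam l k a p.
pose dg := \matrix_(a, b) pd k (fun q => g c q a b) c p.
pose dh := \matrix_(a, b) pd k (fun q => h q a b) c p.
have dgE : dg = T *m g c p + g c p *m T^T.
  apply/matrixP => a b; rewrite !mxE pd_metric //; congr (_ + _).
    by apply: eq_bigr => l _; rewrite mxE.
  by apply: eq_bigr => l _; rewrite !mxE mulrC (chart_metric_sym gc l a cp).
have dhg : dh *m g c p = - (h p *m dg).
  apply/matrixP => a b; apply/eqP; rewrite !mxE -addr_eq0 -big_split /=.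
  apply/eqP; rewrite -[RHS](pd_cst (c := c) k ((a == b)%:R : R) p).
  rewrite -(chart_eq_pd Ac k (fun q cq => sum_invmx_metric a b cq) cp).
  rewrite (pd_sum Ac) // => [|l].
    apply: eq_bigr => l _; rewrite !mxE (pdM Ac) //; exact: csmooth_invmx.
  by apply: csmoothM => //; exact: csmooth_invmx.
have gU := chart_metric_unit gc cp.
have -> : pd k (fun q => h q i j) c p = dh i j by rewrite mxE.
rewrite -[dh](mulmxK gU) dhg dgE mulmxDr mulNmx mulmxDl.
rewrite !mulmxA mulVmx // mul1mx mulmxK // !mxE opprD addrC; congr (- _ - _).
  by apply: eq_bigr => a _; rewrite !mxE.
by apply: eq_bigr => a _; rewrite !mxE mulrC (invmx_metric_sym i a cp).
Qed.



Section gradient.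
Context (s : M -> R) (ss : csmooth (c := c) s).

Lemma gradE p k : grad g s c p 0 k = \sum_l pd l s c p * h p l k.
Proof. by rewrite mxE; apply: eq_bigr => l _; rewrite mxE. Qed.

Lemma csmooth_grad k : csmooth (c := c) (fun q => grad g s c q 0 k).
Proof.
apply: (csmooth_eq Ac (h := fun q => \sum_l pd l s c q * h q l k)).
  by move=> q _; rewrite gradE.
apply: csmooth_sum => // l; apply: csmoothM => //; first exact: csmooth_pd.
exact: csmooth_invmx.
Qed.

Lemma sum_metric_grad p i : dom A c p ->
  \sum_k g c p i k * grad g s c p 0 k = pd i s c p.
Proof.
move=> cp; have gU := chart_metric_unit gc cp.
have : grad g s c p *m g c p = \row_l pd l s c p by rewrite mulmxKV.
move=> /matrixP/(_ 0 i); rewrite !mxE => <-; apply: eq_bigr => k _.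
by rewrite mulrC (chart_metric_sym gc i k cp).
Qed.

Lemma grad_dotE s' p : dom A c p ->
  grad_dot g s' s c p = \sum_m pd m s' c p * grad g s c p 0 m.
Proof.
move=> cp; have gU := chart_metric_unit gc cp.
rewrite /grad_dot /ev2 {1}/grad mulmxKV // mxE.
by apply: eq_bigr => m _; rewrite mxE [(_^T) _ _]mxE.
Qed.

Lemma grad_dotC s' p : dom A c p -> grad_dot g s s' c p = grad_dot g s' s c p.
Proof.
move=> cp; rewrite /grad_dot /ev2 -[RHS]trace_mx11 -mxtrace_tr.
rewrite [(_ *m _ *m _^T)^T]trmx_mul trmxK [(_ *m g c p)^T]trmx_mul.
by rewrite chart_metric_trmx // mulmxA trace_mx11.
Qed.

Lemma hessE p i j : hess g s c p i j =
  pd i (pd j s c) c p - \sum_k Gam k i j p * pd k s c p.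
Proof. by rewrite mxE. Qed.

(** The Laplacian as the divergence of the gradient. In this form it appears in the Ricci
    computations, where the derivatives of gradient components and the contractions with traces of
    Christoffel symbols come from different sums. *)
Lemma laplacian_div p : dom A c p -> laplacian g s c p =
  \sum_i pd i (fun q => grad g s c q 0 i) c p
  + \sum_m (\sum_i Gam i i m p) * grad g s c p 0 m.
Proof.
move=> cp.
have -> : \sum_m (\sum_i Gam i i m p) * grad g s c p 0 m =
    \sum_i \sum_l pd l s c p * \sum_a Gam i i a p * h p a l.
  under eq_bigr do rewrite mulr_suml.
  rewrite exchange_big /=; apply: eq_bigr => i _.
  under [RHS]eq_bigr do rewrite mulr_sumr.
  rewrite [RHS]exchange_big /=; apply: eq_bigr => m _.
  rewrite gradE mulr_sumr; apply: eq_bigr => l _.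
  by rewrite mulrCA (invmx_metric_sym m l cp).
rewrite -big_split /= /laplacian /mxtrace.
apply: (@etrans _ _ (\sum_i \sum_l (pd i (pd l s c) c p * h p l i
    - pd l s c p * \sum_a Gam l i a p * h p a i))).
  have E i : (h p *m hess g s c p) i i = \sum_l (h p l i * pd i (pd l s c) c p
      - \sum_a pd a s c p * (Gam a i l p * h p l i)).
    rewrite mxE; apply: eq_bigr => l _; rewrite hessE mulrBr.
    rewrite (invmx_metric_sym i l cp) (pd_comm Ac _ _ ss cp); congr (_ - _).
    rewrite mulr_sumr; apply: eq_bigr => a _.
    by rewrite (levi_civita_sym a l i cp); ring.
  apply: eq_bigr => i _; rewrite E !sumrB; congr (_ - _).
    by apply: eq_bigr => l _; rewrite mulrC.
  rewrite exchange_big /=; apply: eq_bigr => a _.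
  by rewrite mulr_sumr.
apply: eq_bigr => i _.
rewrite (chart_eq_pd Ac i (h' := fun q => \sum_l pd l s c q * h q l i)) //.
  2: by move=> q _; rewrite gradE.
rewrite (pd_sum Ac) //; last first.
  move=> l; apply: csmoothM => //; [exact: csmooth_pd|exact: csmooth_invmx].
rewrite -big_split /=; apply: eq_bigr => l _.
rewrite (pdM Ac) //; [|exact: csmooth_pd|exact: csmooth_invmx].
(* Of the two sums in the derivative of the inverse metric, one cancels the trace term and the other
   is the Christoffel term of the Hessian. *)
by rewrite pd_invmx // mulrBr mulrN addrA subrK.
Qed.

End gradient.

End chart_metric_theory.

(** Convertible to the metric [gL] of the theorem when [s] is [sigma]; with [s] a slice of [k] it is
    the metric induced on a vertical slice. *)
Definition conformal (R : realType) (n : nat) (M : topologicalType)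
    (A : atlas R n M) (g : tensor2 A) (s : M -> R) : tensor2 A :=
  fun c p => expR (2 * s p) *: g c p.

Section conformal.
Context {R : realType} {n : nat} {M : topologicalType} {A : atlas R n M}.
Context {c : idx A} (Ac : is_chart c) {g : tensor2 A} (gc : chart_metric c g).
Implicit Types (p q : M) (i j k l : 'I_n).
Context (s : M -> R) (ss : csmooth (c := c) s).

Local Notation gs := (conformal g s).

Local Notation h q := (invmx (g c q)).
Local Notation Gam := (levi_civita g c).

Let sg i j : csmooth (c := c) (fun q => g c q i j).
Proof. exact: chart_metric_smooth. Qed.

Let s2 : csmooth (c := c) (fun q => 2 * s q).
Proof. by apply: csmoothM => //; exact: csmooth_cst. Qed.

Let e2 : csmooth (c := c) (fun q => expR (2 * s q)).
Proof. exact: csmooth_expR. Qed.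

Lemma conformal_metric : chart_metric c gs.
Proof.
split=> [i j|p i j cp|p cp].
- apply: (csmooth_eq Ac (h := fun q => expR (2 * s q) * g c q i j)).
    by move=> q _; rewrite mxE.
  exact: csmoothM.
- by rewrite !mxE (chart_metric_sym gc i j cp).
- by rewrite unitmxZ ?(chart_metric_unit gc cp) // unitfE expR_eq0.
Qed.

Local Notation u k q := (grad g s c q 0 k).
(* The difference of the Levi-Civita connections of [gs] and [g]. *)
Definition conformal_diff k i j q : R :=
  (k == j)%:R * pd i s c q + (k == i)%:R * pd j s c q - g c q i j * u k q.

Local Notation S := conformal_diff.

(** Differentiating e^(2s) g gives e^(2s) (2 ds g + dg). The exponential cancels against that of the
    inverse metric, and the terms with ds contract to Kronecker deltas and the gradient. *)
Lemma conformal_levi_civita p k i j : dom A c p ->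
  levi_civita gs c k i j p = Gam k i j p + S k i j p.
Proof.
move=> cp; have gU := chart_metric_unit gc cp.
have pdc a b d : pd a (fun q => gs c q b d) c p =
    expR (2 * s p) *
    (2 * pd a s c p * g c p b d + pd a (fun q => g c q b d) c p).
  rewrite (chart_eq_pd Ac a (h' := fun q => expR (2 * s q) * g c q b d)) //.
    2: by move=> q _; rewrite mxE.
  by rewrite (pdM Ac) // (pd_expR Ac) // (pdZ Ac) //; ring.
rewrite /levi_civita /conformal invmxZ; last first.
  by rewrite unitmxZ ?unitfE ?expR_eq0.
rewrite (eq_bigr (fun l => (h p k l * (pd i (fun q => g c q j l) c p +
   pd j (fun q => g c q i l) c p - pd l (fun q => g c q i j) c p)) +
   2 * (h p k l * g c p l j * pd i s c p + h p k l * g c p l i * pd j s c p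
     - g c p i j * (pd l s c p * h p l k)))); last first.
  move=> l _; rewrite !pdc mxE (chart_metric_sym gc l j cp).
  rewrite (chart_metric_sym gc l i cp) (invmx_metric_sym gc l k cp).
  have := expR_eq0 (2 * s p).
  move: (expR _) (h p k l) (g c p j l) (g c p i l) (g c p i j) => e H a b d.
  move: (pd i s c p) (pd j s c p) (pd l s c p) => si sj sl.
  move: (pd i _ c p) (pd j _ c p) (pd l _ c p) => x y z.
  by move=> /negbT e0; field.
rewrite big_split /= mulrDr; congr (_ + _).
rewrite /conformal_diff -mulr_sumr mulKf ?pnatr_eq0 //.
rewrite sumrB big_split /= -!mulr_suml.
by rewrite !(sum_invmx_metric gc) // -mulr_sumr (gradE s).
Qed.

Local Opaque levi_civita pd grad.

Let cu k : csmooth (c := c) (fun q => grad g s c q 0 k).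
Proof. exact: csmooth_grad. Qed.

Let cG k i j : csmooth (c := c) (Gam k i j).
Proof. exact: csmooth_levi_civita. Qed.

Let cds i : csmooth (c := c) (pd i s c).
Proof. exact: csmooth_pd. Qed.

Let cS k i j : csmooth (c := c) (S k i j).
Proof.
by apply: csmoothB => //; [apply: csmoothD => //|]; apply: csmoothM => //;
  exact: csmooth_cst.
Qed.

Let pdS p l k i j : dom A c p -> pd l (S k i j) c p =
  (k == j)%:R * pd l (pd i s c) c p + (k == i)%:R * pd l (pd j s c) c p
  - (pd l (fun q => g c q i j) c p * u k p
     + g c p i j * pd l (fun q => u k q) c p).
Proof.
move=> cp.
have cZ (a : R) i' : csmooth (c := c) (fun q => a * pd i' s c q).
  by apply: csmoothM => //; exact: csmooth_cst.
rewrite pdB //; [|by apply: csmoothD|by apply: csmoothM].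
by rewrite pdD // !(pdZ Ac) // (pdM Ac).
Qed.

(** The terms in which [S] is contracted on its upper index all have this shape, with [a] made of
    Christoffel symbols, their traces, ds or [S] itself. *)
Let contractS p (a : 'I_n -> R) i j : \sum_k a k * S k i j p =
  a j * pd i s c p + a i * pd j s c p - g c p i j * \sum_k a k * u k p.
Proof.
rewrite mulr_sumr -(sum_deltar a j) -(sum_deltar a i) !mulr_suml.
rewrite -big_split -sumrB; apply: eq_bigr => k _ /=.
rewrite /conformal_diff mulrBr mulrDr !mulrA.
by rewrite [a k * g c p i j]mulrC.
Qed.

(** The first delta contributes ds once and the metric term removes it again, because lowering the
    gradient gives ds; the second delta contributes [n] times. *)
Let traceS p k : dom A c p -> \sum_i S i i k p = n%:R * pd k s c p.
Proof.
move=> cp; rewrite /conformal_diff sumrB big_split /= sum_deltal.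
under [in X in _ + X - _]eq_bigr do rewrite eqxx mul1r.
under [X in _ - X]eq_bigr do rewrite (chart_metric_sym gc _ k cp).
rewrite (sum_metric_grad gc) // sumr_const card_ord mulr_natl.
by rewrite addrAC subrr add0r.
Qed.

Lemma levi_civita_trace_conformal p k : dom A c p ->
  \sum_i levi_civita gs c i i k p = \sum_i Gam i i k p + n%:R * pd k s c p.
Proof.
move=> cp; rewrite -traceS // -big_split /=.
by apply: eq_bigr => i _; exact: conformal_levi_civita.
Qed.

Let S_sym p k i j : dom A c p -> S k i j p = S k j i p.
Proof.
move=> cp; rewrite /conformal_diff (chart_metric_sym gc i j cp).
by rewrite [X in X - _]addrC.
Qed.

Lemma ric_expand (g' : tensor2 A) p j k : ric g' c p j k =
  \sum_i pd i (levi_civita g' c i j k) c p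
  - \sum_i pd j (levi_civita g' c i i k) c p
  + (\sum_i \sum_m levi_civita g' c i i m p * levi_civita g' c m j k p
     - \sum_i \sum_m levi_civita g' c i j m p * levi_civita g' c m i k p).
Proof.
rewrite mxE -!sumrB -big_split /=; apply: eq_bigr => i _.
by rewrite /curvature sumrB.
Qed.

(** The terms linear in second derivatives and Christoffel symbols give (2 - n) Hess s and, through
    [DU + GU], the Laplacian; the quadratic ones give (n - 2) (ds ds - |ds|^2 g). What is not
    tensorial cancels: the traces [ga] between [T3] and [T4], the sums [X] and [Y] between [T1] and
    [T4]. *)
Lemma ric_conformal p j k : dom A c p ->
  ric gs c p j k = ric g c p j k
  - (n%:R - 2) * (hess g s c p j k - pd j s c p * pd k s c p)
  - (laplacian g s c p + (n%:R - 2) * grad_sq g s c p) * g c p j k.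
Proof.
move=> cp; pose N2 := grad_sq g s c p.
pose ga m q := \sum_i Gam i i m q.
pose G1 := \sum_i pd i (Gam i j k) c p.
pose G2 := \sum_i pd j (Gam i i k) c p.
pose G3 := \sum_i \sum_m Gam i i m p * Gam m j k p.
pose G4 := \sum_i \sum_m Gam i j m p * Gam m i k p.
pose GS := \sum_m Gam m j k p * pd m s c p.
pose GU := \sum_m ga m p * u m p.
pose DU := \sum_i pd i (fun q => u i q) c p.
pose X := \sum_i g c p i k * \sum_m Gam i j m p * u m p.
pose Y := \sum_m g c p j m * \sum_i Gam m i k p * u i p.
have cga m : csmooth (c := c) (ga m) by apply: csmooth_sum.
have us i : \sum_m g c p i m * u m p = pd i s c p by exact: sum_metric_grad.
have su : \sum_m pd m s c p * u m p = N2 by rewrite /N2 /grad_sq (grad_dotE gc).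
(* Metric compatibility turns the derivative of [g] left over from differentiating [S] into the
   Christoffel sums that also occur in the last quadratic term. *)
have XY : \sum_i pd i (fun q => g c q j k) c p * u i p = X + Y.
  under eq_bigr do rewrite (pd_metric Ac gc) // mulrDl !mulr_suml.
  rewrite big_split /=; congr (_ + _); rewrite exchange_big /=.
    apply: eq_bigr => l _; rewrite mulr_sumr; apply: eq_bigr => i _.
    by rewrite (levi_civita_sym Ac gc _ _ _ cp) mulrAC mulrC.
  apply: eq_bigr => l _; rewrite mulr_sumr; apply: eq_bigr => i _.
  by rewrite (chart_metric_sym gc l j cp) mulrAC mulrC.
have T1 : \sum_i pd i (levi_civita gs c i j k) c p =
    G1 + pd j (pd k s c) c p + pd j (pd k s c) c p
    - (X + Y + g c p j k * DU).
  rewrite -{1}(pd_comm Ac k j ss cp) -XY mulr_sumr.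
  rewrite -[pd k _ c p](sum_deltal (fun i => pd i (pd j s c) c p)).
  rewrite -[pd j _ c p](sum_deltal (fun i => pd i (pd k s c) c p)).
  rewrite -!big_split -sumrB /=; apply: eq_bigr => i _.
  rewrite (chart_eq_pd Ac i (h' := fun q => Gam i j k q + S i j k q)) //.
    by rewrite pdD // pdS // !addrA.
  by move=> q cq; exact: conformal_levi_civita.
(* The trace is taken before the derivative, so only the simple trace formula has to be
   differentiated. *)
have T2 : \sum_i pd j (levi_civita gs c i i k) c p =
    G2 + n%:R * pd j (pd k s c) c p.
  have cC i : csmooth (c := c) (levi_civita gs c i i k).
    exact (csmooth_levi_civita Ac conformal_metric _ _ _).
  have cT : csmooth (c := c) (fun q => n%:R * pd k s c q).
    by apply: csmoothM => //; exact: csmooth_cst.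
  have E1 : \sum_i pd j (levi_civita gs c i i k) c p =
      pd j (fun q => \sum_i levi_civita gs c i i k q) c p.
    exact (esym (pd_sum Ac j _ cC cp)).
  have E2 : G2 = pd j (fun q => \sum_i Gam i i k q) c p.
    exact (esym (pd_sum Ac j _ (fun i => cG i i k) cp)).
  have E3 := pdZ Ac j n%:R (cds k) cp.
  rewrite [LHS]E1 [X in X + _]E2 -[X in _ + X]E3.
  apply: etrans _ (pdD j (csmooth_sum Ac _ (fun i => cG i i k)) cT cp).
  apply: (chart_eq_pd Ac) => // q cq; exact: levi_civita_trace_conformal.
have T3 : \sum_i \sum_m levi_civita gs c i i m p *
      levi_civita gs c m j k p =
    G3 + (ga k p * pd j s c p + ga j p * pd k s c p - g c p j k * GU)
    + n%:R * GS + n%:R * (2 * (pd j s c p * pd k s c p) - g c p j k * N2).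
  have E m : \sum_i levi_civita gs c i i m p *
      levi_civita gs c m j k p = ga m p * Gam m j k p
      + ga m p * S m j k p + n%:R * (Gam m j k p * pd m s c p)
      + n%:R * (pd m s c p * S m j k p).
    rewrite -mulr_suml conformal_levi_civita //.
    under eq_bigr do rewrite conformal_levi_civita //.
    rewrite big_split /= traceS // -/(ga m p).
    by move: (ga m p) (Gam m j k p) (S m j k p) (pd m s c p) => x y z w; ring.
  rewrite exchange_big /=; under eq_bigr do rewrite E.
  rewrite !big_split /= -!mulr_sumr !contractS su.
  congr (_ + _ + _ + _).
    rewrite [RHS]exchange_big /=.
    by apply: eq_bigr => m _; rewrite mulr_suml.
  by move: (pd j s c p) (pd k s c p) (g c p j k * N2) => x y z; ring.
have T4 : \sum_i \sum_m levi_civita gs c i j m p *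
      levi_civita gs c m i k p =
    G4 + (GS + ga j p * pd k s c p - X) + (ga k p * pd j s c p + GS - Y)
    + ((n%:R + 2) * (pd j s c p * pd k s c p) - 2 * (g c p j k * N2)).
  have E i m : levi_civita gs c i j m p *
      levi_civita gs c m i k p = Gam i j m p * Gam m i k p
      + Gam i j m p * S m i k p + Gam m i k p * S i j m p
      + S i j m p * S m i k p.
    rewrite !conformal_levi_civita //.
    by move: (Gam i j m p) (Gam m i k p) (S i j m p) (S m i k p) => *; ring.
  under eq_bigr => i _ do rewrite (eq_bigr _ (fun m _ => E i m)) !big_split /=.
  rewrite !big_split /=; congr (_ + _ + _ + _).
  - under eq_bigr do rewrite contractS.
    rewrite sumrB big_split /=; congr (_ + _ - _).
    rewrite -mulr_suml; congr (_ * _).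
    by apply: eq_bigr => i _; exact: levi_civita_sym.
  - rewrite exchange_big /=; under eq_bigr do rewrite contractS.
    by rewrite sumrB big_split /=; congr (_ + _ - _); rewrite -mulr_suml.
  under eq_bigr do rewrite contractS.
  (* The first delta term and the metric term of [S] cancel, since lowering [u] gives ds. *)
  have Su i : \sum_m S i j m p * u m p = (i == j)%:R * N2.
    rewrite (eq_bigr (fun m => (m == i)%:R * (pd j s c p * u m p)
      + (i == j)%:R * (pd m s c p * u m p) - u i p * (g c p j m * u m p))).
      rewrite sumrB big_split /= sum_deltal -!mulr_sumr su us.
      by rewrite mulrC addrAC subrr add0r.
    move=> m _; rewrite /conformal_diff (eq_sym m i).
    by move: (pd j s c p) (pd m s c p) (u i p) (u m p) (g c p j m) => *; ring.
  under eq_bigr do rewrite Su.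
  rewrite sumrB big_split /= -mulr_suml.
  have -> : \sum_i S i j i p = n%:R * pd j s c p.
    rewrite -traceS //; apply: eq_bigr => i _; exact: S_sym.
  have -> : \sum_i S i j k p * pd i s c p =
      2 * (pd j s c p * pd k s c p) - g c p j k * N2.
    under eq_bigr do rewrite mulrC.
    rewrite contractS su.
    by move: (pd j s c p) (pd k s c p) (g c p j k * N2) => x y z; ring.
  have -> : \sum_i g c p i k * ((i == j)%:R * N2) = g c p j k * N2.
    by under eq_bigr do rewrite mulrCA; rewrite sum_deltal.
  by move: (pd j s c p) (pd k s c p) (g c p j k * N2) => x y z; ring.
have -> : laplacian g s c p = DU + GU by exact: laplacian_div.
have -> : hess g s c p j k = pd j (pd k s c) c p - GS by exact: hessE.
have -> : ric g c p j k = G1 - G2 + (G3 - G4) by exact: ric_expand.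
apply: etrans (ric_expand _ _ _ _) _.
apply: etrans (congr2 +%R (congr2 (fun a b => a - b) T1 T2)
  (congr2 (fun a b => a - b) T3 T4)) _.
rewrite -/N2; clearbody G1 G2 G3 G4 GS GU DU X Y N2.
move: (pd j (pd k s c) c p) (ga j p) (ga k p) (pd j s c p) (pd k s c p).
by move: (g c p j k) => *; ring.
Qed.

End conformal.

(** * Twisted products *)

Section product_chart.
Context {R : realType} {n1 n2 : nat} {M1 M2 : topologicalType}.
Context {A1 : atlas R n1 M1} {A2 : atlas R n2 M2}.
Context {c1 : idx A1} {c2 : idx A2} (Ac1 : is_chart c1) (Ac2 : is_chart c2).
Implicit Types (h : M1 * M2 -> R) (p q : M1 * M2).

Local Notation A := (prod_atlas A1 A2).
Local Notation c := ((c1, c2) : idx A).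

Lemma cimage_prod :
  cimage c = (lsubmx @^-1` cimage c1) `&` (rsubmx @^-1` cimage c2).
Proof.
apply/seteqP; split=> [x [[p1 p2] [/= cp1 cp2] <-]|
  x [[p1 cp1 e1] [p2 cp2 e2]]].
  by split; rewrite /= ?row_mxKl ?row_mxKr; [exists p1|exists p2].
by exists (p1, p2); [split|rewrite /= e1 e2 hsubmxK].
Qed.

Lemma is_chart_prod : is_chart c.
Proof.
split=> [|[p1 p2] [/= cp1 cp2]].
  rewrite cimage_prod; apply: openI; apply: open_comp.
  - by move=> x _; exact: continuous_lsubmx.
  - exact: chart_open.
  - by move=> x _; exact: continuous_rsubmx.
  - exact: chart_open.
by rewrite /= row_mxKl row_mxKr (chartK Ac1) // (chartK Ac2).
Qed.

Lemma csmooth_slice1 h (p2 : M2) : csmooth (c := c) h -> dom A2 c2 p2 ->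
  csmooth (c := c1) (slice1 h p2).
Proof.
move=> sh cp2; have oI := chart_open Ac1.
apply: (@smooth_on_eq _ _ _ _ ((h \o icoord A c) \o
    (fun x => row_mx x (Defs.coord A2 c2 p2)))) => //.
  by move=> x _; rewrite /slice1 /= row_mxKl row_mxKr (chartK Ac2).
apply: (smooth_on_comp_rV oI _ _ sh).
  move=> x cx; rewrite cimage_prod /= row_mxKl row_mxKr.
  by split=> //; exists p2.
apply: (smooth_on_rV oI) => i; case: (split_ordP i) => a ->.
  apply: (@smooth_on_eq _ _ _ _ (rVcoord a)) => //.
    by move=> x _; rewrite /rVcoord row_mxEl.
  exact: smooth_on_rVcoord.
apply: (@smooth_on_eq _ _ _ _ (cst (Defs.coord A2 c2 p2 0 a))) => //.
  by move=> x _; rewrite row_mxEr.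
exact: smooth_on_cst.
Qed.

Lemma csmooth_slice2 h (p1 : M1) : csmooth (c := c) h -> dom A1 c1 p1 ->
  csmooth (c := c2) (slice2 h p1).
Proof.
move=> sh cp1; have oI := chart_open Ac2.
apply: (@smooth_on_eq _ _ _ _ ((h \o icoord A c) \o
    (fun x => row_mx (Defs.coord A1 c1 p1) x))) => //.
  by move=> x _; rewrite /slice2 /= row_mxKl row_mxKr (chartK Ac1).
apply: (smooth_on_comp_rV oI _ _ sh).
  move=> x cx; rewrite cimage_prod /= row_mxKl row_mxKr.
  by split=> //; exists p1.
apply: (smooth_on_rV oI) => i; case: (split_ordP i) => a ->.
  apply: (@smooth_on_eq _ _ _ _ (cst (Defs.coord A1 c1 p1 0 a))) => //.
    by move=> x _; rewrite row_mxEl.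
  exact: smooth_on_cst.
apply: (@smooth_on_eq _ _ _ _ (rVcoord a)) => //.
  by move=> x _; rewrite /rVcoord row_mxEr.
exact: smooth_on_rVcoord.
Qed.

Let csmooth_sub m (ca : 'I_m -> 'I_(n1 + n2)) (D : set 'rV[R]_m)
    (F : 'rV[R]_m -> R) (u : 'rV[R]_(n1 + n2) -> 'rV[R]_m) :
  (forall x i, u x 0 i = x 0 (ca i)) ->
  (forall x, cimage c x -> D (u x)) -> smooth_on D F ->
  smooth_on (cimage c) (F \o u).
Proof.
move=> uE uD sF; have oI := chart_open is_chart_prod.
apply: (smooth_on_comp_rV oI uD _ sF).
apply: (smooth_on_rV oI) => i.
apply: (@smooth_on_eq _ _ _ _ (rVcoord (ca i))) => //.
exact: smooth_on_rVcoord.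
Qed.

Lemma csmooth_pull1 (F : M1 -> R) :
  csmooth (c := c1) F -> csmooth (c := c) (fun q => F q.1).
Proof.
apply: (@csmooth_sub _ (lshift n2) _ _ lsubmx) => [x i|x]; first by rewrite mxE.
by rewrite cimage_prod => -[].
Qed.

Lemma csmooth_pull2 (F : M2 -> R) :
  csmooth (c := c2) F -> csmooth (c := c) (fun q => F q.2).
Proof.
apply: (@csmooth_sub _ (@rshift n1 n2) _ _ rsubmx) => [x i|x].
  by rewrite mxE.
by rewrite cimage_prod => -[].
Qed.

(** A horizontal basis vector does not move the second coordinate, so the two difference quotients
    coincide at every step [t] and have the same limit. *)
Lemma pd_lshift a h p : dom A2 c2 p.2 ->
  pd (A := A) (lshift n2 a) h c p = pd a (slice1 h p.2) c1 p.1.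
Proof.
move=> cp2; rewrite /pd /der /derive /=.
apply: (congr1 (fun F : R -> R => lim (F t @[t --> 0^']))).
apply/funext => t /=; rewrite /slice1 /=.
have e : 'e_(lshift n2 a) = row_mx ('e_a : 'rV[R]_n1) 0.
  by apply/rowP => i; case: (split_ordP i) => j ->;
    rewrite ?row_mxEl ?row_mxEr !mxE ?eq_lshift ?eq_rlshift.
rewrite e scale_row_mx add_row_mx !row_mxKl !row_mxKr scaler0 add0r.
by rewrite (chartK Ac2).
Qed.

Lemma pd_rshift a h p : dom A1 c1 p.1 ->
  pd (A := A) (rshift n1 a) h c p = pd a (slice2 h p.1) c2 p.2.
Proof.
move=> cp1; rewrite /pd /der /derive /=.
apply: (congr1 (fun F : R -> R => lim (F t @[t --> 0^']))).
apply/funext => t /=; rewrite /slice2 /=.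
have e : 'e_(rshift n1 a) = row_mx 0 ('e_a : 'rV[R]_n2).
  by apply/rowP => i; case: (split_ordP i) => j ->;
    rewrite ?row_mxEl ?row_mxEr !mxE ?eq_rshift ?eq_lrshift.
rewrite e scale_row_mx add_row_mx !row_mxKl !row_mxKr scaler0 add0r.
by rewrite (chartK Ac1).
Qed.

Lemma pd_lshift_pull1 a (F : M1 -> R) p : dom A2 c2 p.2 ->
  pd (A := A) (lshift n2 a) (fun q => F q.1) c p = pd a F c1 p.1.
Proof. by move=> cp2; rewrite pd_lshift. Qed.

Lemma pd_rshift_pull2 a (F : M2 -> R) p : dom A1 c1 p.1 ->
  pd (A := A) (rshift n1 a) (fun q => F q.2) c p = pd a F c2 p.2.
Proof. by move=> cp1; rewrite pd_rshift. Qed.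

Lemma pd_lshift_pull2 a (F : M2 -> R) p : dom A2 c2 p.2 ->
  pd (A := A) (lshift n2 a) (fun q => F q.2) c p = 0.
Proof. by move=> cp2; rewrite pd_lshift // /slice1 /= pd_cst. Qed.

Lemma pd_rshift_pull1 a (F : M1 -> R) p : dom A1 c1 p.1 ->
  pd (A := A) (rshift n1 a) (fun q => F q.1) c p = 0.
Proof. by move=> cp1; rewrite pd_rshift // /slice2 /= pd_cst. Qed.

End product_chart.

(** * Connection, Hessian and Ricci curvature of the twisted metric *)

Section twisted_product.
Context {R : realType} {n1 n2 : nat} {M1 M2 : topologicalType}.
Context {A1 : atlas R n1 M1} {A2 : atlas R n2 M2}.
Context {c1 : idx A1} {c2 : idx A2} (Ac1 : is_chart c1) (Ac2 : is_chart c2).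
Context {g1 : tensor2 A1} {g2 : tensor2 A2}.
Context (gc1 : chart_metric c1 g1) (gc2 : chart_metric c2 g2).
Context (f k : M1 * M2 -> R) (fk : forall p, f p ^+ 2 = expR (2 * k p)).

Local Notation A := (prod_atlas A1 A2).
Local Notation c := ((c1, c2) : idx A).
Context (sk : csmooth (c := c) k).
Implicit Types (h : M1 * M2 -> R) (p q : M1 * M2).
Local Notation g := (twisted_metric g1 g2 f).
Local Notation L a := (lshift n2 a).
Local Notation V a := (rshift n1 a).
Local Notation E q := (expR (2 * k q)).
Local Notation gs p := (conformal g2 (slice2 k p.1)).

Let Ac := is_chart_prod Ac1 Ac2.

Lemma twisted_metricE p : g c p = block_mx (g1 c1 p.1) 0 0 (gs p c2 p.2).
Proof.
rewrite /twisted_metric /pull1 /pull2 /hpull /vpull /= fk /conformal.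
by case: p => p1 p2; rewrite scale_block_mx add_block_mx !scaler0 !addr0 add0r.
Qed.

Lemma twisted_ll p a b : g c p (L a) (L b) = g1 c1 p.1 a b.
Proof. by rewrite twisted_metricE block_mxEul. Qed.
Lemma twisted_lv p a b : g c p (L a) (V b) = 0.
Proof. by rewrite twisted_metricE block_mxEur mxE. Qed.
Lemma twisted_vl p a b : g c p (V a) (L b) = 0.
Proof. by rewrite twisted_metricE block_mxEdl mxE. Qed.
Lemma twisted_vv p a b : g c p (V a) (V b) = E p * g2 c2 p.2 a b.
Proof. by rewrite twisted_metricE block_mxEdr mxE; case: p. Qed.

Let sE : csmooth (c := c) (fun q => E q).
Proof. by apply/csmooth_expR/csmoothM => //; exact: csmooth_cst. Qed.

Lemma conformal_slice_metric p : dom A c p -> chart_metric c2 (gs p).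
Proof.
move=> [cp1 _].
exact (conformal_metric Ac2 gc2 (csmooth_slice2 Ac1 Ac2 sk cp1)).
Qed.

Lemma twisted_chart_metric : chart_metric c g.
Proof.
split=> [i j|p i j [cp1 cp2]|p cp].
- case: (split_ordP i) => a ->; case: (split_ordP j) => b ->.
  + under eq_fun do rewrite twisted_ll.
    exact (csmooth_pull1 Ac1 Ac2 (chart_metric_smooth gc1 a b)).
  + under eq_fun do rewrite twisted_lv; exact: csmooth_cst.
  + under eq_fun do rewrite twisted_vl; exact: csmooth_cst.
  + under eq_fun do rewrite twisted_vv.
    apply: csmoothM => //.
    exact (csmooth_pull2 Ac1 Ac2 (chart_metric_smooth gc2 a b)).
- case: (split_ordP i) => a ->; case: (split_ordP j) => b ->.
  + by rewrite !twisted_ll (chart_metric_sym gc1).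
  + by rewrite twisted_lv twisted_vl.
  + by rewrite twisted_lv twisted_vl.
  + by rewrite !twisted_vv (chart_metric_sym gc2).
- have [cp1 cp2] := cp; rewrite twisted_metricE block_diag_mx_unit.
  rewrite (chart_metric_unit gc1 cp1).
  exact: chart_metric_unit (conformal_slice_metric cp) _ cp2.
Qed.

Lemma invmx_twisted p : dom A c p -> invmx (g c p) =
  block_mx (invmx (g1 c1 p.1)) 0 0 (invmx (gs p c2 p.2)).
Proof.
move=> cp; have := chart_metric_unit twisted_chart_metric cp.
by rewrite twisted_metricE; exact: invmx_block_diag.
Qed.

(* In the names below the letters [l] and [v] stand for a horizontal index
   [lshift n2 _] and a vertical index [rshift n1 _]. *)
Let gll a b : (fun q => g c q (L a) (L b)) = (fun q => g1 c1 q.1 a b).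
Proof. by apply/funext => q; exact: twisted_ll. Qed.
Let glv a b : (fun q => g c q (L a) (V b)) = (fun=> 0).
Proof. by apply/funext => q; exact: twisted_lv. Qed.
Let gvl a b : (fun q => g c q (V a) (L b)) = (fun=> 0).
Proof. by apply/funext => q; exact: twisted_vl. Qed.
Let gvv a b : (fun q => g c q (V a) (V b)) = (fun q => E q * g2 c2 q.2 a b).
Proof. by apply/funext => q; exact: twisted_vv. Qed.

Let twistedE := (gll, glv, gvl, gvv, @pd_cst).

Let pd_l_gvv a i j p : dom A c p ->
  pd (L a) (fun q => E q * g2 c2 q.2 i j) c p =
  2 * pd (L a) k c p * (E p * g2 c2 p.2 i j).
Proof.
move=> cp; have [_ cp2] := cp.
rewrite (pdM Ac) //; last first.
  exact (csmooth_pull2 Ac1 Ac2 (chart_metric_smooth gc2 i j)).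
rewrite (pd_lshift_pull2 Ac2 a (fun q : M2 => g2 c2 q i j)) // mulr0 addr0.
rewrite (pd_expR Ac) //; last by apply: csmoothM => //; exact: csmooth_cst.
rewrite (pdZ Ac) //; move: (E p) (pd _ _ _ _) (g2 _ _ _ _) => x y z.
by ring.
Qed.

Let pd_l_gll d a b p : dom A c p ->
  pd (L d) (fun q => g1 c1 q.1 a b) c p =
  pd d (fun q : M1 => g1 c1 q a b) c1 p.1.
Proof.
move=> [_ cp2].
exact (pd_lshift_pull1 Ac2 d (fun q : M1 => g1 c1 q a b) cp2).
Qed.

Let hll p a b : dom A c p ->
  invmx (g c p) (L a) (L b) = invmx (g1 c1 p.1) a b.
Proof. by move=> cp; rewrite invmx_twisted // block_mxEul. Qed.
Let hlv p a b : dom A c p -> invmx (g c p) (L a) (V b) = 0.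
Proof. by move=> cp; rewrite invmx_twisted // block_mxEur mxE. Qed.
Let hvl p a b : dom A c p -> invmx (g c p) (V a) (L b) = 0.
Proof. by move=> cp; rewrite invmx_twisted // block_mxEdl mxE. Qed.
Let hvv p a b : dom A c p ->
  invmx (g c p) (V a) (V b) = invmx (gs p c2 p.2) a b.
Proof. by move=> cp; rewrite invmx_twisted // block_mxEdr. Qed.

Local Notation G := (levi_civita g c).

Lemma levi_civita_lll d a b p : dom A c p ->
  G (L d) (L a) (L b) p = levi_civita g1 c1 d a b p.1.
Proof.
move=> cp; have [_ cp2] := cp.
rewrite /levi_civita big_split_ord /= [X in _ + X]big1 ?addr0; last first.
  by move=> l _; rewrite hlv // mul0r.
congr (_ * _); apply: eq_bigr => l _.
by rewrite hll // !gll !pd_l_gll.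
Qed.

(** The horizontal slices are totally geodesic: the block [g1] does not vary in vertical
    directions. *)
Lemma levi_civita_vll d a b p : dom A c p -> G (V d) (L a) (L b) p = 0.
Proof.
move=> cp; have [cp1 cp2] := cp; rewrite /levi_civita big1 ?mulr0 // => l _.
case: (split_ordP l) => e ->; first by rewrite hvl // mul0r.
rewrite !twistedE (pd_rshift_pull1 Ac1 e (fun q : M1 => g1 c1 q a b)) //.
by rewrite addr0 subr0 mulr0.
Qed.

Lemma levi_civita_llv d a b p : dom A c p -> G (L d) (L a) (V b) p = 0.
Proof.
move=> cp; have [cp1 cp2] := cp; rewrite /levi_civita big1 ?mulr0 // => l _.
case: (split_ordP l) => e ->; last by rewrite hlv // mul0r.
rewrite !twistedE (pd_rshift_pull1 Ac1 b (fun q : M1 => g1 c1 q a e)) //.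
by rewrite addr0 subr0 mulr0.
Qed.

(** Together with [levi_civita_llv] this says nabla_X U = X(k) U for coordinate fields: the factor 2
    from the derivative of e^(2k) meets the 1/2 of the Christoffel symbols. *)
Lemma levi_civita_vlv d a b p : dom A c p ->
  G (V d) (L a) (V b) p = (d == b)%:R * pd (L a) k c p.
Proof.
move=> cp; have [cp1 cp2] := cp.
rewrite /levi_civita big_split_ord /= big1 ?add0r; last first.
  by move=> l _; rewrite hvl // mul0r.
rewrite -(sum_invmx_metric (conformal_slice_metric cp) d b cp2) mulr_suml.
rewrite mulr_sumr; apply: eq_bigr => l _.
rewrite hvv // !twistedE pd_l_gvv // addr0 subr0 /conformal mxE.
have -> : slice2 k p.1 p.2 = k p by case: (p).
rewrite (chart_metric_sym gc2 l b cp2).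
move: (invmx _ _ _) (pd _ _ _ _) (E p * _) => x y z.
by field.
Qed.

(** The vertical slices are totally umbilical; their second fundamental form is -g(U,V) times the
    horizontal gradient of [k]. *)
Lemma levi_civita_lvv d a b p : dom A c p -> G (L d) (V a) (V b) p =
  - g2 c2 p.2 a b * (E p * grad g1 (slice1 k p.2) c1 p.1 0 d).
Proof.
move=> cp; have [cp1 cp2] := cp.
rewrite /levi_civita big_split_ord /= [X in _ + X]big1 ?addr0; last first.
  by move=> l _; rewrite hlv // mul0r.
rewrite gradE mulr_sumr mulr_sumr mulr_sumr; apply: eq_bigr => l _.
rewrite hll // !twistedE pd_l_gvv // pd_lshift //.
rewrite (invmx_metric_sym gc1 d l cp1).
move: (invmx _ _ _) (pd _ _ _ _) (E p) (g2 _ _ _ _) => x y z w.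
by field.
Qed.

(* On vertical indices the twisted product looks like the conformal change by
   [k (p.1, _)] of [g2] on the slice through [p]. *)
Lemma levi_civita_vvv d a b p : dom A c p ->
  G (V d) (V a) (V b) p = levi_civita (gs p) c2 d a b p.2.
Proof.
move=> cp; have [cp1 cp2] := cp.
rewrite /levi_civita big_split_ord /= big1 ?add0r; last first.
  by move=> l _; rewrite hvl // mul0r.
congr (_ * _); apply: eq_bigr => l _; rewrite hvv // !gvv !pd_rshift //.
have e i j : slice2 (fun q => E q * g2 c2 q.2 i j) p.1 =
    (fun q : M2 => gs p c2 q i j) by apply/funext => q; rewrite mxE.
by rewrite !e.
Qed.

Lemma levi_civita_vl d a b p : dom A c p ->
  G d (V a) (L b) p = G d (L b) (V a) p.
Proof. by move=> cp; rewrite (levi_civita_sym Ac twisted_chart_metric). Qed.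

Local Opaque pd levi_civita grad.

Lemma pd_lshift2 s a b p : dom A2 c2 p.2 -> pd (L a) (pd (L b) s c) c p =
  pd a (pd b (slice1 s p.2) c1) c1 p.1.
Proof.
move=> cp2; rewrite (pd_lshift Ac2 a (pd (L b) s c) cp2).
have -> // : slice1 (pd (L b) s c) p.2 = pd b (slice1 s p.2) c1.
by apply/funext => q; exact (pd_lshift Ac2 b s (p := (q, p.2)) cp2).
Qed.

Lemma pd_rshift2 s a b p : dom A1 c1 p.1 -> pd (V a) (pd (V b) s c) c p =
  pd a (pd b (slice2 s p.1) c2) c2 p.2.
Proof.
move=> cp1; rewrite (pd_rshift Ac1 a (pd (V b) s c) cp1).
have -> // : slice2 (pd (V b) s c) p.1 = pd b (slice2 s p.1) c2.
by apply/funext => q; exact (pd_rshift Ac1 b s (p := (p.1, q)) cp1).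
Qed.

Lemma hess_twisted_ll s a b p : dom A c p ->
  hess g s c p (L a) (L b) = hess g1 (slice1 s p.2) c1 p.1 a b.
Proof.
move=> cp; have [_ cp2] := cp; rewrite !hessE pd_lshift2 // big_split_ord /=.
rewrite [X in _ - (_ + X)]big1 ?addr0; last first.
  by move=> d _; rewrite levi_civita_vll // mul0r.
congr (_ - _); apply: eq_bigr => d _.
by rewrite levi_civita_lll // pd_lshift.
Qed.

Lemma hess_twisted_lv s a b p : dom A c p -> hess g s c p (L a) (V b) =
  pd (L a) (pd (V b) s c) c p - pd (L a) k c p * pd (V b) s c p.
Proof.
move=> cp; rewrite hessE big_split_ord /= big1 ?add0r; last first.
  by move=> d _; rewrite levi_civita_llv // mul0r.
under eq_bigr do rewrite levi_civita_vlv // -mulrA.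
by rewrite sum_deltal.
Qed.

Lemma hess_twisted_vl s a b p : dom A c p -> hess g s c p (V b) (L a) =
  pd (V b) (pd (L a) s c) c p - pd (L a) k c p * pd (V b) s c p.
Proof.
move=> cp; rewrite hessE big_split_ord /= big1 ?add0r; last first.
  by move=> d _; rewrite levi_civita_vl // levi_civita_llv // mul0r.
under eq_bigr do rewrite levi_civita_vl // levi_civita_vlv // -mulrA.
by rewrite sum_deltal.
Qed.

(** The umbilical part of the connection gives the horizontal gradient term; the difference tensor
    of the conformal slice metric gives the three vertical corrections. *)
Lemma hess_twisted_vv s a b p : csmooth (c := c) s -> dom A c p ->
  hess g s c p (V a) (V b) = hess g2 (slice2 s p.1) c2 p.2 a b
  - pd (V a) k c p * pd (V b) s c p - pd (V b) k c p * pd (V a) s c p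
  + g2 c2 p.2 a b * grad_dot g2 (slice2 k p.1) (slice2 s p.1) c2 p.2
  + E p * g2 c2 p.2 a b * grad_dot g1 (slice1 k p.2) (slice1 s p.2) c1 p.1.
Proof.
move=> ss cp; have [cp1 cp2] := cp; have sk2 := csmooth_slice2 Ac1 Ac2 sk cp1.
rewrite !hessE pd_rshift2 // big_split_ord /= !pd_rshift //.
rewrite (grad_dotC gc1 _ _ cp1) (grad_dotC gc2 _ _ cp2).
rewrite (grad_dotE gc1 _ _ cp1) (grad_dotE gc2 _ _ cp2).
have -> : \sum_d G (L d) (V a) (V b) p * pd (L d) s c p =
    - (E p * g2 c2 p.2 a b *
       \sum_m pd m (slice1 s p.2) c1 p.1 * grad g1 (slice1 k p.2) c1 p.1 0 m).
  rewrite mulr_sumr -sumrN; apply: eq_bigr => d _.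
  rewrite levi_civita_lvv // pd_lshift //.
  move: (pd _ _ _ _) (grad _ _ _ _ _ _) (E p) (g2 _ _ _ _) => x y z w; ring.
under eq_bigr => d _ do rewrite levi_civita_vvv // pd_rshift //
  (conformal_levi_civita Ac2 gc2 sk2 _ _ _ cp2) /conformal_diff mulrDl.
rewrite big_split /=.
set S := \sum_i levi_civita _ _ _ _ _ _ * _.
have -> : \sum_d ((d == b)%:R * pd a (slice2 k p.1) c2 p.2 +
    (d == a)%:R * pd b (slice2 k p.1) c2 p.2 -
    g2 c2 p.2 a b * grad g2 (slice2 k p.1) c2 p.2 0 d) *
    pd d (slice2 s p.1) c2 p.2 =
  pd a (slice2 k p.1) c2 p.2 * pd b (slice2 s p.1) c2 p.2 +
  pd b (slice2 k p.1) c2 p.2 * pd a (slice2 s p.1) c2 p.2 -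
  g2 c2 p.2 a b *
    \sum_m pd m (slice2 s p.1) c2 p.2 * grad g2 (slice2 k p.1) c2 p.2 0 m.
  under eq_bigr do rewrite mulrBl mulrDl -!mulrA.
  rewrite sumrB big_split /= !sum_deltal -mulr_sumr.
  by congr (_ - _ * _); apply: eq_bigr => m _; rewrite mulrC.
move: (pd a (pd b _ _) _ _) => x1.
move: (pd a (slice2 k _) _ _) (pd b (slice2 k _) _ _) => x2 x3.
move: (pd a (slice2 s _) _ _) (pd b (slice2 s _) _ _) => x4 x5.
move: (\sum_m _) (\sum_m _) (E p) (g2 _ _ _ _) => x6 x7 x8 x9; ring.
Qed.

Let sum_cst m (F : 'I_m -> R) a :
  (forall i, F i = a) -> \sum_i F i = m%:R * a.
Proof.
by move=> Fa; rewrite (eq_bigr (fun=> a)) // sumr_const card_ord mulr_natl.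
Qed.

Let pd_zero i (F : M1 * M2 -> R) p : (forall q, dom A c q -> F q = 0) ->
  dom A c p -> pd i F c p = 0.
Proof. by move=> F0 cp; rewrite (chart_eq_pd Ac i F0 cp) pd_cst. Qed.

Let pd_l_eq1 i (F : M1 * M2 -> R) (H : M1 -> R) p :
  (forall q, dom A c q -> F q = H q.1) -> dom A c p ->
  pd (L i) F c p = pd i H c1 p.1.
Proof.
move=> FH cp; have [_ cp2] := cp.
by rewrite (chart_eq_pd Ac (L i) FH cp) (pd_lshift_pull1 Ac2 i H cp2).
Qed.

Let pd_v_eq1 i (F : M1 * M2 -> R) (H : M1 -> R) p :
  (forall q, dom A c q -> F q = H q.1) -> dom A c p -> pd (V i) F c p = 0.
Proof.
move=> FH cp; have [cp1 _] := cp.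
by rewrite (chart_eq_pd Ac (V i) FH cp) (pd_rshift_pull1 Ac1 i H cp1).
Qed.

(** Such a trace is the logarithmic derivative of the volume density, which contains the factor
    e^(n2 k). *)
Lemma levi_civita_trace_l d p : dom A c p -> \sum_i G i i (L d) p =
  \sum_i levi_civita g1 c1 i i d p.1 + n2%:R * pd (L d) k c p.
Proof.
move=> cp; rewrite big_split_ord /=; congr (_ + _).
  by apply: eq_bigr => i _; exact: levi_civita_lll.
apply: sum_cst => i.
by rewrite levi_civita_vl // levi_civita_vlv // eqxx mul1r.
Qed.

Lemma levi_civita_trace_v d p : dom A c p -> \sum_i G i i (V d) p =
  \sum_i levi_civita (gs p) c2 i i d p.2.
Proof.
move=> cp; rewrite big_split_ord /= big1 ?add0r; last first.
  by move=> i _; exact: levi_civita_llv.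
by apply: eq_bigr => i _; exact: levi_civita_vvv.
Qed.

Let ric_expand_trace i j p : ric g c p i j =
  \sum_l pd l (G l i j) c p - \sum_l pd i (G l l j) c p
  + (\sum_m (\sum_l G l l m p) * G m i j p
     - \sum_l \sum_m G l i m p * G m l j p).
Proof.
rewrite ric_expand; congr (_ + (_ - _)); rewrite exchange_big /=.
by apply: eq_bigr => m _; rewrite mulr_suml.
Qed.

(** Besides the curvature of [g1], only vertical summation indices contribute, each with the same
    amount; hence the factor n2. The sum [Q] coming from [T3] completes the second derivatives of
    [k] in [T2] to the Hessian. *)
Lemma ric_twisted_ll a b p : dom A c p -> ric g c p (L a) (L b) =
  ric g1 c1 p.1 a b - n2%:R * (hess g1 (slice1 k p.2) c1 p.1 a b
    + pd a (slice1 k p.2) c1 p.1 * pd b (slice1 k p.2) c1 p.1).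
Proof.
move=> cp; have [cp1 cp2] := cp.
pose Q := \sum_m levi_civita g1 c1 m a b p.1 * pd m (slice1 k p.2) c1 p.1.
pose S1 := \sum_l pd l (levi_civita g1 c1 l a b) c1 p.1.
pose S2 := \sum_l pd a (levi_civita g1 c1 l l b) c1 p.1.
pose S3 := \sum_m (\sum_l levi_civita g1 c1 l l m p.1) *
  levi_civita g1 c1 m a b p.1.
pose S4 := \sum_l \sum_m levi_civita g1 c1 l a m p.1 *
  levi_civita g1 c1 m l b p.1.
have T1 : \sum_l pd l (G l (L a) (L b)) c p =
    S1.
  rewrite big_split_ord /= [X in _ + X]big1 ?addr0; last first.
    by move=> l _; apply: pd_zero => // q cq; exact: levi_civita_vll.
  apply: eq_bigr => l _.
  by apply: pd_l_eq1 => // q cq; exact: levi_civita_lll.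
have T2 : \sum_l pd (L a) (G l l (L b)) c p =
    S2 + n2%:R * pd a (pd b (slice1 k p.2) c1) c1 p.1.
  rewrite big_split_ord /=; congr (_ + _).
    apply: eq_bigr => l _.
    by apply: pd_l_eq1 => // q cq; exact: levi_civita_lll.
  rewrite -pd_lshift2 //.
  apply: sum_cst => l; apply: (chart_eq_pd Ac) => // q cq.
  by rewrite levi_civita_vl // levi_civita_vlv // eqxx mul1r.
have T3 : \sum_m (\sum_l G l l m p) * G m (L a) (L b) p =
    S3 + n2%:R * Q.
  rewrite big_split_ord /= [X in _ + X]big1 ?addr0; last first.
    by move=> l _; rewrite levi_civita_vll // mulr0.
  rewrite mulr_sumr -big_split /=; apply: eq_bigr => m _.
  rewrite levi_civita_trace_l // levi_civita_lll // pd_lshift // mulrDl.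
  by congr (_ + _); rewrite -mulrA; congr (_ * _); exact: mulrC.
have T4 : \sum_l \sum_m G l (L a) m p * G m l (L b) p =
    S4 + n2%:R * (pd a (slice1 k p.2) c1 p.1 * pd b (slice1 k p.2) c1 p.1).
  rewrite big_split_ord /=; congr (_ + _); last first.
    apply: sum_cst => l; rewrite big_split_ord /= big1 ?add0r; last first.
      by move=> m _; rewrite levi_civita_vll // mul0r.
    under eq_bigr do rewrite levi_civita_vlv // -mulrA eq_sym.
    rewrite sum_deltal levi_civita_vl // levi_civita_vlv // eqxx mul1r.
    by rewrite !pd_lshift.
  apply: eq_bigr => l _; rewrite big_split_ord /= [X in _ + X]big1 ?addr0.
    by apply: eq_bigr => m _; rewrite !levi_civita_lll.
  by move=> m _; rewrite levi_civita_llv // mul0r.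
rewrite hessE.
apply: etrans (ric_expand_trace _ _ _) _.
apply: etrans (congr2 +%R (congr2 (fun a b => a - b) T1 T2)
  (congr2 (fun a b => a - b) T3 T4)) _.
have -> : ric g1 c1 p.1 a b = S1 - S2 + (S3 - S4).
  rewrite ric_expand; congr (_ + (_ - _)); rewrite exchange_big /=.
  by apply: eq_bigr => m _; rewrite mulr_suml.
rewrite -/Q; clearbody Q S1 S2 S3 S4.
move: (pd a (pd b (slice1 k p.2) c1) c1 p.1) => x1.
by move: (pd a (slice1 k p.2) c1 p.1) (pd b (slice1 k p.2) c1 p.1) => *; ring.
Qed.

Let cG i j l : csmooth (c := c) (G i j l).
Proof. exact (csmooth_levi_civita Ac twisted_chart_metric i j l). Qed.

Let trace_v_vert d p : dom A c p ->
  \sum_l G (V l) (V l) (V d) p = \sum_l G l l (V d) p.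
Proof.
move=> cp; rewrite [RHS]big_split_ord /= [X in X + _]big1 ?add0r // => l _.
exact: levi_civita_llv.
Qed.

Let ric_assemble i j p (t1 t2 t3 t4 : R) :
  \sum_l pd l (G l i j) c p = t1 -> \sum_l pd i (G l l j) c p = t2 ->
  \sum_m (\sum_l G l l m p) * G m i j p = t3 ->
  \sum_l \sum_m G l i m p * G m l j p = t4 ->
  ric g c p i j = t1 - t2 + (t3 - t4).
Proof. by move=> <- <- <- <-; exact: ric_expand_trace. Qed.

Let div_lv a b p : dom A c p ->
  \sum_l pd l (G l (L a) (V b)) c p = pd (L a) (pd (V b) k c) c p.
Proof.
move=> cp; rewrite big_split_ord /= big1 ?add0r; last first.
  by move=> l _; apply: pd_zero => // q cq; exact: levi_civita_llv.
rewrite -(pd_comm Ac (V b) (L a) sk cp).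
rewrite -[RHS](sum_deltal (fun l => pd (V l) (pd (L a) k c) c p)).
apply: eq_bigr => l _.
rewrite -(pdZ Ac (V l) (l == b)%:R (csmooth_pd Ac (L a) sk) cp).
by apply: (chart_eq_pd Ac) => // q cq; exact: levi_civita_vlv.
Qed.

Let trace_lv a b p : dom A c p ->
  \sum_m (\sum_l G l l m p) * G m (L a) (V b) p =
  (\sum_l G l l (V b) p) * pd (L a) k c p.
Proof.
move=> cp; rewrite big_split_ord /= [X in X + _]big1 ?add0r; last first.
  by move=> l _; rewrite levi_civita_llv // mulr0.
under eq_bigr do rewrite levi_civita_vlv // mulrCA.
by rewrite sum_deltal.
Qed.

(** The two quadratic sums are equal and cancel. The divergence contributes XU(k) once, the
    derivative of the trace n2 times with the opposite sign. *)
Lemma ric_twisted_lv a b p : dom A c p -> ric g c p (L a) (V b) =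
  (1 - n2%:R) * pd (L a) (pd (V b) k c) c p.
Proof.
move=> cp; have [cp1 cp2] := cp.
have T2 : \sum_l pd (L a) (G l l (V b)) c p =
    n2%:R * pd (L a) (pd (V b) k c) c p.
  have E1 : \sum_l pd (L a) (G l l (V b)) c p =
      pd (L a) (fun q => \sum_l G l l (V b) q) c p.
    exact (esym (pd_sum Ac (L a) _ (fun l => cG l l (V b)) cp)).
  rewrite [LHS]E1.
  (* The conformal trace formula splits the vertical trace into this function on [M2], which
     horizontal derivatives annihilate, and n2 dk. *)
  pose F (q : M2) := \sum_i levi_civita g2 c2 i i b q.
  have sF : csmooth (c := c) (fun q => F q.2).
    apply: (csmooth_pull2 Ac1 Ac2 (F := F)).
    by apply: csmooth_sum => // i; exact: csmooth_levi_civita.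
  have sV := csmooth_pd Ac (V b) sk.
  have sZ : csmooth (c := c) (fun q => n2%:R * pd (V b) k c q).
    by apply: csmoothM => //; exact: csmooth_cst.
  rewrite -(pdZ Ac (L a) n2%:R sV cp) -[RHS]add0r.
  rewrite -[X in X + _](pd_lshift_pull2 (c1 := c1) Ac2 a F cp2).
  apply: etrans _ (pdD (L a) sF sZ cp).
  apply: (chart_eq_pd Ac) => // q cq; have [cq1 cq2] := cq.
  rewrite levi_civita_trace_v //.
  have sk2 := csmooth_slice2 Ac1 Ac2 sk cq1.
  rewrite (levi_civita_trace_conformal Ac2 gc2 sk2) //.
  by rewrite (pd_rshift Ac1 b k cq1).
have T4 : \sum_l \sum_m G l (L a) m p * G m l (V b) p =
    (\sum_l G l l (V b) p) * pd (L a) k c p.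
  rewrite -trace_v_vert // big_split_ord /= [X in X + _]big1 ?add0r; last first.
    move=> l _; rewrite big_split_ord /= !big1 ?addr0 // => m _.
      by rewrite levi_civita_llv // mul0r.
    by rewrite (levi_civita_llv _ l) // mulr0.
  rewrite mulr_suml; apply: eq_bigr => l _.
  rewrite big_split_ord /= big1 ?add0r.
    under eq_bigr do rewrite levi_civita_vlv // -mulrA eq_sym.
    by rewrite sum_deltal mulrC.
  by move=> m _; rewrite levi_civita_vll // mul0r.
rewrite (ric_assemble (div_lv a b cp) T2 (trace_lv a b cp) T4).
by rewrite subrr addr0 mulrBl mul1r.
Qed.

(** The equation contains the transposed entry as well. Torsion-freeness reduces the divergence and
    trace sums to those of [ric_twisted_lv], but the derivative of the trace is now a vertical one
    and is computed differently. *)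
Lemma ric_twisted_vl a b p : dom A c p -> ric g c p (V b) (L a) =
  (1 - n2%:R) * pd (L a) (pd (V b) k c) c p.
Proof.
move=> cp; have [cp1 cp2] := cp.
have T1 : \sum_l pd l (G l (V b) (L a)) c p = pd (L a) (pd (V b) k c) c p.
  rewrite -(div_lv a b cp); apply: eq_bigr => l _.
  by apply: (chart_eq_pd Ac) => // q cq; exact: levi_civita_vl.
have T2 : \sum_l pd (V b) (G l l (L a)) c p =
    n2%:R * pd (L a) (pd (V b) k c) c p.
  rewrite big_split_ord /= big1 ?add0r; last first.
    move=> l _; apply: (@pd_v_eq1 _ _ (levi_civita g1 c1 l l a)) => // q cq.
    exact: levi_civita_lll.
  rewrite -(pd_comm Ac (V b) (L a) sk cp); apply: sum_cst => l.
  apply: (chart_eq_pd Ac) => // q cq.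
  by rewrite levi_civita_vl // levi_civita_vlv // eqxx mul1r.
have T3 : \sum_m (\sum_l G l l m p) * G m (V b) (L a) p =
    (\sum_l G l l (V b) p) * pd (L a) k c p.
  by rewrite -trace_lv //; apply: eq_bigr => m _; rewrite levi_civita_vl.
have T4 : \sum_l \sum_m G l (V b) m p * G m l (L a) p =
    (\sum_l G l l (V b) p) * pd (L a) k c p.
  rewrite -trace_v_vert // big_split_ord /= [X in X + _]big1 ?add0r; last first.
    move=> l _; rewrite big_split_ord /= !big1 ?addr0 // => m _.
      by rewrite levi_civita_vll // mulr0.
    by rewrite levi_civita_vl // levi_civita_llv // mul0r.
  rewrite mulr_suml; apply: eq_bigr => l _.
  rewrite big_split_ord /= big1 ?add0r.
    under eq_bigr do rewrite levi_civita_vl // levi_civita_vlv // mulrCA.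
    rewrite sum_deltal; congr (_ * _).
    exact (levi_civita_sym Ac twisted_chart_metric _ _ _ cp).
  by move=> m _; rewrite [X in _ * X]levi_civita_vl // levi_civita_llv // mulr0.
rewrite (ric_assemble T1 T2 T3 T4).
by rewrite subrr addr0 mulrBl mul1r.
Qed.

(** The purely vertical sums form the Ricci tensor of the slice metric. In the rest, the term 2N
    from differentiating e^(2k) in [T1] cancels against [T4], and [DU + GU] is the horizontal
    Laplacian of [k]. *)
Lemma ric_twisted_vv a b p : dom A c p -> ric g c p (V a) (V b) =
  ric (gs p) c2 p.2 a b
  - E p * (laplacian g1 (slice1 k p.2) c1 p.1
           + n2%:R * grad_sq g1 (slice1 k p.2) c1 p.1) * g2 c2 p.2 a b.
Proof.
move=> cp; have [cp1 cp2] := cp.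
pose k1 := slice1 k p.2; have sk1 : csmooth (c := c1) k1.
  exact (csmooth_slice1 Ac1 Ac2 sk cp2).
pose u d (q : M1) := grad g1 k1 c1 q 0 d.
have su d : csmooth (c := c1) (u d) by exact: csmooth_grad.
pose N := grad_sq g1 k1 c1 p.1.
have NE : N = \sum_m pd m k1 c1 p.1 * u m p.1 by exact: grad_dotE.
pose DU := \sum_d pd d (u d) c1 p.1.
pose GU := \sum_m (\sum_i levi_civita g1 c1 i i m p.1) * u m p.1.
pose S1 := \sum_l pd l (levi_civita (gs p) c2 l a b) c2 p.2.
pose S2 := \sum_l pd a (levi_civita (gs p) c2 l l b) c2 p.2.
pose S3 := \sum_m (\sum_l levi_civita (gs p) c2 l l m p.2) *
  levi_civita (gs p) c2 m a b p.2.
pose S4 := \sum_l \sum_m levi_civita (gs p) c2 l a m p.2 *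
  levi_civita (gs p) c2 m l b p.2.
have Ek : expR (2 * k1 p.1) = E p by rewrite /k1 /slice1; case: (p).
have T1 : \sum_l pd l (G l (V a) (V b)) c p =
    S1 - g2 c2 p.2 a b * (E p * (2 * N + DU)).
  rewrite big_split_ord /= addrC; congr (_ + _).
    apply: eq_bigr => l _; rewrite (pd_rshift Ac1 l _ cp1).
    apply: (chart_eq_pd Ac2) => // q cq.
    exact (levi_civita_vvv l a b (p := (p.1, q)) (conj cp1 cq)).
  rewrite NE /DU -mulNr !mulr_sumr -big_split /= !mulr_sumr.
  apply: eq_bigr => l _; rewrite (pd_lshift Ac2 l _ cp2).
  have s2 : csmooth (c := c1) (fun q : M1 => 2 * k1 q).
    by apply: csmoothM => //; exact: csmooth_cst.
  have se : csmooth (c := c1) (fun q : M1 => expR (2 * k1 q)).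
    exact: csmooth_expR.
  have seu : csmooth (c := c1) (fun q : M1 => expR (2 * k1 q) * u l q).
    exact: csmoothM.
  rewrite (chart_eq_pd Ac1 l (h' := fun q : M1 =>
    - g2 c2 p.2 a b * (expR (2 * k1 q) * u l q)) _ cp1); last first.
    move=> q cq.
    exact (levi_civita_lvv l a b (p := (q, p.2)) (conj cq cp2)).
  rewrite (pdZ Ac1 l _ seu cp1) (pdM Ac1 l se (su l) cp1).
  rewrite (pd_expR Ac1 l s2 cp1) (pdZ Ac1 l 2 sk1 cp1) Ek.
  by congr (_ * _); rewrite mulrDr -!mulrA.
have T2 : \sum_l pd (V a) (G l l (V b)) c p = S2.
  rewrite big_split_ord /= big1 ?add0r; last first.
    by move=> l _; apply: pd_zero => // q cq; exact: levi_civita_llv.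
  apply: eq_bigr => l _; rewrite (pd_rshift Ac1 a _ cp1).
  apply: (chart_eq_pd Ac2) => // q cq.
  exact (levi_civita_vvv l l b (p := (p.1, q)) (conj cp1 cq)).
have T3 : \sum_m (\sum_l G l l m p) * G m (V a) (V b) p =
    S3 - g2 c2 p.2 a b * (E p * (GU + n2%:R * N)).
  rewrite big_split_ord /= addrC; congr (_ + _).
    apply: eq_bigr => m _.
    by rewrite levi_civita_trace_v // levi_civita_vvv.
  rewrite NE /GU mulr_sumr -big_split /= !mulr_sumr -sumrN.
  apply: eq_bigr => m _.
  rewrite levi_civita_trace_l // levi_civita_lvv // (pd_lshift Ac2 m _ cp2).
  rewrite -/k1 -/(u m p.1).
  move: (\sum_i _) (pd m k1 c1 p.1) (u m p.1) (E p) (g2 _ _ _ _) => x y z w v.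
  by ring.
have T4 : \sum_l \sum_m G l (V a) m p * G m l (V b) p =
    S4 - g2 c2 p.2 a b * (E p * (2 * N)).
  have E1 l m : G (L l) (V a) (V m) p * G (V m) (L l) (V b) p =
      (m == b)%:R * (- g2 c2 p.2 a m * (E p * (u l p.1 * pd l k1 c1 p.1))).
    rewrite levi_civita_lvv // levi_civita_vlv // (pd_lshift Ac2 l _ cp2).
    rewrite -/k1 -/(u l p.1).
    move: (pd l k1 c1 p.1) (u l p.1) (E p) (g2 _ _ _ _) (_%:R) => x y z w v.
    by ring.
  have E2 l m : G (V l) (V a) (L m) p * G (L m) (V l) (V b) p =
      (l == a)%:R * (- g2 c2 p.2 l b * (E p * (u m p.1 * pd m k1 c1 p.1))).
    rewrite levi_civita_vl // levi_civita_lvv // levi_civita_vlv //.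
    rewrite (pd_lshift Ac2 m _ cp2) -/k1 -/(u m p.1).
    move: (pd m k1 c1 p.1) (u m p.1) (E p) (g2 _ _ _ _) (_%:R) => x y z w v.
    by ring.
  have uN : \sum_m - g2 c2 p.2 a b * (E p * (u m p.1 * pd m k1 c1 p.1)) =
      - g2 c2 p.2 a b * (E p * N).
    rewrite NE !mulr_sumr; apply: eq_bigr => m _.
    by rewrite [u m _ * _]mulrC.
  have B1 : \sum_l \sum_m G (L l) (V a) m p * G m (L l) (V b) p =
      - g2 c2 p.2 a b * (E p * N).
    rewrite -uN; apply: eq_bigr => l _; rewrite big_split_ord /=.
    rewrite [X in X + _]big1 ?add0r; last first.
      by move=> m _; rewrite levi_civita_vl // levi_civita_llv // mul0r.
    by under eq_bigr do rewrite E1; rewrite sum_deltal.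
  have B2 : \sum_l \sum_m G (V l) (V a) m p * G m (V l) (V b) p =
      - g2 c2 p.2 a b * (E p * N) + S4.
    have -> : \sum_l \sum_m G (V l) (V a) m p * G m (V l) (V b) p =
        \sum_l \sum_m G (V l) (V a) (L m) p * G (L m) (V l) (V b) p + S4.
      rewrite -big_split /=; apply: eq_bigr => l _.
      rewrite big_split_ord /=; congr (_ + _); apply: eq_bigr => m _.
      by rewrite !levi_civita_vvv.
    congr (_ + _); rewrite exchange_big -uN /=; apply: eq_bigr => m _.
    by under eq_bigr do rewrite E2; rewrite sum_deltal.
  (* The two kinds of mixed index pairs contribute equally, which gives the factor 2. *)
  rewrite big_split_ord /= B1 B2 addrA addrC; congr (_ + _).
  by move: (g2 _ _ _ _) (E p) => x y; clearbody N; ring.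
rewrite (ric_assemble T1 T2 T3 T4).
have -> : laplacian g1 k1 c1 p.1 = DU + GU by exact: laplacian_div.
have -> : ric (gs p) c2 p.2 a b = S1 - S2 + (S3 - S4).
  rewrite ric_expand; congr (_ + (_ - _)); rewrite exchange_big /=.
  by apply: eq_bigr => m _; rewrite mulr_suml.
rewrite -/k1 -/N; clear T1 T2 T3 T4 NE; clearbody S1 S2 S3 S4 DU GU N.
by move: (g2 _ _ _ _) (E p) => x y; ring.
Qed.

End twisted_product.

(** * Vector fields with a prescribed value at a point *)

Section flat_functions.
Context {R : realType}.

(* Closed under differentiation up to linear combinations; [flat 0] is the
   classical smooth function which is flat at [0]. *)
Definition flat (m : nat) (x : R) : R :=
  if 0 < x then x^-1 ^+ m * expR (- x^-1) else 0.

Lemma flat_gt0 m x : 0 < x -> 0 < flat m x.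
Proof.
by move=> x0; rewrite /flat x0 mulr_gt0 ?expR_gt0 // exprn_gt0 ?invr_gt0.
Qed.

Lemma flat_le0 m x : x <= 0 -> flat m x = 0.
Proof. by rewrite /flat leNgt => /negbTE ->. Qed.

(** With y = 1/x this is y^(m+2) <= (m+2)! e^y, one term of the exponential series. The square makes
    the difference quotient at 0 tend to 0. *)
Lemma flat_sq m x : `|flat m x| <= (m.+2)`!%:R * x ^+ 2.
Proof.
have [x0|x0] := ltP 0 x; last first.
  by rewrite flat_le0 // normr0 mulr_ge0 // sqr_ge0.
rewrite gtr0_norm ?flat_gt0 // /flat x0.
have y0 : 0 < x^-1 by rewrite invr_gt0.
have := @expR_ge1Dxn R x^-1 m.+1 (ltW y0).
rewrite expRN => H.
have {}H : x^-1 ^+ m.+2 <= (m.+2)`!%:R * expR x^-1.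
  rewrite -ler_pdivrMl ?ltr0n ?fact_gt0 // mulrC.
  by apply: le_trans H; rewrite lerDr.
rewrite ler_pdivrMr ?expR_gt0 //.
rewrite -mulrA [x ^+ 2 * _]mulrC mulrA -ler_pdivrMr ?exprn_gt0 //.
apply: le_trans H; rewrite -exprVn -exprD addn2.
exact: lexx.
Qed.

Let is_derive_flat0 m : is_derive (0 : R) (1 : R) (flat m) 0.
Proof.
have H : (fun h : R => h^-1 *: ((flat m \o shift 0) (h *: (1 : R)) - flat m 0))
    @ 0^' --> (0 : R).
  apply/cvgrPdist_le => e e0.
  have C0 : 0 < (m.+2)`!%:R :> R by rewrite ltr0n fact_gt0.
  have d0 : 0 < e / (m.+2)`!%:R by rewrite divr_gt0.
  near=> h.
  have h0 : h != 0 by near: h; exact: nbhs_dnbhs_neq.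
  rewrite sub0r normrN /= addr0 -[h *: 1]/(h * 1) mulr1.
  rewrite (flat_le0 m (lexx 0)) subr0 normrZ normfV ler_pdivrMl ?normr_gt0 //.
  apply: le_trans (flat_sq m h) _.
  rewrite -real_normK ?num_real // expr2 mulrA mulrC.
  apply: ler_wpM2l => //; rewrite -ler_pdivlMl // mulrC.
  near: h; apply: dnbhs0_le; exact: d0.
apply: DeriveDef; first exact: (cvgP _ H).
exact: cvg_lim H.
Unshelve. all: by end_near. Qed.

(** For x > 0 differentiate y^m e^(-y) at y = 1/x; for x < 0 the function vanishes nearby; at 0 the
    bound [flat_sq] decides. *)
Lemma is_derive_flat m (x : R) :
  is_derive x (1 : R) (flat m) (flat m.+2 x - m%:R * flat m.+1 x).
Proof.
have [x0|x0|->] := ltgtP x 0.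
- rewrite !flat_le0 ?ltW // mulr0 subr0.
  apply: (@near_eq_is_derive _ _ _ (cst (0 : R))).
  have : \forall y \near x, y < 0 by exact: lt_nbhsl.
  by apply: filterS => y /ltW /flat_le0 ->.
- pose P : R -> R := (id ^+ m) * (expR \o -%R).
  have dP : is_derive x^-1 (1 : R) P
      (m%:R * x^-1 ^+ m.-1 * expR (- x^-1) - x^-1 ^+ m * expR (- x^-1)).
    have d1 : is_derive (x^-1) (1 : R) (id ^+ m : R -> R)
        ((m%:R * x^-1 ^+ m.-1) *: 1) by exact: is_deriveX.
    have d2 : is_derive (x^-1) (1 : R) (expR \o -%R : R -> R)
      (expR (- x^-1) * -1) by exact: is_derive1_comp.
    apply: is_derive_eq (is_deriveM d1 d2) _.
    rewrite -[_ *: (_ * -1)]/(_ * (_ * -1)) -[_ *: (_ *: 1)]/(_ * (_ * 1)) /=.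
    rewrite !exprfctE.
    by move: (expR _) (x^-1 ^+ m) (x^-1 ^+ m.-1) => u v w; ring.
  have dV : is_derive x (1 : R) (@GRing.inv R) (- x ^- 2 *: 1).
    by apply: is_deriveV; rewrite ?lt0r_neq0.
  apply: (@near_eq_is_derive _ _ _ (P \o GRing.inv)).
    have : \forall y \near x, 0 < y by exact: lt_nbhsr.
    apply: filterS => y y0; rewrite /flat y0 /P /=.
    by rewrite -[LHS]/((id ^+ m) y^-1 * expR (- y^-1)) exprfctE.
  apply: is_derive_eq (is_derive1_comp dP dV) _.
  rewrite /flat x0 -exprVn -[_ *: 1]/(_ * 1).
  (* The exponent [m.-1] is truncated at m = 0, where its coefficient vanishes. *)
  case: m {P dP} => [|m] /=.
    by rewrite !mul0r !expr0; move: (expR _) => u; ring.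
  by rewrite !exprS; move: (expR _) => u; move: (x^-1) => v; ring.
- have -> : flat m.+2 0 - m%:R * flat m.+1 0 = 0.
    by rewrite !(flat_le0 _ (lexx 0)) mulr0 subr0.
  exact: is_derive_flat0.
Qed.

(** The induction on the order runs for all [m] at once, because a derivative involves [flat m.+1]
    and [flat m.+2]. *)
Lemma smooth_flat m : smooth_on [set: R] (flat m).
Proof.
have dF l x : derivable (flat l) x 1 by case: (is_derive_flat l x).
move=> k; elim: k m => [|k IH] m.
  by move=> x _; apply/differentiable_continuous/derivable1_diffP.
have oT := @openT R.
apply: CkS_real => //.
apply: (@Ck_eq _ _ _ _ _ (flat m.+2 \+ (cst (- m%:R) \* flat m.+1))) => //.
  move=> x _ /=; case: (is_derive_flat m x) => _ ->.
  by rewrite mulNr.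
by apply: CkD => //; apply: CkM => //; exact: Ck_cst.
Qed.

End flat_functions.

(** * Bump functions on coordinate space *)

Section bump.
Context {R : realType} {n : nat}.
Implicit Types x y : 'rV[R]_n.

(** Euclidean, because the norm on row vectors is the maximum norm, which is not smooth. *)
Definition sqdist x y : R := \sum_i (y 0 i - x 0 i) ^+ 2.

Lemma smooth_sqdist x : smooth_on [set: 'rV[R]_n] (sqdist x).
Proof.
have oT := @openT 'rV[R]_n.
apply: smooth_on_sum => // i.
have sB : smooth_on [set: 'rV[R]_n] (rVcoord i \+ cst (- x 0 i)).
  apply: smooth_onD => //; last exact: smooth_on_cst.
  exact: smooth_on_rVcoord.
apply: (@smooth_on_eq _ _ _ _ ((rVcoord i \+ cst (- x 0 i)) \*
  (rVcoord i \+ cst (- x 0 i)))) => //; last exact: smooth_onM.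
Qed.

Lemma exists_bump x (U : set 'rV[R]_n) : open U -> U x ->
  exists (b : 'rV[R]_n -> R) (K : set 'rV[R]_n),
    [/\ smooth_on [set: 'rV[R]_n] b, b x = 1, compact K, K `<=` U
      & forall y, ~ K y -> b y = 0].
Proof.
move=> oU Ux; have oT := @openT 'rV[R]_n.
have /nbhs_ballP[r /= r0 rU] : nbhs x U by exact: open_nbhs_nbhs.
(* Half the radius, so that the closed cube [K] below lies in the open ball of radius [r], itself a
   cube for the maximum norm. *)
pose e := r / 2; have e0 : 0 < e by rewrite divr_gt0.
pose h y := flat 0 (e ^+ 2 - sqdist x y).
have sh : smooth_on [set: 'rV[R]_n] h.
  apply: (@smooth_on_comp _ _ _ [set: R] (cst (e ^+ 2) \+ (\- sqdist x))) => //.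
    apply: smooth_onD => //; first exact: smooth_on_cst.
    by apply: smooth_onN => //; exact: smooth_sqdist.
  exact: smooth_flat.
have hx : 0 < h x.
  rewrite /h /sqdist big1 => [|i _]; last by rewrite subrr expr0n.
  by rewrite subr0 flat_gt0 // exprn_gt0.
exists (fun y => (h x)^-1 * h y).
(* A product of segments, hence compact; it contains the Euclidean ball of radius [e] where [h] is
   positive. *)
exists [set y | forall i, `[x 0 i - e, x 0 i + e]%classic (y 0 i)].
split.
- exact: smooth_onZ.
- by rewrite mulVf // gt_eqF.
- apply: (@rV_compact R n (fun i => `[x 0 i - e, x 0 i + e]%classic)) => i.
  exact: segment_compact.
- move=> y Ky; apply: rU; split=> // i j; rewrite (ord1 i).
  have := Ky j; rewrite /= in_itv /= => /andP[y1 y2].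
  rewrite /ball /= ltr_norml.
  have : e < r by rewrite /e ltr_pdivrMr // ltr_pMr // ltr1n.
  by move=> er; apply/andP; split; lra.
- move=> y; apply: contra_notP => /eqP.
  rewrite mulf_eq0 negb_or => /andP[_ hy] i.
  have dy : sqdist x y < e ^+ 2.
    rewrite -subr_gt0 ltNge; apply/negP => /(flat_le0 0) H.
    by move: hy; rewrite /h H eqxx.
  have H : (y 0 i - x 0 i) ^+ 2 <= e ^+ 2.
    apply: le_trans (ltW dy); rewrite /sqdist (bigD1 i) //= lerDl.
    by apply: sumr_ge0 => j _; exact: sqr_ge0.
  rewrite /= in_itv /=; apply/andP; split; nra.
Qed.

End bump.

(** * Extension of a tangent vector to a global field *)

Section extend_vector.
Context {R : realType} {n : nat} {M : topologicalType} {A : atlas R n M}.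
Context (HA : smooth_manifold A).

Lemma smooth_manifold_chart c : is_chart (A := A) c.
Proof. by split; [exact: cimage_open|move=> p; exact: coordK]. Qed.

Let overlap c c' : set 'rV[R]_n := Defs.coord A c @` (dom A c `&` dom A c').

Let overlapE c c' : overlap c c' = cimage c `&` (icoord A c @^-1` dom A c').
Proof.
apply/seteqP; split => [x [p [cp cp'] <-]|x [[p cp <-] /=]].
  by split; [exists p|rewrite /= (coordK HA)].
by rewrite (coordK HA) // => cp'; exists p.
Qed.

Lemma overlap_open c c' : open (overlap c c').
Proof.
rewrite openE => x; rewrite overlapE => -[cx cx'].
have h1 : nbhs x (cimage c).
  by apply: open_nbhs_nbhs; split => //; exact: cimage_open.
have h2 : nbhs x (icoord A c @^-1` dom A c').
  apply: (icoord_continuous HA cx); apply: open_nbhs_nbhs; split => //.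
  exact: dom_open.
exact: filterI h1 h2.
Qed.

Let overlap_coord c c' p : dom A c p -> dom A c' p ->
  overlap c c' (Defs.coord A c p).
Proof. by move=> cp cp'; exists p. Qed.

Let transition_diff c c' p : dom A c p -> dom A c' p ->
  differentiable (transition c c') (Defs.coord A c p).
Proof.
move=> cp cp'; apply: smooth_on_diff (transition_smooth HA c c') _.
exact: overlap_coord.
Qed.

Lemma mul_transition_jacobian c c' p (v : 'rV[R]_n) :
  dom A c p -> dom A c' p ->
  v *m transition_jacobian c c' p = 'D_v (transition c c') (Defs.coord A c p).
Proof.
move=> cp cp'; rewrite /transition_jacobian -deriveEjacobian //.
exact: transition_diff.
Qed.

(** The chain rule, tested on row vectors; the composite of the transition maps agrees with the
    direct one only near the point, which is enough for the derivative. *)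
Lemma transition_jacobian_comp c c' c'' p : dom A c p -> dom A c' p ->
  dom A c'' p -> transition_jacobian c c'' p =
    transition_jacobian c c' p *m transition_jacobian c' c'' p.
Proof.
move=> cp cp' cp''; apply/row_matrixP => i.
rewrite [LHS]rowE [RHS]rowE [RHS]mulmxA; move: (delta_mx 0 i) => v.
have E : v *m transition_jacobian c c' p *m transition_jacobian c' c'' p =
    'D_('D_v (transition c c') (Defs.coord A c p)) (transition c' c'')
       (Defs.coord A c' p).
  exact (etrans (congr1 (mulmx^~ _) (mul_transition_jacobian v cp cp'))
    (mul_transition_jacobian _ cp' cp'')).
apply: etrans (mul_transition_jacobian v cp cp'') _; apply: etrans _ (esym E).
set x := Defs.coord A c p.
have nx : {near x, transition c' c'' \o transition c c' =1 transition c c''}.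
  have : nbhs x (overlap c c').
    by apply: open_nbhs_nbhs; split; [exact: overlap_open|exact: overlap_coord].
  by apply: filterS => _ [q [cq cq'] <-]; rewrite /transition /= !(coordK HA).
have tx : transition c c' x = Defs.coord A c' p.
  by rewrite /transition /= (coordK HA).
have d1 := transition_diff cp cp'.
have d2 : differentiable (transition c' c'') (transition c c' x).
  by rewrite tx; exact: transition_diff.
rewrite -(near_eq_derive v nx) -tx [LHS]deriveE; last first.
  exact: differentiable_comp.
rewrite (diff_comp d1 d2) /= [in RHS](deriveE v d1) [in RHS]deriveE //.
Qed.

Lemma transition_jacobian_id c p :
  dom A c p -> transition_jacobian c c p = 1%:M.
Proof.
move=> cp; apply/row_matrixP => i.
rewrite [LHS]rowE [RHS]rowE [RHS]mulmx1.
rewrite (mul_transition_jacobian _ cp cp).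
rewrite -[RHS](derive_id (Defs.coord A c p)); apply: near_eq_derive.
have : nbhs (Defs.coord A c p) (cimage c).
  by apply: open_nbhs_nbhs; split; [exact: cimage_open|exists p].
by apply: filterS => _ [q cq <-]; rewrite /transition /= (coordK HA).
Qed.

(* Cut off the constant field [v] in the chart [c0]; the support is closed in
   [M] because [M] is Hausdorff. *)
Lemma exists_vfield c0 p (v : 'rV[R]_n) : dom A c0 p ->
  exists2 X : vfield A, smooth_vfield X & X c0 p = v.
Proof.
move=> cp.
have [b [K [sb bx cK KU bK]]] :=
  exists_bump (cimage_open HA (c := c0)) (cimage_coord cp).
pose X : vfield A := fun c q => if `[< dom A c0 q >] then
  b (Defs.coord A c0 q) *: (v *m transition_jacobian c0 c q) else 0.
exists X; last first.
  by rewrite /X asboolT // bx scale1r transition_jacobian_id // mulmx1.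
split=> [c|c c' q cq cq']; last first.
  rewrite /X; case: asboolP => [c0q|_]; last by rewrite mul0mx.
  by rewrite -scalemxAl -mulmxA -transition_jacobian_comp.
apply: smooth_on_local => x cx; set q := icoord A c x.
have cq : dom A c q by exact: (icoord_dom (smooth_manifold_chart c)).
(* Inside the domain of [c0] the field is given near the point by the cut-off formula; outside it,
   the field vanishes near the point. *)
have [c0q|c0q] := pselect (dom A c0 q).
  have ox : open_nbhs x (overlap c c0).
    by split; [exact: overlap_open|rewrite overlapE].
  exists (overlap c c0); first exact: open_nbhs_nbhs.
  pose t := transition c c0.
  (* The transported constant field is a directional derivative of the inverse transition map,
     evaluated at [t y], so its smoothness is that of a composition. *)
  exists (fun y => b (t y) *: 'D_v (transition c0 c) (t y)); last first.
    apply: filterS (open_nbhs_nbhs ox) => y; rewrite overlapE => -[cy c0y].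
    rewrite /X asboolT // mul_transition_jacobian //.
    exact: (icoord_dom (smooth_manifold_chart c)).
  have [oO _] := ox.
  apply: smooth_on_rV => // i.
  apply: (@smooth_on_eq _ _ _ _ ((b \o t) \*
    ((fun z => 'D_v (transition c0 c) z 0 i) \o t))) => //.
    by move=> y _; rewrite mxE.
  apply: smooth_onM => //.
    by apply: smooth_on_comp_rV sb => //; exact: transition_smooth.
  apply: (@smooth_on_comp_rV _ _ _ _ (overlap c0 c)) => //.
  - move=> y; rewrite overlapE => -[cy c0y]; apply: overlap_coord => //.
    exact: (icoord_dom (smooth_manifold_chart c)).
  - exact: transition_smooth.
  - apply: smooth_on_coord; first exact: overlap_open.
    by apply: smooth_on_derive; exact: transition_smooth.
have cKM : closed (icoord A c0 @` K).
  apply: compact_closed (manifold_hausdorff HA) _; apply: continuous_compact cK.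
  apply: continuous_in_subspaceT => y; rewrite inE => /KU.
  exact: icoord_continuous.
have Kq : ~ (icoord A c0 @` K) q.
  move=> [y /KU [q' c0q' <-]]; rewrite (coordK HA) // => qq'.
  by rewrite -qq' in c0q.
exists [set: 'rV[R]_n]; first exact: filterT.
exists (cst 0); first exact: smooth_on_cst.
have : nbhs x (icoord A c @^-1` ~` (icoord A c0 @` K)).
  apply: (icoord_continuous HA cx); apply: open_nbhs_nbhs; split => //.
  exact: closed_openC.
apply: filterS => y /= Ky; rewrite /X; case: asboolP => // c0y.
rewrite bK ?scale0r // => Ky'; apply: Ky.
by exists (Defs.coord A c0 (icoord A c y)) => //; rewrite (coordK HA).
Qed.

End extend_vector.

(** * The equation and the three conditions *)

Section bilinear_sum.
Context {R : comPzRingType} {m m' : nat} (x : 'rV[R]_m) (y : 'rV[R]_m').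
Implicit Types F : 'I_m -> 'I_m' -> R.

(** Tensor values and products of derivatives both take this form, so a whole side of a condition
    collapses to one [bil] of its components; basis vectors then recover the components. *)
Definition bil F : R := \sum_a \sum_b x 0 a * y 0 b * F a b.

Lemma eq_bil F F' : (forall a b, F a b = F' a b) -> bil F = bil F'.
Proof. by move=> H; do 2![apply: eq_bigr => ? _]; rewrite H. Qed.

Lemma bilD F F' : bil (fun a b => F a b + F' a b) = bil F + bil F'.
Proof.
rewrite -big_split; apply: eq_bigr => a _; rewrite -big_split.
by apply: eq_bigr => b _; rewrite mulrDr.
Qed.

Lemma bilZ z F : bil (fun a b => z * F a b) = z * bil F.
Proof.
rewrite mulr_sumr; apply: eq_bigr => a _; rewrite mulr_sumr.
by apply: eq_bigr => b _; rewrite mulrCA.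
Qed.

Lemma bilB F F' : bil (fun a b => F a b - F' a b) = bil F - bil F'.
Proof.
rewrite -mulN1r -bilZ -bilD; apply: eq_bil => a b.
by rewrite mulN1r.
Qed.

Lemma bil_eq0 F : (forall a b, F a b = 0) -> bil F = 0.
Proof.
move=> F0; rewrite /bil big1 // => a _; rewrite big1 // => b _.
by rewrite F0 mulr0.
Qed.

Lemma bil_mul (u : 'I_m -> R) (v : 'I_m' -> R) :
  bil (fun a b => u a * v b) = (\sum_a x 0 a * u a) * (\sum_b y 0 b * v b).
Proof.
rewrite mulr_suml; apply: eq_bigr => a _; rewrite mulr_sumr.
by apply: eq_bigr => b _; rewrite mulrACA.
Qed.

End bilinear_sum.

Lemma bil_delta (R : comPzRingType) m m' (F : 'I_m -> 'I_m' -> R) a b :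
  bil ('e_a) ('e_b) F = F a b.
Proof.
rewrite /bil -(sum_deltal (F^~ b) a); apply: eq_bigr => i _.
rewrite -(sum_deltal (F i) b) mulr_sumr; apply: eq_bigr => j _.
by rewrite !mxE !eqxx /= mulrA.
Qed.

Lemma pseudo_riemannian_chart (R : realType) n (M : topologicalType)
    (A : atlas R n M) (g : tensor2 A) c :
  pseudo_riemannian g -> chart_metric c g.
Proof.
move=> gm; split=> [i j|p i j cp|p cp]; first exact: metric_smooth.
  by rewrite -[in LHS](Defs.metric_sym gm cp) mxE.
exact: metric_nondegenerate.
Qed.

(** * Lie derivatives of block-diagonal tensors *)

Section lie_derivative.
Context {R : realType} {n1 n2 : nat} {M1 M2 : topologicalType}.
Context {A1 : atlas R n1 M1} {A2 : atlas R n2 M2}.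
Context {c1 : idx A1} {c2 : idx A2} (Ac1 : is_chart c1) (Ac2 : is_chart c2).
Context {g1 : tensor2 A1} {g2 : tensor2 A2}.
Context (gc1 : chart_metric c1 g1) (gc2 : chart_metric c2 g2).
Context {Z1 : vfield A1} {Z2 : vfield A2}.

Local Notation A := (prod_atlas A1 A2).
Local Notation c := ((c1, c2) : idx A).
Local Notation L a := (lshift n2 a).
Local Notation V a := (rshift n1 a).
Implicit Types (h : M1 * M2 -> R) (p q : M1 * M2).
Implicit Types (Z : vfield A) (T : tensor2 A).

Let Ac := is_chart_prod Ac1 Ac2.

Lemma der_expR Z h p : csmooth (c := c) h -> dom A c p ->
  der Z (fun q => expR (2 * h q)) c p = 2 * expR (2 * h p) * der Z h c p.
Proof.
move=> sh cp.
have s2 : csmooth (c := c) (fun q => 2 * h q).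
  by apply: csmoothM => //; exact: csmooth_cst.
rewrite (der_pd Z (csmooth_expR Ac s2) cp) (der_pd Z sh cp) mulr_sumr.
apply: eq_bigr => i _; rewrite (pd_expR Ac i s2 cp) (pdZ Ac i 2 sh cp).
by move: (Z _ _ _ _) (expR _) (pd _ _ _ _) => x y z; ring.
Qed.

(** The Leibniz rule for h g1; vertical components of [Z] enter only through Z(h), as [T] has no
    mixed entries. It is used with h = e^(2 sigma) for [g_L] and with h = 1 for the pull-back of
    [g1]. *)
Lemma lie_ll Z T h p a b : csmooth (c := c) h ->
  (forall q d, Z c q 0 (L d) = Z1 c1 q.1 0 d) ->
  (forall q i j, T c q (L i) (L j) = h q * g1 c1 q.1 i j) ->
  (forall q i j, T c q (L i) (V j) = 0) ->
  (forall q i j, T c q (V i) (L j) = 0) -> dom A c p ->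
  lie Z T c p (L a) (L b) =
    der Z h c p * g1 c1 p.1 a b + h p * lie Z1 g1 c1 p.1 a b.
Proof.
move=> sh ZL Tll Tlv Tvl cp; have [cp1 cp2] := cp.
have sg := chart_metric_smooth gc1 a b.
have sgp := csmooth_pull1 Ac1 Ac2 sg.
have shg : csmooth (c := c) (fun q => h q * g1 c1 q.1 a b) by exact: csmoothM.
have ZLf d : (fun q => Z c q 0 (L d)) = (fun q => Z1 c1 q.1 0 d).
  by apply/funext => q; exact: ZL.
have E1 : der Z (fun q => T c q (L a) (L b)) c p =
    der Z h c p * g1 c1 p.1 a b +
    h p * der Z1 (fun q : M1 => g1 c1 q a b) c1 p.1.
  have -> : (fun q => T c q (L a) (L b)) = (fun q => h q * g1 c1 q.1 a b).
    by apply/funext => q; exact: Tll.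
  rewrite (der_pd Z shg cp) (der_pd Z sh cp) (der_pd Z1 sg cp1).
  have -> : \sum_i Z1 c1 p.1 0 i * pd i (fun q : M1 => g1 c1 q a b) c1 p.1 =
      \sum_i Z c p 0 i * pd i (fun q => g1 c1 q.1 a b) c p.
    rewrite big_split_ord /= [X in _ + X]big1 ?addr0; last first.
      move=> d _.
      rewrite (pd_rshift_pull1 Ac1 d (fun q : M1 => g1 c1 q a b) cp1).
      by rewrite mulr0.
    apply: eq_bigr => d _.
    by rewrite ZL (pd_lshift_pull1 Ac2 d (fun q : M1 => g1 c1 q a b) cp2).
  rewrite mulr_suml mulr_sumr -big_split /=; apply: eq_bigr => i _.
  rewrite (pdM Ac i sh sgp cp) mulrDr mulrA; congr (_ + _).
  exact: mulrCA.
rewrite [lie Z _ _ _ _ _]mxE [lie Z1 _ _ _ _ _]mxE E1 !mulrDr !addrA.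
congr (_ + _ + _).
  rewrite big_split_ord /= [X in _ + X]big1 ?addr0 ?mulr_sumr; last first.
    by move=> d _; rewrite Tvl mulr0.
  apply: eq_bigr => d _; rewrite ZLf Tll.
  rewrite (pd_lshift_pull1 Ac2 a (fun q : M1 => Z1 c1 q 0 d) cp2).
  exact: mulrCA.
rewrite big_split_ord /= [X in _ + X]big1 ?addr0 ?mulr_sumr; last first.
  by move=> d _; rewrite Tlv mulr0.
apply: eq_bigr => d _; rewrite ZLf Tll.
rewrite (pd_lshift_pull1 Ac2 b (fun q : M1 => Z1 c1 q 0 d) cp2).
exact: mulrCA.
Qed.

(** Used with h = e^(2 omega), the vertical factor of [g_L], and with h = 1. *)
Lemma lie_vv Z T h p a b : csmooth (c := c) h ->
  (forall q d, Z c q 0 (V d) = Z2 c2 q.2 0 d) ->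
  (forall q i j, T c q (V i) (V j) = h q * g2 c2 q.2 i j) ->
  (forall q i j, T c q (L i) (V j) = 0) ->
  (forall q i j, T c q (V i) (L j) = 0) -> dom A c p ->
  lie Z T c p (V a) (V b) =
    der Z h c p * g2 c2 p.2 a b + h p * lie Z2 g2 c2 p.2 a b.
Proof.
move=> sh ZV Tvv Tlv Tvl cp; have [cp1 cp2] := cp.
have sg := chart_metric_smooth gc2 a b.
have sgp := csmooth_pull2 Ac1 Ac2 sg.
have shg : csmooth (c := c) (fun q => h q * g2 c2 q.2 a b) by exact: csmoothM.
have ZVf d : (fun q => Z c q 0 (V d)) = (fun q => Z2 c2 q.2 0 d).
  by apply/funext => q; exact: ZV.
have E1 : der Z (fun q => T c q (V a) (V b)) c p =
    der Z h c p * g2 c2 p.2 a b +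
    h p * der Z2 (fun q : M2 => g2 c2 q a b) c2 p.2.
  have -> : (fun q => T c q (V a) (V b)) = (fun q => h q * g2 c2 q.2 a b).
    by apply/funext => q; exact: Tvv.
  rewrite (der_pd Z shg cp) (der_pd Z sh cp) (der_pd Z2 sg cp2).
  have -> : \sum_i Z2 c2 p.2 0 i * pd i (fun q : M2 => g2 c2 q a b) c2 p.2 =
      \sum_i Z c p 0 i * pd i (fun q => g2 c2 q.2 a b) c p.
    rewrite big_split_ord /= [X in X + _]big1 ?add0r; last first.
      move=> d _.
      rewrite (pd_lshift_pull2 Ac2 d (fun q : M2 => g2 c2 q a b) cp2).
      by rewrite mulr0.
    apply: eq_bigr => d _.
    by rewrite ZV (pd_rshift_pull2 Ac1 d (fun q : M2 => g2 c2 q a b) cp1).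
  rewrite mulr_suml mulr_sumr -big_split /=; apply: eq_bigr => i _.
  rewrite (pdM Ac i sh sgp cp) mulrDr mulrA; congr (_ + _).
  exact: mulrCA.
rewrite [lie Z _ _ _ _ _]mxE [lie Z2 _ _ _ _ _]mxE E1 !mulrDr !addrA.
congr (_ + _ + _).
  rewrite big_split_ord /= [X in X + _]big1 ?add0r ?mulr_sumr; last first.
    by move=> d _; rewrite Tlv mulr0.
  apply: eq_bigr => d _; rewrite ZVf Tvv.
  rewrite (pd_rshift_pull2 Ac1 a (fun q : M2 => Z2 c2 q 0 d) cp1).
  exact: mulrCA.
rewrite big_split_ord /= [X in X + _]big1 ?add0r ?mulr_sumr; last first.
  by move=> d _; rewrite Tvl mulr0.
apply: eq_bigr => d _; rewrite ZVf Tvv.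
rewrite (pd_rshift_pull2 Ac1 b (fun q : M2 => Z2 c2 q 0 d) cp1).
exact: mulrCA.
Qed.

(** The components of each lift depend on their own factor only, so every cross derivative of [Z]
    vanishes. *)
Lemma lie_mixed Z T p a b :
  (forall q d, Z c q 0 (L d) = Z1 c1 q.1 0 d) ->
  (forall q d, Z c q 0 (V d) = Z2 c2 q.2 0 d) ->
  (forall q i j, T c q (L i) (V j) = 0) ->
  (forall q i j, T c q (V i) (L j) = 0) -> dom A c p ->
  lie Z T c p (L a) (V b) = 0 /\ lie Z T c p (V b) (L a) = 0.
Proof.
move=> ZL ZV Tlv Tvl [cp1 cp2].
have ZLf d : (fun q => Z c q 0 (L d)) = (fun q => Z1 c1 q.1 0 d).
  by apply/funext => q; exact: ZL.
have ZVf d : (fun q => Z c q 0 (V d)) = (fun q => Z2 c2 q.2 0 d).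
  by apply/funext => q; exact: ZV.
have der0 i j : (forall q, T c q i j = 0) ->
    der Z (fun q => T c q i j) c p = 0.
  move=> T0; have -> : (fun q => T c q i j) = (fun=> 0) by apply/funext.
  exact: derive_cst.
have dZV d : pd (L a) (fun q => Z c q 0 (V d)) c p = 0.
  by rewrite ZVf (pd_lshift_pull2 Ac2 a (fun q : M2 => Z2 c2 q 0 d) cp2).
have dZL d : pd (V b) (fun q => Z c q 0 (L d)) c p = 0.
  by rewrite ZLf (pd_rshift_pull1 Ac1 b (fun q : M1 => Z1 c1 q 0 d) cp1).
split; rewrite mxE der0 // add0r !big_split_ord /= !big1 ?addr0 // => d _;
  by rewrite ?dZV ?dZL ?Tlv ?Tvl ?mulr0 ?mul0r.
Qed.

End lie_derivative.

(** * Evaluation on lifts *)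

Section lifts.
Context {R : realType} {n1 n2 : nat} {M1 M2 : topologicalType}.
Context {A1 : atlas R n1 M1} {A2 : atlas R n2 M2}.
Context {c1 : idx A1} {c2 : idx A2} (Ac1 : is_chart c1) (Ac2 : is_chart c2).

Local Notation A := (prod_atlas A1 A2).
Local Notation c := ((c1, c2) : idx A).
Local Notation L a := (lshift n2 a).
Local Notation V a := (rshift n1 a).
Implicit Types (h : M1 * M2 -> R) (p q : M1 * M2) (T : tensor2 A).
Implicit Types (X Y : vfield A1) (U W : vfield A2).

Let Ac := is_chart_prod Ac1 Ac2.

Lemma ev2_ll T X Y p : ev2 T (hlift A2 X) (hlift A2 Y) c p =
  bil (X c1 p.1) (Y c1 p.1) (fun a b => T c p (L a) (L b)).
Proof.
rewrite /ev2 mxE big_split_ord /= [X in _ + X]big1 ?addr0; last first.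
  by move=> j _; rewrite [(_^T) _ _]mxE /hlift row_mxEr [X in _ * X]mxE mulr0.
rewrite /bil exchange_big; apply: eq_bigr => b _.
rewrite [(_^T) _ _]mxE /hlift row_mxEl mxE big_split_ord /= [X in _ + X]big1.
  by rewrite addr0 mulr_suml; apply: eq_bigr => a _; rewrite row_mxEl mulrAC.
by move=> a _; rewrite row_mxEr mxE mul0r.
Qed.

Lemma ev2_vv T U W p : ev2 T (vlift A1 U) (vlift A1 W) c p =
  bil (U c2 p.2) (W c2 p.2) (fun a b => T c p (V a) (V b)).
Proof.
rewrite /ev2 mxE big_split_ord /= [X in X + _]big1 ?add0r; last first.
  by move=> j _; rewrite [(_^T) _ _]mxE /vlift row_mxEl [X in _ * X]mxE mulr0.
rewrite /bil exchange_big; apply: eq_bigr => b _.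
rewrite [(_^T) _ _]mxE /vlift row_mxEr mxE big_split_ord /= [X in X + _]big1.
  by rewrite add0r mulr_suml; apply: eq_bigr => a _; rewrite row_mxEr mulrAC.
by move=> a _; rewrite row_mxEl mxE mul0r.
Qed.

Lemma der_hlift X h p : csmooth (c := c) h -> dom A c p ->
  der (hlift A2 X) h c p = \sum_a X c1 p.1 0 a * pd (L a) h c p.
Proof.
move=> sh cp; rewrite (der_pd (hlift A2 X) sh cp) big_split_ord /=.
rewrite [X in _ + X]big1 ?addr0; last first.
  by move=> a _; rewrite /hlift row_mxEr mxE mul0r.
by apply: eq_bigr => a _; rewrite /hlift row_mxEl.
Qed.

Lemma der_vlift U h p : csmooth (c := c) h -> dom A c p ->
  der (vlift A1 U) h c p = \sum_a U c2 p.2 0 a * pd (V a) h c p.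
Proof.
move=> sh cp; rewrite (der_pd (vlift A1 U) sh cp) big_split_ord /=.
rewrite [X in X + _]big1 ?add0r; last first.
  by move=> a _; rewrite /vlift row_mxEl mxE mul0r.
by apply: eq_bigr => a _; rewrite /vlift row_mxEr.
Qed.

(** The coefficients of a vertical lift are constant in horizontal directions, so X(U(h)) has no
    first-order term and is bilinear in the values of [X] and [U]. *)
Lemma der2_lift X U h p :
  (forall b, csmooth (c := c2) (fun q : M2 => U c2 q 0 b)) ->
  csmooth (c := c) h -> dom A c p ->
  der2 (hlift A2 X) (vlift A1 U) h c p =
  bil (X c1 p.1) (U c2 p.2) (fun a b => pd (L a) (pd (V b) h c) c p).
Proof.
move=> sU sh cp; have [cp1 cp2] := cp.
have sUp b := csmooth_pull2 Ac1 Ac2 (sU b).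
have sV b := csmooth_pd Ac (V b) sh.
have sUV b : csmooth (c := c) (fun q => U c2 q.2 0 b * pd (V b) h c q).
  exact: csmoothM.
have sS := csmooth_sum Ac (index_enum 'I_n2) sUV.
have -> : der2 (hlift A2 X) (vlift A1 U) h c p = der (hlift A2 X)
    (fun q => \sum_b U c2 q.2 0 b * pd (V b) h c q) c p.
  apply: near_eq_derive; apply: (near_chart Ac cp) => q cq.
  exact: der_vlift.
rewrite (der_hlift X sS cp); apply: eq_bigr => a _.
rewrite (pd_sum Ac (L a) _ sUV cp) mulr_sumr; apply: eq_bigr => b _.
rewrite (pdM Ac (L a) (sUp b) (sV b) cp).
rewrite (pd_lshift_pull2 Ac2 a (fun q : M2 => U c2 q 0 b) cp2).
by rewrite mul0r add0r mulrA.
Qed.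

End lifts.

(** * The equation and the conditions at one point *)

Section pointwise.
Context {R : realType} {n1 n2 : nat} {M1 M2 : topologicalType}.
Context {A1 : atlas R n1 M1} {A2 : atlas R n2 M2}.
Context {c1 : idx A1} {c2 : idx A2} (Ac1 : is_chart c1) (Ac2 : is_chart c2).
Context {g1 : tensor2 A1} {g2 : tensor2 A2}.
Context (gc1 : chart_metric c1 g1) (gc2 : chart_metric c2 g2).
Context (f k s : M1 * M2 -> R) (fk : forall p, f p ^+ 2 = expR (2 * k p)).
Context (Z1 : vfield A1) (Z2 : vfield A2).

Local Notation A := (prod_atlas A1 A2).
Local Notation c := ((c1, c2) : idx A).
Local Notation L a := (lshift n2 a).
Local Notation V a := (rshift n1 a).
Local Notation n := (n1 + n2)%N.
Local Notation g := (twisted_metric g1 g2 f).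
Local Notation gL := (conformal g s).
Local Notation om := (fun q => k q + s q).
Context (sk : csmooth (c := c) k) (ss : csmooth (c := c) s).
Context (p : M1 * M2) (cp : dom A c p) (Lam : R).

Local Notation Z := ((fun c q => hlift A2 Z1 c q + vlift A1 Z2 c q) : vfield A).
Local Notation Theta :=
  (laplacian g s c p + (n%:R - 2) * grad_sq g s c p).
Local Notation E2 := (expR (2 * s p)).

Let cp1 : dom A1 c1 p.1 := proj1 cp.
Let cp2 : dom A2 c2 p.2 := proj2 cp.
Let Ac := is_chart_prod Ac1 Ac2.
Let gT : chart_metric c g := twisted_chart_metric Ac1 Ac2 gc1 gc2 fk sk.
Let e2s : csmooth (c := c) (fun q => expR (2 * s q)).
Proof. by apply/csmooth_expR/csmoothM => //; exact: csmooth_cst. Qed.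
Let csmoothZ2 h : csmooth (c := c) h -> csmooth (c := c) (fun q => 2 * h q).
Proof. by move=> sh; apply: csmoothM => //; exact: csmooth_cst. Qed.
Let so : csmooth (c := c) om.
Proof. exact: csmoothD. Qed.

Let ZL q d : Z c q 0 (L d) = Z1 c1 q.1 0 d.
Proof. by rewrite mxE /hlift /vlift row_mxEl row_mxEl mxE addr0. Qed.
Let ZV q d : Z c q 0 (V d) = Z2 c2 q.2 0 d.
Proof. by rewrite mxE /hlift /vlift row_mxEr row_mxEr mxE add0r. Qed.

Let gLll q a b : gL c q (L a) (L b) = expR (2 * s q) * g1 c1 q.1 a b.
Proof. by rewrite mxE (twisted_ll fk). Qed.
Let gLlv q a b : gL c q (L a) (V b) = 0.
Proof. by rewrite mxE (twisted_lv fk) mulr0. Qed.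
Let gLvl q a b : gL c q (V a) (L b) = 0.
Proof. by rewrite mxE (twisted_vl fk) mulr0. Qed.
Let gLvv q a b : gL c q (V a) (V b) = expR (2 * om q) * g2 c2 q.2 a b.
Proof. by rewrite mxE (twisted_vv fk) mulrA -expRD mulrDr addrC. Qed.

Definition horizontal_lhs a b : R := ric g1 c1 p.1 a b
  - n2%:R * (hess g1 (slice1 k p.2) c1 p.1 a b
             + pd (L a) k c p * pd (L b) k c p)
  - (n%:R - 2) * (hess g1 (slice1 s p.2) c1 p.1 a b
                  - pd (L a) s c p * pd (L b) s c p)
  + E2 / 2 * lie Z1 g1 c1 p.1 a b.

Definition horizontal_rhs a b : R :=
  (E2 * (Lam - der Z s c p) + Theta) * g1 c1 p.1 a b.

Definition vertical_lhs a b : R := ric g c p (V a) (V b)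
  - (n%:R - 2) * (hess g s c p (V a) (V b) - pd (V a) s c p * pd (V b) s c p)
  + E2 * f p ^+ 2 / 2 * lie Z2 g2 c2 p.2 a b.

Definition vertical_rhs a b : R :=
  f p ^+ 2 * (E2 * (Lam - der Z om c p) + Theta) * g2 c2 p.2 a b.

Definition mixed_lhs a b : R := (n2%:R - 1) * pd (L a) (pd (V b) k c) c p
  + (n%:R - 2) * (pd (L a) (pd (V b) s c) c p - pd (L a) k c p * pd (V b) s c p
                  - pd (L a) s c p * pd (V b) s c p).

Local Notation eqn i j := ((ric gL c p + 2^-1 *: lie Z gL c p) i j =
  (Lam *: gL c p) i j).

(** The conformal formula is applied once for all four blocks; what remains is to insert the block
    values of the twisted metric. *)
Let entry (i j : 'I_n) : (ric gL c p + 2^-1 *: lie Z gL c p) i j -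
    (Lam *: gL c p) i j =
  ric g c p i j - (n%:R - 2) * (hess g s c p i j - pd i s c p * pd j s c p)
  - Theta * g c p i j + 2^-1 * lie Z gL c p i j - Lam * gL c p i j.
Proof.
rewrite [X in X - _]mxE [X in _ + X - _]mxE [X in _ - X]mxE.
by rewrite (ric_conformal Ac gT ss).
Qed.

Let eqn_iff (x y u v : R) : x - y = u - v -> (x = y <-> u = v).
Proof.
by move=> E; split=> H; apply: subr0_eq; [rewrite -E H subrr|rewrite E H subrr].
Qed.

(** Half the Lie derivative of e^(2 sigma) g1 contains e^(2 sigma) Z(sigma) g1; moved to the right,
    this produces Lambda - Z(sigma). *)
Lemma equation_ll a b :
  eqn (L a) (L b) <-> horizontal_lhs a b = horizontal_rhs a b.
Proof.
apply: eqn_iff; rewrite entry /horizontal_lhs /horizontal_rhs.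
rewrite (ric_twisted_ll Ac1 Ac2 gc1 gc2 fk sk a b cp).
rewrite (hess_twisted_ll Ac1 Ac2 gc1 gc2 fk sk s a b cp).
rewrite (lie_ll Ac1 Ac2 gc1 a b e2s ZL gLll gLlv gLvl cp) gLll.
rewrite (der_expR Ac1 Ac2 Z ss cp) (twisted_ll fk) -!(pd_lshift Ac2 _ k cp2).
move: Theta (lie Z1 g1 c1 p.1 a b) (der Z s c p) => x1 x2 x3.
move: (g1 c1 p.1 a b) E2 => x4 x5.
move: (ric _ _ _ _ _) (hess g1 _ _ _ _ _) (hess g1 _ _ _ _ _) => x6 x7 x8.
by move: (pd _ k _ _) (pd _ k _ _) (pd _ s _ _) (pd _ s _ _) => *; field.
Qed.

(** The vertical factor of [g_L] is e^(2 omega) = e^(2 sigma) f^2, so its derivative contributes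
    Z(omega) and both terms carry f^2. *)
Lemma equation_vv a b : eqn (V a) (V b) <-> vertical_lhs a b = vertical_rhs a b.
Proof.
apply: eqn_iff; rewrite entry /vertical_lhs /vertical_rhs.
have e2o := csmooth_expR Ac (csmoothZ2 so).
rewrite (lie_vv Ac1 Ac2 gc2 a b e2o ZV gLvv gLlv gLvl cp) gLvv.
rewrite (der_expR Ac1 Ac2 Z so cp) (twisted_vv fk).
have -> : expR (2 * (k p + s p)) = E2 * f p ^+ 2.
  by rewrite fk -expRD mulrDr addrC.
rewrite -fk.
move: Theta (lie Z2 g2 c2 p.2 a b) (der Z _ c p) => x1 x2 x3.
move: (g2 c2 p.2 a b) E2 => x4 x5.
move: (ric _ _ _ _ _) (hess _ _ _ _ _ _) (f p) => x6 x7 x8.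
by move: (pd _ s _ _) (pd _ s _ _) => *; field.
Qed.

(** The metric and its Lie derivative have no mixed part, so only the Ricci curvature remains, and
    it is the negative of [mixed_lhs]. *)
Lemma equation_lv a b : eqn (L a) (V b) <-> mixed_lhs a b = 0.
Proof.
have [lie0 _] := lie_mixed Ac1 Ac2 a b ZL ZV gLlv gLvl cp.
have H : (ric gL c p + 2^-1 *: lie Z gL c p) (L a) (V b) -
    (Lam *: gL c p) (L a) (V b) = 0 - mixed_lhs a b.
  rewrite entry lie0 gLlv (twisted_lv fk) /mixed_lhs.
  rewrite (ric_twisted_lv Ac1 Ac2 gc1 gc2 fk sk a b cp).
  rewrite (hess_twisted_lv Ac1 Ac2 gc1 gc2 fk sk s a b cp).
  move: Theta (pd _ (pd _ k _) _ _) (pd _ (pd _ s _) _ _) => x1 x2 x3.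
  by move: (pd _ k _ _) (pd _ s _ _) (pd _ s _ _) => *; ring.
by have [H1 H2] := eqn_iff H; split=> [/H1 /esym|/esym /H2].
Qed.

Lemma equation_vl a b : eqn (V b) (L a) <-> mixed_lhs a b = 0.
Proof.
have [_ lie0] := lie_mixed Ac1 Ac2 a b ZL ZV gLlv gLvl cp.
have H : (ric gL c p + 2^-1 *: lie Z gL c p) (V b) (L a) -
    (Lam *: gL c p) (V b) (L a) = 0 - mixed_lhs a b.
  rewrite entry lie0 gLvl (twisted_vl fk) /mixed_lhs.
  rewrite (ric_twisted_vl Ac1 Ac2 gc1 gc2 fk sk a b cp).
  rewrite (hess_twisted_vl Ac1 Ac2 gc1 gc2 fk sk s a b cp).
  rewrite (pd_comm Ac (V b) (L a) ss cp).
  move: Theta (pd _ (pd _ k _) _ _) (pd _ (pd _ s _) _ _) => x1 x2 x3.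
  by move: (pd _ k _ _) (pd _ s _ _) (pd _ s _ _) => *; ring.
by have [H1 H2] := eqn_iff H; split=> [/H1 /esym|/esym /H2].
Qed.

Section conditions.
Context (X Y : vfield A1) (U W : vfield A2).

Lemma condition_iE :
  ev2 (pull1 A2 (ric g1)) (hlift A2 X) (hlift A2 Y) c p
  - n2%:R * (ev2 (hess1 A2 g1 k) (hlift A2 X) (hlift A2 Y) c p
             + der (hlift A2 X) k c p * der (hlift A2 Y) k c p)
  - (n%:R - 2) * (ev2 (hess1 A2 g1 s) (hlift A2 X) (hlift A2 Y) c p
                  - der (hlift A2 X) s c p * der (hlift A2 Y) s c p)
  + E2 / 2 * ev2 (lie (hlift A2 Z1) (pull1 A2 g1)) (hlift A2 X) (hlift A2 Y) c p
  = bil (X c1 p.1) (Y c1 p.1) horizontal_lhs.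
Proof.
have sc : csmooth (c := c) (fun=> 1) by exact: csmooth_cst.
have lieE a b : lie (hlift A2 Z1) (pull1 A2 g1) c p (L a) (L b) =
    lie Z1 g1 c1 p.1 a b.
  rewrite (lie_ll Ac1 Ac2 gc1 a b (Z1 := Z1) (h := fun=> 1)) //.
  - by rewrite /der derive_cst mul0r add0r mul1r.
  - by move=> q d; rewrite /hlift row_mxEl.
  - by move=> q i j; rewrite /pull1 /hpull block_mxEul mul1r.
  - by move=> q i j; rewrite /pull1 /hpull block_mxEur mxE.
  - by move=> q i j; rewrite /pull1 /hpull block_mxEdl mxE.
rewrite !ev2_ll !der_hlift //.
rewrite -!bil_mul -[X in n2%:R * X]bilD -!bilB -!bilZ -!bilB -bilD.
apply: eq_bil => a b; rewrite /horizontal_lhs lieE.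
by rewrite /pull1 /hess1 /hpull !block_mxEul.
Qed.

Lemma condition_i_rhsE :
  (E2 * (Lam - der Z s c p) + Theta)
    * ev2 (pull1 A2 g1) (hlift A2 X) (hlift A2 Y) c p
  = bil (X c1 p.1) (Y c1 p.1) horizontal_rhs.
Proof.
rewrite ev2_ll -bilZ; apply: eq_bil => a b.
by rewrite /pull1 /hpull block_mxEul.
Qed.

Lemma condition_iiE :
  ev2 (ric g) (vlift A1 U) (vlift A1 W) c p
  - (n%:R - 2) * (ev2 (hess g s) (vlift A1 U) (vlift A1 W) c p
                  - der (vlift A1 U) s c p * der (vlift A1 W) s c p)
  + E2 * f p ^+ 2 / 2
    * ev2 (lie (vlift A1 Z2) (pull2 A1 g2)) (vlift A1 U) (vlift A1 W) c p
  = bil (U c2 p.2) (W c2 p.2) vertical_lhs.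
Proof.
have sc : csmooth (c := c) (fun=> 1) by exact: csmooth_cst.
have lieE a b : lie (vlift A1 Z2) (pull2 A1 g2) c p (V a) (V b) =
    lie Z2 g2 c2 p.2 a b.
  rewrite (lie_vv Ac1 Ac2 gc2 a b (Z2 := Z2) (h := fun=> 1)) //.
  - by rewrite /der derive_cst mul0r add0r mul1r.
  - by move=> q d; rewrite /vlift row_mxEr.
  - by move=> q i j; rewrite /pull2 /vpull block_mxEdr mul1r.
  - by move=> q i j; rewrite /pull2 /vpull block_mxEur mxE.
  - by move=> q i j; rewrite /pull2 /vpull block_mxEdl mxE.
rewrite !ev2_vv !der_vlift // -!bil_mul -!bilB -!bilZ -!bilB -bilD.
by apply: eq_bil => a b; rewrite /vertical_lhs lieE.
Qed.

Lemma condition_ii_rhsE :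
  f p ^+ 2 * (E2 * (Lam - der Z om c p) + Theta)
    * ev2 (pull2 A1 g2) (vlift A1 U) (vlift A1 W) c p
  = bil (U c2 p.2) (W c2 p.2) vertical_rhs.
Proof.
rewrite ev2_vv -bilZ; apply: eq_bil => a b.
by rewrite /pull2 /vpull block_mxEdr.
Qed.

Lemma condition_iiiE :
  (forall b, csmooth (c := c2) (fun q : M2 => U c2 q 0 b)) ->
  (n2%:R - 1) * der2 (hlift A2 X) (vlift A1 U) k c p
  + (n%:R - 2) * (der2 (hlift A2 X) (vlift A1 U) s c p
                  - der (hlift A2 X) k c p * der (vlift A1 U) s c p
                  - der (hlift A2 X) s c p * der (vlift A1 U) s c p)
  = bil (X c1 p.1) (U c2 p.2) mixed_lhs.
Proof.
move=> sU; rewrite !der2_lift // !der_hlift // !der_vlift //.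
by rewrite -!bil_mul -!bilB -!bilZ -bilD.
Qed.

Lemma ric_vertical : ev2 (ric g) (vlift A1 U) (vlift A1 W) c p =
  ev2 (pull2 A1 (ric g2)) (vlift A1 U) (vlift A1 W) c p
  - (n2%:R - 2) * (ev2 (hess2 A1 g2 k) (vlift A1 U) (vlift A1 W) c p
                   - der (vlift A1 U) k c p * der (vlift A1 W) k c p)
  - (laplacian2 A1 g2 k c p + (n2%:R - 2) * grad_dot2 A1 g2 k k c p)
    * ev2 (pull2 A1 g2) (vlift A1 U) (vlift A1 W) c p
  - f p ^+ 2 * (laplacian1 A2 g1 k c p + n2%:R * grad_dot1 A2 g1 k k c p)
    * ev2 (pull2 A1 g2) (vlift A1 U) (vlift A1 W) c p.
Proof.
rewrite !ev2_vv !der_vlift // -!bil_mul -!bilB -!bilZ -!bilB.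
apply: eq_bil => a b.
rewrite (ric_twisted_vv Ac1 Ac2 gc1 gc2 fk sk a b cp).
rewrite (ric_conformal Ac2 gc2 (csmooth_slice2 Ac1 Ac2 sk cp1) _ _ cp2).
rewrite !(pd_rshift Ac1 _ k cp1) fk /pull2 /hess2 /vpull !block_mxEdr.
by [].
Qed.

Lemma hess_vertical : ev2 (hess g s) (vlift A1 U) (vlift A1 W) c p =
  ev2 (hess2 A1 g2 s) (vlift A1 U) (vlift A1 W) c p
  - der (vlift A1 U) k c p * der (vlift A1 W) s c p
  - der (vlift A1 W) k c p * der (vlift A1 U) s c p
  + ev2 (pull2 A1 g2) (vlift A1 U) (vlift A1 W) c p * grad_dot2 A1 g2 k s c p
  + f p ^+ 2 * ev2 (pull2 A1 g2) (vlift A1 U) (vlift A1 W) c p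
    * grad_dot1 A2 g1 k s c p.
Proof.
(* In [bil_mul] the derivative along [U] has to come first, and in [bilZ] the scalar has to stand on
   the left. *)
rewrite [der _ k c p * der (vlift A1 U) s c p]mulrC.
rewrite [X in _ + X + _]mulrC [X in _ + X]mulrC.
rewrite !ev2_vv !der_vlift // -!bil_mul -!bilZ -!bilB -!bilD.
apply: eq_bil => a b.
rewrite (hess_twisted_vv Ac1 Ac2 gc1 gc2 fk sk a b ss cp).
rewrite fk /pull2 /hess2 /vpull !block_mxEdr.
rewrite [pd (V b) k c p * _]mulrC [g2 _ _ _ _ * _]mulrC.
by rewrite [expR _ * _ * _]mulrC.
Qed.

End conditions.

End pointwise.

(** The formulas for Ric(U,V) and Hess sigma(U,V) that accompany (ii) hold independently of the
    equation; they form the first conjunct, and (ii) itself uses the tensors of [g]. *)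
Theorem theorem3p1 (R : realType) (n1 n2 : nat) (M1 M2 : topologicalType)
    (A1 : atlas R n1 M1) (A2 : atlas R n2 M2)
    (g1 : tensor2 A1) (g2 : tensor2 A2)
    (f phi lambda : M1 * M2 -> R) (rho : R)
    (Z1 : vfield A1) (Z2 : vfield A2)
    (n1_gt0 : (0 < n1)%N) (n2_gt0 : (0 < n2)%N)
    (M1_manifold : smooth_manifold A1) (M2_manifold : smooth_manifold A2)
    (g1_metric : pseudo_riemannian g1) (g2_metric : pseudo_riemannian g2)
    (f_smooth : smooth_fun (prod_atlas A1 A2) f) (f_gt0 : forall p, 0 < f p)
    (phi_smooth : smooth_fun (prod_atlas A1 A2) phi)
    (phi_gt0 : forall p, 0 < phi p)
    (lambda_smooth : smooth_fun (prod_atlas A1 A2) lambda)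
    (Z1_smooth : smooth_vfield Z1) (Z2_smooth : smooth_vfield Z2) :
  let A := prod_atlas A1 A2 in
  let n := (n1 + n2)%N in
  let k : M1 * M2 -> R := fun p => ln (f p) in
  let sigma : M1 * M2 -> R := fun p => ln (phi p) in
  let omega : M1 * M2 -> R := fun p => k p + sigma p in
  let g : tensor2 A := twisted_metric g1 g2 f in
  let gL : tensor2 A := fun c p => expR (2 * sigma p) *: g c p in
  let Z : vfield A := fun c p => hlift A2 Z1 c p + vlift A1 Z2 c p in
  let Lambda (c : idx A) (p : M1 * M2) : R := lambda p + rho * scal gL c p in
  let Theta (c : idx A) (p : M1 * M2) : R :=
    laplacian g sigma c p + (n%:R - 2) * grad_sq g sigma c p in
  let Ric_vertical (U V : vfield A) (c : idx A) (p : M1 * M2) : R :=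
    ev2 (pull2 A1 (ric g2)) U V c p
    - (n2%:R - 2) * (ev2 (hess2 A1 g2 k) U V c p - der U k c p * der V k c p)
    - (laplacian2 A1 g2 k c p + (n2%:R - 2) * grad_dot2 A1 g2 k k c p)
      * ev2 (pull2 A1 g2) U V c p
    - f p ^+ 2 * (laplacian1 A2 g1 k c p + n2%:R * grad_dot1 A2 g1 k k c p)
      * ev2 (pull2 A1 g2) U V c p in
  let Hess_sigma_vertical (U V : vfield A) (c : idx A) (p : M1 * M2) : R :=
    ev2 (hess2 A1 g2 sigma) U V c p
    - der U k c p * der V sigma c p - der V k c p * der U sigma c p
    + ev2 (pull2 A1 g2) U V c p * grad_dot2 A1 g2 k sigma c p
    + f p ^+ 2 * ev2 (pull2 A1 g2) U V c p * grad_dot1 A2 g1 k sigma c p in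
  let equation : Prop := forall c p, dom A c p ->
    ric gL c p + 2^-1 *: lie Z gL c p = Lambda c p *: gL c p in
  let condition_i : Prop := forall X1 Y1 : vfield A1,
    smooth_vfield X1 -> smooth_vfield Y1 ->
    let X := hlift A2 X1 in let Y := hlift A2 Y1 in
    forall c p, dom A c p ->
    ev2 (pull1 A2 (ric g1)) X Y c p
    - n2%:R * (ev2 (hess1 A2 g1 k) X Y c p + der X k c p * der Y k c p)
    - (n%:R - 2) * (ev2 (hess1 A2 g1 sigma) X Y c p
                    - der X sigma c p * der Y sigma c p)
    + expR (2 * sigma p) / 2
      * ev2 (lie (hlift A2 Z1) (pull1 A2 g1)) X Y c p
    = (expR (2 * sigma p) * (Lambda c p - der Z sigma c p) + Theta c p)
      * ev2 (pull1 A2 g1) X Y c p in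
  let condition_ii : Prop := forall U2 V2 : vfield A2,
    smooth_vfield U2 -> smooth_vfield V2 ->
    let U := vlift A1 U2 in let V := vlift A1 V2 in
    forall c p, dom A c p ->
    ev2 (ric g) U V c p
    - (n%:R - 2) * (ev2 (hess g sigma) U V c p
                    - der U sigma c p * der V sigma c p)
    + expR (2 * sigma p) * f p ^+ 2 / 2
      * ev2 (lie (vlift A1 Z2) (pull2 A1 g2)) U V c p
    = f p ^+ 2
      * (expR (2 * sigma p) * (Lambda c p - der Z omega c p) + Theta c p)
      * ev2 (pull2 A1 g2) U V c p in
  let condition_iii : Prop := forall (X1 : vfield A1) (U2 : vfield A2),
    smooth_vfield X1 -> smooth_vfield U2 ->
    let X := hlift A2 X1 in let U := vlift A1 U2 in
    forall c p, dom A c p ->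
    (n2%:R - 1) * der2 X U k c p
    + (n%:R - 2) * (der2 X U sigma c p - der X k c p * der U sigma c p
                    - der X sigma c p * der U sigma c p) = 0 in
  (forall U2 V2 : vfield A2, smooth_vfield U2 -> smooth_vfield V2 ->
    let U := vlift A1 U2 in let V := vlift A1 V2 in
    forall c p, dom A c p ->
    ev2 (ric g) U V c p = Ric_vertical U V c p /\
    ev2 (hess g sigma) U V c p = Hess_sigma_vertical U V c p) /\
  (equation <-> condition_i /\ condition_ii /\ condition_iii).
Proof.
have Ac1 c := smooth_manifold_chart M1_manifold c.
have Ac2 c := smooth_manifold_chart M2_manifold c.
have gc1 c := pseudo_riemannian_chart c g1_metric.
have gc2 c := pseudo_riemannian_chart c g2_metric.
move=> A n k sigma omega g gL Z Lambda Theta Ric_vertical Hess_sigma_vertical.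
move=> equation condition_i condition_ii condition_iii.
have sk c1 c2 : csmooth (A := prod_atlas A1 A2) (c := (c1, c2)) k.
  exact (csmooth_ln (is_chart_prod (Ac1 c1) (Ac2 c2)) f_gt0 (f_smooth _)).
have ss c1 c2 : csmooth (A := prod_atlas A1 A2) (c := (c1, c2)) sigma.
  exact (csmooth_ln (is_chart_prod (Ac1 c1) (Ac2 c2)) phi_gt0 (phi_smooth _)).
have fk p : f p ^+ 2 = expR (2 * k p).
  by rewrite expRM_natl /k lnK // posrE.
(* Condition (iii) contains XU(k) and XU(sigma), in which the components of [U] are
   differentiated. *)
have sv2 (U : vfield A2) c2 b : smooth_vfield U ->
    csmooth (c := c2) (fun q : M2 => U c2 q 0 b).
  move=> sU.
  exact (smooth_on_coord b (chart_open (Ac2 c2)) (vfield_smooth sU c2)).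
split.
  move=> U W sU sW /= [c1 c2] p cp; split.
    exact (ric_vertical (Ac1 c1) (Ac2 c2) (gc1 c1) (gc2 c2) fk (sk c1 c2)
      cp U W).
  exact (hess_vertical (Ac1 c1) (Ac2 c2) (gc1 c1) (gc2 c2) fk (sk c1 c2)
    (ss c1 c2) cp U W).
(* The value of [Lambda] at the point is inserted for the number [Lam]. *)
have eq_ll c1 c2 p (cp : dom A (c1, c2) p) a b := equation_ll (Ac1 c1) (Ac2 c2)
  (gc1 c1) (gc2 c2) fk Z1 Z2 (sk c1 c2) (ss c1 c2) cp (Lambda (c1, c2) p) a b.
have eq_vv c1 c2 p (cp : dom A (c1, c2) p) a b := equation_vv (Ac1 c1) (Ac2 c2)
  (gc1 c1) (gc2 c2) fk Z1 Z2 (sk c1 c2) (ss c1 c2) cp (Lambda (c1, c2) p) a b.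
have eq_lv c1 c2 p (cp : dom A (c1, c2) p) a b := equation_lv (Ac1 c1) (Ac2 c2)
  (gc1 c1) (gc2 c2) fk Z1 Z2 (sk c1 c2) (ss c1 c2) cp (Lambda (c1, c2) p) a b.
have eq_vl c1 c2 p (cp : dom A (c1, c2) p) a b := equation_vl (Ac1 c1) (Ac2 c2)
  (gc1 c1) (gc2 c2) fk Z1 Z2 (sk c1 c2) (ss c1 c2) cp (Lambda (c1, c2) p) a b.
have iL c1 c2 p (cp : dom A (c1, c2) p) X Y := condition_iE (Ac1 c1) (Ac2 c2)
  (gc1 c1) Z1 (sk c1 c2) (ss c1 c2) cp X Y.
have iR c1 c2 p X Y := condition_i_rhsE (c1 := c1) (c2 := c2)
  (g1 := g1) (g2 := g2) f sigma Z1 Z2 p (Lambda (c1, c2) p) X Y.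
have iiL c1 c2 p (cp : dom A (c1, c2) p) U W := condition_iiE (Ac1 c1) (Ac2 c2)
  (g1 := g1) (gc2 c2) f Z2 (ss c1 c2) cp U W.
have iiR c1 c2 p U W := condition_ii_rhsE (c1 := c1) (c2 := c2)
  (g1 := g1) (g2 := g2) f k sigma Z1 Z2 p (Lambda (c1, c2) p) U W.
have iiiL c1 c2 p (cp : dom A (c1, c2) p) X U sU := condition_iiiE (Ac1 c1)
  (Ac2 c2) (sk c1 c2) (ss c1 c2) cp X (fun b => sv2 U c2 b sU).
split=> [H|[Hi [Hii Hiii]] [c1 c2] p cp].
  have entry c p i j (cp : dom A c p) :=
    congr1 (fun T : 'M[R]_(n1 + n2) => T i j) (H c p cp).
  split; [|split].
  - move=> X Y sX sY /= [c1 c2] p cp.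
    apply: etrans (iL _ _ _ cp X Y) _; apply: etrans _ (esym (iR c1 c2 p X Y)).
    by apply: eq_bil => a b; exact ((eq_ll _ _ _ cp a b).1 (entry _ _ _ _ cp)).
  - move=> U W sU sW /= [c1 c2] p cp.
    apply: etrans (iiL _ _ _ cp U W) _.
    apply: etrans _ (esym (iiR c1 c2 p U W)).
    by apply: eq_bil => a b; exact ((eq_vv _ _ _ cp a b).1 (entry _ _ _ _ cp)).
  - move=> X U sX sU /= [c1 c2] p cp.
    apply: etrans (iiiL _ _ _ cp X U sU) _.
    by apply: bil_eq0 => a b; exact ((eq_lv _ _ _ cp a b).1 (entry _ _ _ _ cp)).
have [cp1 cp2] := cp.
(* Established once, because both mixed blocks of the matrix equation reduce to it. *)
have iii0 a b : mixed_lhs (c1 := c1) (c2 := c2) k sigma p a b = 0.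
  have [X sX Xp] := exists_vfield M1_manifold 'e_a cp1.
  have [U sU Up] := exists_vfield M2_manifold 'e_b cp2.
  have := etrans (esym (iiiL _ _ _ cp X U sU)) (Hiii X U sX sU (c1, c2) p cp).
  by rewrite Xp Up bil_delta.
apply/matrixP => i j.
case: (split_ordP i) => a ->; case: (split_ordP j) => b ->.
- apply: ((eq_ll _ _ _ cp a b).2 _).
  have [X sX Xp] := exists_vfield M1_manifold 'e_a cp1.
  have [Y sY Yp] := exists_vfield M1_manifold 'e_b cp1.
  have := etrans (esym (iL _ _ _ cp X Y))
    (etrans (Hi X Y sX sY (c1, c2) p cp) (iR c1 c2 p X Y)).
  by rewrite Xp Yp !bil_delta.
- exact ((eq_lv _ _ _ cp a b).2 (iii0 a b)).
- exact ((eq_vl _ _ _ cp b a).2 (iii0 b a)).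
- apply: ((eq_vv _ _ _ cp a b).2 _).
  have [U sU Up] := exists_vfield M2_manifold 'e_a cp2.
  have [W sW Wp] := exists_vfield M2_manifold 'e_b cp2.
  have := etrans (esym (iiL _ _ _ cp U W))
    (etrans (Hii U W sU sW (c1, c2) p cp) (iiR c1 c2 p U W)).
  by rewrite Up Wp !bil_delta.
Qed.
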